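(* Let $(p,j)$ be an irregular pair satisfying the mod $p$ multiplicity one condition $$\dim_{\mathbb{F}_p}\Big(H^1_c(\mathrm{SL}_2(\mathbb{Z}),\mathcal P_{j_0-2}^\vee\otimes\mathbb{F}_p)^+[\mathfrak m_{j_0}]\Big)=1,$$ where $j_0$ is the integer with $2\le j_0\le p-3$ and $j_0\equiv j\pmod{p-1}$. Then for every integer $k\ge2$ with $k\equiv j\pmod{p-1}$ and every normalized eigenform $f\in S_k(\Gamma_0(p),\overline{\mathbb{Q}}_p)^{\rm ord}$ congruent to $E_k^{\rm ord}$ modulo the maximal ideal of $\overline{\mathbb{Z}}_p$, $$\mu(f)\ \le\ \operatorname{ord}_\varpi(a_p(f)-1).$$
   Context: Irregular pair $(p,j)$: $p$ prime, $j\ge 2$ even, $p$ divides the numerator of $B_j/j$ ($B_j$ the Bernoulli number). An embedding $\overline{\mathbb{Q}}\hookrightarrow\overline{\mathbb{Q}}_p$ is fixed; $\omega$ is the Teichmüller character. $E_k^{\rm ord}=-(1-p^{k-1})\frac{B_k}{2k}+\sum_{n\ge1}\big(\sum_{d\mid n,\,p\nmid d}d^{k-1}\big)q^n$. Here $a_p(f)$ is the $U_p$-eigenvalue of $f$ (a $p$-adic unit). Modular symbols. $\Delta_0$ = degree zero divisors on $\mathbb{P}^1(\mathbb{Q})$. For a congruence subgroup $\Gamma$ and a right $\Gamma$-module $V$ (with the orders of torsion elements of $\Gamma$ invertible on $V$), $H^1_c(\Gamma,V)$ is identified with $\operatorname{Hom}_\Gamma(\Delta_0,V)$, the additive maps $\varphi:\Delta_0\to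 V$ with $\varphi(\gamma D)=\varphi(D)|\gamma$; Hecke operators act in the usual way when $V$ carries an action of the relevant matrices, and $\pm$ denotes the $\pm1$ eigenspaces of $\begin{pmatrix}-1&0\\0&1\end{pmatrix}$. $\mathcal P_g$ is the $\mathbb{Z}_p$-module of polynomials over $\mathbb{Q}_p$ of degree $\le g$ mapping $\mathbb{Z}_p$ into $\mathbb{Z}_p$, with left action $(\gamma\cdot P)(z)=(a+cz)^gP\big(\frac{b+dz}{a+cz}\big)$ for $\gamma=\begin{pmatrix}a&b\\c&d\end{pmatrix}$, and $\mathcal P_g^\vee=\operatorname{Hom}(\mathcal P_g,\mathbb{Z}_p)$ with $(\alpha|\gamma)(P)=\alpha(\gamma\cdot P)$. For $g=j_0-2<p$ one has $\mathcal P_g=\mathbb{Z}_p[z]_{\deg\le g}$, so that all integral matrices act. The notation $[\mathfrak m_{j_0}]$ means the subspace killed by $T_\ell-(1+\ell^{j_0-1})$ for all primes $\ell\ne p$ and by $T_p-1$ (i.e. the Hecke eigenspace mod $p$ of $E_{j_0}^{\rm ord}$). $p$-adic $L$-function. Let $\mathcal O$ be the ring of integers of the finite extension of $\mathbb{Q}_p$ generated by the Hecke eigenvalues of $f$, with uniformizer $\varpi$ and $\operatorname{ord}_\varpi(\varpi)=1$. Let $\xi_f(\{r\}-\{s\})(P)=2\pi i\int_s^r f(z)P(z)\,dz$ and $\xi_f=\xi_f^++\xi_f^-$ the decomposition under $\begin{pmatrix}-1&0\\0&1\end{pmatrix}$. Choose a period $\Omega_f^+$ (canonical period) so that $\varphi_f^+=\xi_f^+/\Omega_f^+$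 has algebraic values, all values on $\Delta_0\times\mathcal P_{k-2}$ are $p$-adic integers and at least one is a $p$-adic unit. $L_p^+(f)$ is the measure on $\mathbb{Z}_p^\times$ given by $L_p^+(f)(a+p^n\mathbb{Z}_p)=a_p(f)^{-n}\varphi_f^+(\{\infty\}-\{a/p^n\})(1)$. Its image $L_p^+(f,\omega^0)$ under $[x]\mapsto[x/\omega(x)]$ lies in $\mathcal O[[1+p\mathbb{Z}_p]]$, and $\mu(f)=\mu(f,\omega^0)$ is the largest $n$ with $\varpi^n$ dividing it. *)

(* Defs.v *)
From HB Require Import structures.
From mathcomp Require Import all_boot all_order all_algebra all_field.
From mathcomp Require Import complex freeg.
From mathcomp Require Import all_classical all_reals all_analysis.

Set Implicit Arguments.
Unset Strict Implicit.
Unset Printing Implicit Defensive.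

Import Order.TTheory GRing.Theory Num.Theory.
Import numFieldNormedType.Exports.
Local Open Scope classical_set_scope.
Local Open Scope ring_scope.

(* [:: B_0; ...; B_n], from \sum_(i <= n) 'C(n.+1, i) B_i = 0 for 0 < n *)
Fixpoint bernoulli_seq (n : nat) : seq rat :=
  if n is m.+1 then
    let s := bernoulli_seq m in
    rcons s (- (\sum_(i < m.+1) 'C(m.+2, i)%:R * s`_i) / m.+2%:R)
  else [:: 1].

Definition bernoulli (n : nat) : rat := (bernoulli_seq n)`_n.

Definition irregular_pair (p j : nat) : Prop :=
  [/\ prime p, (2 <= j)%N, ~~ odd j
    & (p%:Z %| numq (bernoulli j / j%:R))%Z].

(* the n-th q-expansion coefficient of E_k^ord *)
Definition eis_ord (p k n : nat) : rat :=
  if n == 0%N then - (1 - p%:R ^+ k.-1) * bernoulli k / (k.*2)%:R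
  else \sum_(d <- divisors n | ~~ (p %| d)%N) d%:R ^+ k.-1.

(* [v] is the additive valuation ord_p, normalised by v(p) = 1; its value at 0
   is irrelevant, since 0 is treated separately in every definition below. *)

Section Padic.
Variables (p : nat) (K : closedFieldType) (v : K -> rat).

Definition ord_ge (q : rat) (x : K) : bool := (x == 0) || (q <= v x).
Definition padic_integral (x : K) : bool := ord_ge 0 x.
Definition in_max (x : K) : bool := (x == 0) || (0 < v x).
Definition padic_unit (x : K) : bool := (x != 0) && (v x == 0).

Definition rat_cauchy (u : nat -> rat) : Prop :=
  forall N : nat, exists M : nat, forall m n : nat,
    (M <= m)%N -> (M <= n)%N -> ord_ge N%:R (ratr (u m) - ratr (u n)).

Definition rat_cvg (u : nat -> rat) (x : K) : Prop :=
  forall N : nat, exists M : nat, forall n : nat,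
    (M <= n)%N -> ord_ge N%:R (ratr (u n) - x).

(* Q_p inside K: the closure of the rational numbers *)
Definition Qp : set K := [set x | exists2 u, rat_cauchy u & rat_cvg u x].

Definition Zp : set K := [set x | Qp x /\ padic_integral x].

(* These conditions determine (K, v) up to isomorphism: the closure of the
   rationals is complete for the p-adic valuation, hence is Q_p, and K is an
   algebraic closure of it. *)
Record is_Qpbar : Prop := IsQpbar {
  Qpbar_p_neq0 : p%:R != 0 :> K;
  Qpbar_ord_p : v p%:R = 1;
  Qpbar_ordM : forall x y, x != 0 -> y != 0 -> v (x * y) = v x + v y;
  Qpbar_ordD : forall q x y, ord_ge q x -> ord_ge q y -> ord_ge q (x + y);
  Qpbar_complete : forall u, rat_cauchy u -> exists x, rat_cvg u x;
  Qpbar_algebraic : forall x, exists P : {poly K},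
    [/\ P != 0, forall i, Qp P`_i & root P x]
}.

Definition subfield_set (S : set K) : Prop :=
  [/\ S 1, forall x y, S x -> S y -> S (x - y),
      forall x y, S x -> S y -> S (x * y) & forall x, S x -> S x^-1].

(* Q_p(f 0, f 1, ...) *)
Definition coef_field (f : nat -> K) : set K :=
  [set x | forall S : set K,
     subfield_set S -> Qp `<=` S -> (forall n, S (f n)) -> S x].

Definition coef_ring (f : nat -> K) : set K :=
  [set x | coef_field f x /\ padic_integral x].

Definition uniformizer (f : nat -> K) (w : K) : Prop :=
  [/\ w != 0, coef_ring f w, in_max w &
      forall x, coef_ring f x -> in_max x ->
        exists2 y, coef_ring f y & x = w * y].

(* the Teichmuller representative of an integer prime to p *)
Definition teichmuller (a : nat) : K :=
  xget 0 [set w : K | w ^+ p.-1 = 1 /\ in_max (w - a%:R)].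

Definition Pg (g : nat) : set {poly K} :=
  [set P : {poly K} | [/\ (size P <= g.+1)%N, forall i, Qp P`_i
             & forall x, Zp x -> Zp P.[x]]].

(* Only the restriction of a functional to [Pg g] is meaningful. *)
Definition Pg_dual (g : nat) : set ({poly K} -> K) :=
  [set al | (forall P, Pg g P -> Zp (al P)) /\
     (forall c P Q, Zp c -> Pg g P -> Pg g Q ->
        al (c *: P + Q) = c * al P + al Q)].

(* equality in Pg_dual / p Pg_dual = Pg_dual (x) F_p *)
Definition eq_Pg_dual_mod (g : nat) (al be : {poly K} -> K) : Prop :=
  exists2 ga, Pg_dual g ga & forall P, Pg g P -> al P - be P = p%:R * ga P.

End Padic.

Definition mx2 (a b c d : int) : 'M[int]_2 :=
  \matrix_(i, j) if i == 0 then (if j == 0 then a else b)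
                 else (if j == 0 then c else d).

Definition mx_neg : 'M[int]_2 := mx2 (- 1) 0 0 1.

Definition SL2Z : set 'M[int]_2 := [set M : 'M[int]_2 | \det M = 1].

Definition Gamma0 (N : nat) : set 'M[int]_2 :=
  [set M : 'M[int]_2 | \det M = 1 /\ (N%:Z %| M 1%R 0%R)%Z].

(* (a + c z)^g P((b + d z) / (a + c z)), for P of degree at most g *)
Definition poly_act (A : comNzRingType) (g : nat) (M : 'M[int]_2)
    (P : {poly A}) : {poly A} :=
  \sum_(i < g.+1)
    P`_i *: (((M 0 1)%:~R%:P + (M 1 1)%:~R *: 'X) ^+ i *
             ((M 0 0)%:~R%:P + (M 1 0)%:~R *: 'X) ^+ (g - i)).

(* P^1(Q), with [None] the cusp at infinity *)
Definition cusp : choiceType := option rat.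

Definition mx_cusp (M : 'M[int]_2) (r : cusp) : cusp :=
  match r with
  | None => if M 1 0 == 0 then None else Some ((M 0 0)%:~R / (M 1 0)%:~R)
  | Some x =>
      if (M 1 0)%:~R * x + (M 1 1)%:~R == 0 then None
      else Some (((M 0 0)%:~R * x + (M 0 1)%:~R) /
                 ((M 1 0)%:~R * x + (M 1 1)%:~R))
  end.

Definition divisor : zmodType := {freeg cusp / int}.

Definition pt (r : cusp) : divisor := << 1 *g r >>.

Definition div_lift (G : zmodType) (h : cusp -> G) (D : divisor) : G :=
  \sum_(c <- dom D) h c *~ coeff c D.

Definition mx_div (M : 'M[int]_2) : divisor -> divisor :=
  div_lift (fun c => pt (mx_cusp M c)).

Definition Delta0 : set divisor := [set D | deg D = 0].

(* An element of Hom_Gamma(Delta_0, P_g^\vee (x) F_p) is represented by a map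
   into P_g^\vee which satisfies the required identities modulo p; two maps
   which are congruent modulo p represent the same element. The values outside
   of [Delta0] and [Pg g] are irrelevant. *)

Section ModularSymbols.
Variables (p : nat) (K : closedFieldType) (v : K -> rat).

Definition symbol : zmodType := (divisor -> {poly K} -> K).

Definition eq_symbol (g : nat) (phi psi : symbol) : Prop :=
  forall D, Delta0 D -> eq_Pg_dual_mod p v g (phi D) (psi D).

(* (phi | M)(D) = phi(M D) | M *)
Definition slash (g : nat) (phi : symbol) (M : 'M[int]_2) : symbol :=
  fun D P => phi (mx_div M D) (poly_act g M P).

(* T_l at level one, the prime l = p included *)
Definition hecke (g l : nat) (phi : symbol) : symbol :=
  \sum_(b < l) slash g phi (mx2 1 b%:Z 0 l%:Z) +
  slash g phi (mx2 l%:Z 0 0 1).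

(* H^1_c(SL_2(Z), P_g^\vee (x) F_p); with right actions, equivariance reads
   phi(gamma D) | gamma = phi(D) *)
Definition H1c (g : nat) : set symbol :=
  [set phi | [/\ forall D, Delta0 D -> Pg_dual v g (phi D),
       forall D D', Delta0 D -> Delta0 D' ->
         eq_Pg_dual_mod p v g (phi (D + D')) (phi D + phi D')
     & forall M, SL2Z M -> eq_symbol g (slash g phi M) phi]].

Definition H1c_plus (g : nat) : set symbol :=
  [set phi | H1c g phi /\ eq_symbol g (slash g phi mx_neg) phi].

(* H^1_c(SL_2(Z), P_(k-2)^\vee (x) F_p)^+ [m_k] *)
Definition H1c_plus_eis (k : nat) : set symbol :=
  [set phi | [/\ H1c_plus (k - 2) phi,
       forall l, prime l -> l != p ->
         eq_symbol (k - 2) (hecke (k - 2) l phi) (phi *+ (1 + l ^ k.-1))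
     & eq_symbol (k - 2) (hecke (k - 2) p phi) phi]].

Definition null_symbol (g : nat) : set symbol :=
  [set phi | eq_symbol g phi 0].

(* dim_(F_p) (M / N) = d, for subgroups M, N with p M contained in N: there is
   a basis of d elements *)
Definition Fp_dim (U : zmodType) (M N : set U) (d : nat) : Prop :=
  exists e : 'I_d -> U,
    [/\ forall i, M (e i),
        forall x, M x -> exists c : 'I_d -> int, N (x - \sum_i e i *~ c i)
      & forall c : 'I_d -> int,
          N (\sum_i e i *~ c i) -> forall i, (p%:Z %| c i)%Z].

Definition mult_one_mod_p (j0 : nat) : Prop :=
  Fp_dim (H1c_plus_eis j0) (null_symbol (j0 - 2)) 1.

End ModularSymbols.

Section ComplexForms.
Variable R : realType.
Local Notation C := R[i].

Definition upper (z : C) : Prop := 0 < complex.Im z.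

Definition mx_upper (M : 'M[int]_2) (z : C) : C :=
  ((M 0 0)%:~R * z + (M 0 1)%:~R) / ((M 1 0)%:~R * z + (M 1 1)%:~R).

Definition autfactor (M : 'M[int]_2) (z : C) : C :=
  (M 1 0)%:~R * z + (M 1 1)%:~R.

(* S_k(Gamma_0(N)) over the complex numbers; the values of F off the upper
   half plane are irrelevant *)
Record cusp_form (N k : nat) (F : C -> C) : Prop := CuspForm {
  cusp_form_holo : forall z, upper z -> derivable (F : C^o -> C^o) z 1;
  cusp_form_mod : forall M z, Gamma0 N M -> upper z ->
    F (mx_upper M z) = autfactor M z ^+ k * F z;
  cusp_form_cusps : forall M, SL2Z M -> forall e : R, 0 < e ->
    exists Y : R, forall z, upper z -> Y < complex.Im z ->
      `| autfactor M z ^- k * F (mx_upper M z) | < (e%:C)%C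
}.

(* exp(2 pi i z) *)
Definition qpar (z : C) : C :=
  ((expR (- (2 * pi * complex.Im z)))%:C *
   (cos (2 * pi * complex.Re z) +i* sin (2 * pi * complex.Re z)))%C.

Definition q_expansion (F : C -> C) (a : nat -> C) : Prop :=
  forall z, upper z ->
    (fun n => \sum_(i < n) a i * qpar z ^+ i) @ \oo --> (F z : C^o).

Variables (K : closedFieldType) (iinf : {rmorphism algC -> C})
  (ip : {rmorphism algC -> K}).

(* f is the q-expansion of F, which is defined over the algebraic numbers,
   carried to K by the embeddings *)
Definition q_expansion_in (F : C -> C) (f : nat -> K) : Prop :=
  exists a : nat -> algC,
    q_expansion F (fun n => iinf (a n)) /\ (forall n, f n = ip (a n)).

End ComplexForms.

(* T_l (l <> p) and U_p on q-expansions, at level p and weight k *)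
Definition hecke_q (K : fieldType) (p k l : nat) (f : nat -> K) : nat -> K :=
  fun n => f (l * n)%N +
    (if (l != p) && (l %| n)%N then l%:R ^+ k.-1 * f (n %/ l)%N else 0).

Definition normalized_eigenform (K : fieldType) (p k : nat) (f : nat -> K) :
  Prop :=
  f 1%N = 1 /\
  (forall l, prime l -> exists c : K, forall n, hecke_q p k l f n = c * f n).

Section Lfunction.
Variables (R : realType) (p : nat) (K : closedFieldType) (v : K -> rat).
Variables (iinf : {rmorphism algC -> R[i]}) (ip : {rmorphism algC -> K}).
Local Notation C := R[i].

Definition Cintegral (G : R -> C) : C :=
  ((\int[lebesgue_measure]_(t in `]0%R, +oo[) complex.Re (G t)) +i*
   (\int[lebesgue_measure]_(t in `]0%R, +oo[) complex.Im (G t)))%C.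

(* the integral of F(z) P(z) dz from s to infinity, along z = s + i t *)
Definition vert_integral (F : C -> C) (P : {poly C}) (s : rat) : C :=
  let z (t : R) : C := (ratr s +i* t)%C in
  Cintegral (fun t => F (z t) * P.[z t] * (0 +i* 1)%C).

(* xi_f({r} - {s})(P) = 2 pi i \int_s^r F P dz, the path from s to r being
   taken through infinity along vertical lines *)
Definition xi (F : C -> C) (D : divisor) (P : {poly C}) : C :=
  div_lift (fun c : cusp =>
    if c is Some r then - ((0 +i* (2 * pi))%C * vert_integral F P r) else 0) D.

Definition xi_plus (k : nat) (F : C -> C) (D : divisor) (P : {poly C}) : C :=
  (xi F D P + xi F (mx_div mx_neg D) (poly_act (k - 2) mx_neg P)) / 2.

Definition alg_part (z : C) : algC := xget 0 [set x : algC | iinf x = z].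

(* phi_f^+ = xi_f^+ / Om, extended linearly from the monomials to polynomials
   with p-adic coefficients *)
Definition phi_plus (k : nat) (F : C -> C) (Om : C) (D : divisor)
    (P : {poly K}) : K :=
  \sum_(i < (k - 2).+1) P`_i * ip (alg_part (xi_plus k F D 'X^i / Om)).

Record canonical_period (k : nat) (F : C -> C) (Om : C) : Prop :=
  CanonicalPeriod {
  period_neq0 : Om != 0;
  period_algebraic : forall D (i : nat), Delta0 D -> (i <= k - 2)%N ->
    exists x : algC, iinf x = xi_plus k F D 'X^i / Om;
  period_integral : forall D P, Delta0 D -> Pg v (k - 2) P ->
    padic_integral v (phi_plus k F Om D P);
  period_unit : exists D P,
    [/\ Delta0 D, Pg v (k - 2) P & padic_unit v (phi_plus k F Om D P)]
}.

(* L_p^+(f)(a + p^n Z_p), for n > 0 and a prime to p *)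
Definition Lp_plus (k : nat) (f : nat -> K) (F : C -> C) (Om : C)
    (n a : nat) : K :=
  f p ^- n * phi_plus k F Om (pt None - pt (Some (a%:R / p%:R ^+ n))) 1.

(* The value at b + p^n Z_p (n > 0, b = 1 mod p) of the image of L_p^+(f) under
   x |-> x / omega(x): the inverse image of this ball is the union of the
   a + p^n Z_p with a / omega(a) in b + p^n Z_p. *)
Definition Lp_plus_omega0 (k : nat) (f : nat -> K) (F : C -> C) (Om : C)
    (n b : nat) : K :=
  \sum_(a < p ^ n | coprime a p &&
      padic_integral v ((a%:R / teichmuller p v a - b%:R) / p%:R ^+ n))
    Lp_plus k f F Om n a.

(* A measure on 1 + p Z_p with p-adically integral values, i.e. an element of
   the Iwasawa algebra, given by its values [lam n b] on the balls
   b + p^n Z_p, n > 0, b = 1 mod p *)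
Definition integral_measure (lam : nat -> nat -> K) : Prop :=
  forall n b : nat, (0 < n)%N -> (b = 1 %[mod p])%N ->
    [/\ padic_integral v (lam n b),
        forall b', (b' = b %[mod p ^ n])%N -> lam n b' = lam n b
      & lam n b = \sum_(i < p) lam n.+1 (b + i * p ^ n)%N].

(* Integrality is tested in the integers of K: a canonical period is only
   determined up to an algebraic p-adic unit. When the values of [nu] are in
   the coefficient field of f, so are those of [lam]. *)
Definition measure_dvd (c : K) (nu : nat -> nat -> K) : Prop :=
  exists2 lam, integral_measure lam &
    forall n b : nat, (0 < n)%N -> (b = 1 %[mod p])%N -> nu n b = c * lam n b.

Definition sup_nat (A : set nat) : \bar R :=
  ereal_sup [set (n%:R : R)%:E | n in A].

Definition mu_invariant (k : nat) (f : nat -> K) (F : C -> C) (Om : C)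
    (w : K) : \bar R :=
  sup_nat [set n | measure_dvd (w ^+ n) (Lp_plus_omega0 k f F Om)].

(* +oo at x = 0 *)
Definition ord_unif (f : nat -> K) (w x : K) : \bar R :=
  sup_nat [set n | exists2 y, coef_ring v f y & x = w ^+ n * y].

End Lfunction.

(* Main.v *)
Require Import Defs.
From HB Require Import structures.
From mathcomp Require Import all_boot all_order all_algebra all_field.
From mathcomp Require Import complex freeg.
From mathcomp Require Import all_classical all_reals all_analysis.
From mathcomp Require Import measurable_realfun.
From mathcomp Require Import ring lra zify.

(** The measure is evaluated on one set, the whole of 1 + p Z_p. By the eigenvalue equation of U_p
    its total mass is a_p^-1 (a_p - 1) u, with u = phi({oo} - {0})(1) for the normalised symbol phi
    ([total_mass]). A power of the uniformizer which divides the measure divides the total mass, and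
    the bound follows if u is a p-adic unit ([phi_infty_unit]).

    To see that u is a unit, let m be the maximal ideal of the p-adic integers. Some value
    phi(D)(1) at the constant polynomial is outside m: otherwise all values would be in m, because
    U_p has a unit eigenvalue and replaces polynomials by polynomials that are closer to constants
    ([phi_one_max]), and this contradicts the choice of the period. A linear form from the residue
    field to its prime field ([residue_form]) turns D |-> phi(D)(1) into a nonzero additive map psi
    with values modulo p. It satisfies U_p psi = psi, it is an eigenvector of T_l with the
    eigenvalue of the Eisenstein series, and Gamma0(p) acts on it through a^(k-2), that is, through
    a^(j0-2). Summing over the projective line over the field with p elements makes psi a symbol of
    level one and weight j0, with the same eigenvalues, whose value at the constant polynomial is
    psi ([induced_one], [induced_Up], [induced_Tl]). The boundary symbol, which sends the cusp x / y
    to the evaluation of forms at (- y, x), has the same eigenvalues, and its value on {oo} - {0} at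
    1 is -1. By multiplicity one the first symbol is a multiple of the second. If u were in m, the
    multiple would be zero, and so would psi ([constant_symbol_vanish]). This needs j0 > 2, but for
    j0 = 2 the space in the hypothesis vanishes ([mult_one_weight2]).

    The relations satisfied by phi come from the periods of the cusp form. The q-expansion provides
    a primitive of F P ([Fint]), the periods are the limits of this primitive at the cusps ([XiE]),
    and an identity between differential forms becomes one between periods ([Xi_relation]). The
    limits exist and compute the integrals because F decays exponentially at all cusps, each of
    which is equivalent to oo or to 0 under Gamma0(p). At oo the decay is visible in the
    q-expansion; at 0 it follows from the equation of U_p, which relates F at 0 to its scaling by p
    ([Wfun_decay]). *)

Set Implicit Arguments.
Unset Strict Implicit.
Unset Printing Implicit Defensive.

Import Order.TTheory GRing.Theory Num.Theory.
Import numFieldNormedType.Exports.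
Import ComplexField.Normc.
Local Open Scope classical_set_scope.
Local Open Scope ring_scope.

(** * Complex differentiation *)

Section ComplexNorm.
Variable R : realType.
Local Notation C := R[i].
Local Notation nrm := (@normc R).
Implicit Types (z w l : C) (x y e : R).

Lemma nrm_ge0 z : 0 <= nrm z.
Proof. by case: z => a b; rewrite sqrtr_ge0. Qed.

Lemma nrm_eq0 z : (nrm z == 0) = (z == 0).
Proof.
by apply/eqP/eqP => [/eq0_normc//|->]; rewrite /= expr0n /= addr0 sqrtr0.
Qed.

Lemma nrm_gt0 z : (0 < nrm z) = (z != 0).
Proof. by rewrite lt_def nrm_eq0 nrm_ge0 andbT. Qed.

Lemma nrm0 : nrm 0 = 0.
Proof. by apply/eqP; rewrite nrm_eq0. Qed.

Lemma nrm_real x : nrm (x%:C)%C = `|x|.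
Proof. by rewrite /= expr0n /= addr0 sqrtr_sqr. Qed.

Lemma nrm1 : nrm 1 = 1.
Proof. exact: (normc1 R). Qed.

Lemma nrmX z n : nrm (z ^+ n) = nrm z ^+ n.
Proof. by elim: n => [|n IH]; rewrite ?expr0 ?nrm1 // !exprS normcM IH. Qed.

Lemma nrm_nat n : nrm n%:R = n%:R.
Proof.
have -> : (n%:R : C) = ((n%:R : R)%:C)%C by rewrite rmorph_nat.
by rewrite nrm_real ger0_norm.
Qed.

Lemma nrmB z w : nrm (z - w) = nrm (w - z).
Proof. by rewrite -normcN opprB. Qed.

Lemma nrm_le_dist z w : nrm z - nrm w <= nrm (z - w).
Proof. by rewrite lerBlDr; apply: le_trans (le_normcD _ _); rewrite subrK. Qed.

Lemma nrm_sum (I : Type) (r : seq I) (P : pred I) (f : I -> C) :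
  nrm (\sum_(i <- r | P i) f i) <= \sum_(i <- r | P i) nrm (f i).
Proof.
elim/big_ind2: _ => [|x1 x2 y1 y2 h1 h2|//]; first by rewrite nrm0.
by apply: le_trans (le_normcD _ _) _; apply: lerD.
Qed.

Lemma Re_le_nrm z : `|complex.Re z| <= nrm z.
Proof.
case: z => a b /=; rewrite -[leLHS]sqrtr_sqr; apply: ler_wsqrtr.
by rewrite lerDl sqr_ge0.
Qed.

Lemma Im_le_nrm z : `|complex.Im z| <= nrm z.
Proof.
case: z => a b /=; rewrite -[leLHS]sqrtr_sqr; apply: ler_wsqrtr.
by rewrite lerDr sqr_ge0.
Qed.

Lemma nrm_le_ReIm z : nrm z <= `|complex.Re z| + `|complex.Im z|.
Proof.
case: z => a b.
have -> : (a +i* b)%C = (a%:C + 'i * b%:C)%C by rewrite [LHS]complexE.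
apply: le_trans (le_normcD _ _) _; rewrite normcM !nrm_real /=.
by rewrite /= !(expr0n, expr1n) /= !add0r sqrtr1 !mul0r !mul1r subr0 addr0 !add0r.
Qed.

Lemma ReD z w : complex.Re (z + w) = complex.Re z + complex.Re w.
Proof. by case: z w => [a b] [c d]. Qed.
Lemma ImD z w : complex.Im (z + w) = complex.Im z + complex.Im w.
Proof. by case: z w => [a b] [c d]. Qed.
Lemma ReN z : complex.Re (- z) = - complex.Re z.
Proof. by case: z. Qed.
Lemma ImN z : complex.Im (- z) = - complex.Im z.
Proof. by case: z. Qed.
Lemma ReB z w : complex.Re (z - w) = complex.Re z - complex.Re w.
Proof. by rewrite ReD ReN. Qed.
Lemma ImB z w : complex.Im (z - w) = complex.Im z - complex.Im w.
Proof. by rewrite ImD ImN. Qed.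
Lemma ReM_real x z : complex.Re ((x%:C)%C * z) = x * complex.Re z.
Proof. by case: z => a b /=; rewrite mul0r subr0. Qed.
Lemma ImM_real x z : complex.Im ((x%:C)%C * z) = x * complex.Im z.
Proof. by case: z => a b /=; rewrite mul0r addr0. Qed.
Lemma eqC z w : complex.Re z = complex.Re w -> complex.Im z = complex.Im w -> z = w.
Proof. by case: z w => [a b] [c d] /= -> ->. Qed.

End ComplexNorm.

Section ComplexDerivative.
Variable R : realType.
Local Notation C := R[i].
Local Notation nrm := (@normc R).
Implicit Types (G H : C -> C) (z w l m : C).

Definition ccont G z := forall e : R, 0 < e -> exists2 d : R, 0 < d &
  forall w, nrm (w - z) < d -> nrm (G w - G z) < e.

(** Caratheodory's form of the derivative: the difference quotient extends to a function
    [rho] that is continuous at [z]. The chain rule then composes these functions, without a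
    separate case for an inner function that repeats its value. *)
Definition cderiv G z l := exists rho : C -> C,
  [/\ forall w, G w - G z = rho w * (w - z), ccont rho z & rho z = l].

Lemma ccontD G H z : ccont G z -> ccont H z -> ccont (fun w => G w + H w) z.
Proof.
move=> hG hH e e0; have e2 : 0 < e / 2 by rewrite divr_gt0.
have [d1 d10 h1] := hG _ e2; have [d2 d20 h2] := hH _ e2.
exists (Num.min d1 d2) => [|w]; rewrite lt_min ?d10 // => /andP[w1 w2].
have -> : G w + H w - (G z + H z) = (G w - G z) + (H w - H z) by ring.
apply: le_lt_trans (le_normcD _ _) _.
by rewrite (splitr e); apply: ltrD; [exact: h1|exact: h2].
Qed.

Lemma ccont_cst a z : ccont (fun=> a) z.
Proof. by move=> e e0; exists 1 => // w _; rewrite subrr nrm0. Qed.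

Lemma ccont_id z : ccont id z.
Proof. by move=> e e0; exists e. Qed.

Lemma ccont_bound G z : ccont G z -> exists2 d : R, 0 < d &
  forall w, nrm (w - z) < d -> nrm (G w) <= nrm (G z) + 1.
Proof.
move=> /(_ 1 ltr01)[d d0 h]; exists d => // w /h h1.
by rewrite -lerBlDl; apply: le_trans (nrm_le_dist _ _) (ltW h1).
Qed.

Lemma ccontM G H z : ccont G z -> ccont H z -> ccont (fun w => G w * H w) z.
Proof.
move=> hG hH e e0.
have [d0 d00 h0] := ccont_bound hG.
set A := nrm (G z) + 1 in h0; have A0 : 0 < A by rewrite ltr_wpDl // nrm_ge0.
set B := nrm (H z) + 1; have B0 : 0 < B by rewrite ltr_wpDl // nrm_ge0.
have [d1 d10 h1] := hG (e / 2 / B) (divr_gt0 (divr_gt0 e0 (ltr0Sn _ _)) B0).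
have [d2 d20 h2] := hH (e / 2 / A) (divr_gt0 (divr_gt0 e0 (ltr0Sn _ _)) A0).
exists (Num.min d0 (Num.min d1 d2)) => [|w]; rewrite !lt_min ?d00 ?d10 ?d20 //.
move=> /and3P[w0 w1 w2].
have -> : G w * H w - G z * H z = G w * (H w - H z) + (G w - G z) * H z by ring.
apply: le_lt_trans (le_normcD _ _) _; rewrite !normcM.
rewrite [ltRHS](splitr e); apply: ltr_leD.
  apply: le_lt_trans (_ : _ <= A * nrm (H w - H z)) _.
    by apply: ler_wpM2r; [exact: nrm_ge0|exact: h0].
  by rewrite mulrC -ltr_pdivlMr //; exact: h2.
apply: le_trans (_ : _ <= (e / 2 / B) * B) _; last by rewrite divfK ?gt_eqF.
apply: ler_pM; rewrite ?nrm_ge0 //; first by apply/ltW/h1.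
by rewrite lerDl.
Qed.

Lemma ccont_comp G H z : ccont H z -> ccont G (H z) -> ccont (fun w => G (H w)) z.
Proof.
move=> hH hG e /hG[d /hH[d' d'0 h'] h]; exists d' => // w /h' /h; exact.
Qed.

Lemma ccontV z : z != 0 -> ccont (fun w => w^-1) z.
Proof.
rewrite -nrm_gt0 => z0 e e0.
exists (Num.min (nrm z / 2) (e * (nrm z ^+ 2 / 2))).
  by rewrite lt_min divr_gt0 // mulr_gt0 // divr_gt0 // exprn_gt0.
move=> w; rewrite lt_min => /andP[w1 w2].
have w3 : nrm z / 2 < nrm w.
  have := nrm_le_dist z w; rewrite nrmB => h.
  have := le_lt_trans h w1; lra.
have w4 : 0 < nrm w by apply: lt_trans w3; rewrite divr_gt0.
have z1 : z != 0 by rewrite -nrm_gt0.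
have w5 : w != 0 by rewrite -nrm_gt0.
have -> : w^-1 - z^-1 = (z - w) * (w * z)^-1 by field; apply/andP.
rewrite normcM normcV normcM ltr_pdivrMr ?mulr_gt0 // nrmB.
apply: lt_le_trans w2 _; rewrite ler_pM2l //.
by rewrite expr2 mulrAC; apply: ler_wpM2r; exact: ltW.
Qed.

Lemma cderiv_cont G z l : cderiv G z l -> ccont G z.
Proof.
case=> rho [h1 h2 h3].
have -> : G = fun w => rho w * (w + - z) + G z.
  by apply/funext => w; rewrite -h1 subrK.
apply: ccontD (@ccont_cst _ _); apply: ccontM h2 _.
by apply: ccontD (@ccont_id _) (@ccont_cst _ _).
Qed.

Lemma cderiv_eq G z l l' : cderiv G z l -> l = l' -> cderiv G z l'.
Proof. by move=> h <-. Qed.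

Lemma cderiv_ext G H z l : G =1 H -> cderiv G z l -> cderiv H z l.
Proof. by move=> /funext ->. Qed.

Lemma cderiv_cst a z : cderiv (fun=> a) z 0.
Proof. by exists (fun=> 0); split => // [w|]; [rewrite subrr mul0r|exact: ccont_cst]. Qed.

Lemma cderiv_id z : cderiv id z 1.
Proof. by exists (fun=> 1); split => // [w|]; [rewrite mul1r|exact: ccont_cst]. Qed.

Lemma cderivD G H z l m : cderiv G z l -> cderiv H z m ->
  cderiv (fun w => G w + H w) z (l + m).
Proof.
move=> [r1 [h1 c1 e1]] [r2 [h2 c2 e2]]; exists (fun w => r1 w + r2 w); split.
- by move=> w; rewrite mulrDl -h1 -h2; ring.
- exact: ccontD.
- by rewrite e1 e2.
Qed.

Lemma cderivM G H z l m : cderiv G z l -> cderiv H z m ->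
  cderiv (fun w => G w * H w) z (l * H z + G z * m).
Proof.
move=> [r1 [h1 c1 e1]] hH; have cH := cderiv_cont hH; case: hH => [r2 [h2 c2 e2]].
exists (fun w => r1 w * H w + G z * r2 w); split.
- move=> w; rewrite mulrDl -[X in _ = _ + X]mulrA -h2 -mulrA [H w * _]mulrC mulrA -h1; ring.
- apply: ccontD; first exact: ccontM.
  exact: ccontM (@ccont_cst _ _) c2.
- by rewrite e1 e2.
Qed.

Lemma cderivZ a G z l : cderiv G z l -> cderiv (fun w => a * G w) z (a * l).
Proof.
move=> h; apply: cderiv_eq (cderivM (cderiv_cst a z) h) _.
by rewrite mul0r add0r.
Qed.

Lemma cderivB G H z l m : cderiv G z l -> cderiv H z m ->
  cderiv (fun w => G w - H w) z (l - m).
Proof.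
move=> hG hH; have := cderivD hG (cderivZ (-1) hH); rewrite mulN1r.
by apply: cderiv_ext => w; rewrite mulN1r.
Qed.

Lemma cderiv_sum n (G : nat -> C -> C) z (l : nat -> C) :
  (forall i, (i < n)%N -> cderiv (G i) z (l i)) ->
  cderiv (fun w => \sum_(i < n) G i w) z (\sum_(i < n) l i).
Proof.
elim: n => [|n IH] h.
  rewrite big_ord0; apply: cderiv_ext (cderiv_cst 0 z) => w; by rewrite big_ord0.
rewrite big_ord_recr /=.
have := cderivD (IH (fun i hi => h i (ltnW hi))) (h n (ltnSn n)).
by apply: cderiv_ext => w; rewrite big_ord_recr.
Qed.

Lemma cderiv_comp G H z l m : cderiv H z m -> cderiv G (H z) l ->
  cderiv (fun w => G (H w)) z (l * m).
Proof.
move=> hH; have cH := cderiv_cont hH; case: hH => [r2 [h2 c2 e2]] [r1 [h1 c1 e1]].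
exists (fun w => r1 (H w) * r2 w); split.
- by move=> w; rewrite h1 h2 mulrA.
- by apply: ccontM => //; apply: ccont_comp.
- by rewrite e1 e2.
Qed.

Lemma cderivV z : z != 0 -> cderiv (fun w => w^-1) z (- z ^- 2).
Proof.
move=> z0; exists (fun w => if w == 0 then z ^- 2 else - (w * z)^-1); split.
- move=> w; case: eqVneq => [->|w0]; first by rewrite invr0; field.
  by field; rewrite z0.
- move=> e e0.
  have z1 : 0 < nrm z by rewrite nrm_gt0.
  have hc : ccont (fun w => - z^-1 * w^-1) z.
    by apply: ccontM (@ccont_cst _ _) (ccontV z0).
  have [d d0 h] := hc e e0; exists (Num.min d (nrm z)); first by rewrite lt_min d0.
  move=> w; rewrite lt_min => /andP[w1 w2].
  have w0 : w != 0.
    apply: contraTneq w2 => ->; by rewrite sub0r normcN ltxx.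
  rewrite (negbTE w0) (negbTE z0); have := h w w1.
  by rewrite !invfM [w^-1 * _]mulrC !mulNr.
- by rewrite (negbTE z0) expr2.
Qed.

Lemma cderivX n G z l : cderiv G z l ->
  cderiv (fun w => G w ^+ n) z (n%:R * G z ^+ n.-1 * l).
Proof.
move=> h; elim: n => [|n IH].
  by apply: cderiv_ext (cderiv_eq (cderiv_cst 1 z) _) => [w|]; rewrite ?expr0 ?mul0r.
apply: cderiv_ext (cderiv_eq (cderivM h IH) _) => [w|]; first by rewrite exprS.
case: n {IH} => [|n] /=; first by rewrite !expr0; ring.
by rewrite exprS -[n.+2%:R]natr1; ring.
Qed.

Lemma cderiv_horner (P : {poly C}) z : cderiv (fun w => P.[w]) z P^`().[z].
Proof.
elim/poly_ind: P => [|P c IH].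
  by apply: cderiv_ext (cderiv_eq (cderiv_cst 0 z) _) => [w|]; rewrite ?deriv0 ?horner0.
apply: cderiv_ext (cderiv_eq (cderivD (cderivM IH (cderiv_id z)) (cderiv_cst c z)) _).
  by move=> w /=; rewrite !hornerE.
by rewrite derivD derivM derivX derivC !hornerE addrC.
Qed.

Lemma cderiv_local G H z l (d : R) : 0 < d ->
  (forall w, nrm (w - z) < d -> G w = H w) -> cderiv G z l -> cderiv H z l.
Proof.
move=> d0 h [r [h1 c1 e1]].
exists (fun w => if nrm (w - z) < d then r w else (H w - H z) / (w - z)).
have zd : nrm (z - z) < d by rewrite subrr nrm0.
split.
- move=> w; case: ifPn => hw; first by rewrite -h1 h // h.
  rewrite divfK // -nrm_gt0; apply: lt_le_trans d0 _; by rewrite leNgt.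
- move=> e /c1[d' d'0 h']; exists (Num.min d d') => [|w]; first by rewrite lt_min d0.
  rewrite lt_min zd => /andP[w1 w2]; rewrite w1; exact: h'.
- by rewrite zd.
Qed.

(** The entry point for power series and for the exponential, where Taylor estimates give a
    quadratic error. *)
Lemma cderiv_quad G z l (K d : R) : 0 < d ->
  (forall w, nrm (w - z) < d -> nrm (G w - G z - l * (w - z)) <= K * nrm (w - z) ^+ 2) ->
  cderiv G z l.
Proof.
move=> d0 h; exists (fun w => if w == z then l else (G w - G z) / (w - z)); split.
- move=> w; case: eqVneq => [->|w0]; first by rewrite !subrr mulr0.
  by rewrite divfK // subr_eq0.
- move=> e e0; pose K' := `|K| + 1.
  have K0 : 0 < K' by rewrite ltr_wpDl.
  exists (Num.min d (e / K')) => [|w]; first by rewrite lt_min d0 divr_gt0.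
  rewrite lt_min eqxx => /andP[w1 w2].
  case: (eqVneq w z) => [_|w0]; first by rewrite subrr nrm0.
  have w3 : w - z != 0 by rewrite subr_eq0.
  have -> : (G w - G z) / (w - z) - l = (G w - G z - l * (w - z)) / (w - z).
    by field.
  rewrite normcM normcV ltr_pdivrMr ?nrm_gt0 //.
  apply: le_lt_trans (h w w1) _.
  rewrite expr2 mulrA ltr_pM2r ?nrm_gt0 //.
  apply: le_lt_trans (_ : _ <= K' * nrm (w - z)) _.
    apply: ler_wpM2r; first exact: nrm_ge0.
    by apply: le_trans (ler_norm K) _; rewrite lerDl.
  by rewrite mulrC -ltr_pdivlMr.
- by rewrite eqxx.
Qed.

(** The difference quotients at the periods are 0, and they tend to the derivative. *)
Lemma cderiv_small_periods G z l : cderiv G z l ->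
  (forall e : R, 0 < e -> exists h, [/\ h != 0, nrm h < e & G (z + h) = G z]) ->
  l = 0.
Proof.
move=> [r [h1 c1 e1]] hp; apply/eqP; rewrite -nrm_eq0 eq_le nrm_ge0 andbT.
apply/ler_addgt0Pr => e e0; have [d d0 h] := c1 e e0.
have [h0 [h00 h0d hG]] := hp d d0.
have := h (z + h0); rewrite addrC addKr => /(_ h0d); rewrite addrC.
have := h1 (z + h0); rewrite hG subrr [z + h0 - z]addrC addKr => /esym/eqP.
rewrite mulf_eq0 (negbTE h00) orbF => /eqP ->.
by rewrite addr0 normcN e1 add0r => /ltW.
Qed.

(** Along a line, real and imaginary parts have real derivatives, which gives access to the
    mean value theorem and to the fundamental theorem of calculus. *)
Lemma cderiv_line_Re G (z v : C) (t : R) l : cderiv G (z + t%:C%C * v) l ->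
  is_derive t (1 : R) (fun s : R => complex.Re (G (z + s%:C%C * v))) (complex.Re (l * v)).
Proof.
case=> r [h1 c1 e1]; set f := fun s : R => _.
have key : (h^-1 *: (f (h *: 1 + t) - f t)) @[h --> (0 : R)^'] --> complex.Re (l * v).
  apply/cvgrPdist_lt => e e0.
  have v0 : 0 < nrm v + 1 by rewrite ltr_wpDl // nrm_ge0.
  have [d d0 h] := c1 (e / (nrm v + 1)) (divr_gt0 e0 v0).
  near=> s.
  have s0 : s != 0 by near: s; exact: nbhs_dnbhs_neq.
  have sd : `|s| < d / (nrm v + 1).
    near: s; apply: dnbhs0_lt; exact: divr_gt0.
  set w := z + (t%:C)%C * v in h1 h e1 *.
  have E : z + ((s *: (1 : R) + t)%:C)%C * v = w + (s%:C)%C * v.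
    by rewrite /w scaler1 rmorphD /=; ring.
  rewrite /f E -ReB h1 [w + _ - w]addrC addKr mulrCA ReM_real.
  rewrite /GRing.scale /= mulKf // -ReB -mulrBl.
  apply: le_lt_trans (Re_le_nrm _) _; rewrite normcM nrmB.
  have sv : nrm (w + (s%:C)%C * v - w) < d.
    rewrite [w + _ - w]addrC addKr normcM nrm_real.
    apply: le_lt_trans (_ : _ <= `|s| * (nrm v + 1)) _.
      by apply: ler_wpM2l => //; rewrite lerDl.
    by rewrite -ltr_pdivlMr.
  have := h _ sv; rewrite e1 => h'.
  apply: le_lt_trans (_ : _ <= nrm (r (w + (s%:C)%C * v) - l) * (nrm v + 1)) _.
    by apply: ler_wpM2l; [exact: nrm_ge0|rewrite lerDl].
  by rewrite -ltr_pdivlMr.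
split; first exact/(cvgP _ key).
exact/cvg_lim.
Unshelve. all: by end_near. Qed.

Lemma cderiv_line_Im G (z v : C) (t : R) l : cderiv G (z + t%:C%C * v) l ->
  is_derive t (1 : R) (fun s : R => complex.Im (G (z + s%:C%C * v))) (complex.Im (l * v)).
Proof.
move=> h; have E x : complex.Im x = complex.Re (- ('i%C : C) * x).
  by case: x => a b /=; rewrite oppr0 mul0r mulN1r sub0r opprK.
rewrite E mulrA; have := cderiv_line_Re (cderivZ (- ('i%C : C)) h).
rewrite (_ : (fun s => _) = (fun s : R => complex.Im (G (z + (s%:C)%C * v)))) //.
by apply/funext => s; rewrite E.
Qed.

(** The factor 2 is the price of applying the mean value theorem to the real and imaginary
    parts separately. *)
Lemma cderiv_mvi G (dG : C -> C) z w (M : R) :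
  (forall t : R, 0 <= t <= 1 -> cderiv G (z + t%:C%C * (w - z)) (dG (z + t%:C%C * (w - z)))) ->
  (forall t : R, 0 <= t <= 1 -> nrm (dG (z + t%:C%C * (w - z))) <= M) ->
  nrm (G w - G z) <= 2 * M * nrm (w - z).
Proof.
move=> hd hM; set v := w - z in hd hM *.
have aux (pr : C -> R) (hpr : forall x y, pr (x - y) = pr x - pr y)
   (hle : forall x, `|pr x| <= nrm x)
   (hder : forall (t : R) l, cderiv G (z + t%:C%C * v) l ->
     is_derive t (1 : R) (fun s : R => pr (G (z + s%:C%C * v))) (pr (l * v))) :
   `|pr (G w - G z)| <= M * nrm v.
  have hd' (t : R) : 0 <= t <= 1 -> is_derive t (1 : R)
      (fun s : R => pr (G (z + s%:C%C * v))) (pr (dG (z + t%:C%C * v) * v)).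
    by move=> /hd; exact: hder.
  have [||c c01 hc] := @MVT_segment R (fun s : R => pr (G (z + s%:C%C * v)))
     (fun t => pr (dG (z + t%:C%C * v) * v)) 0 1 ler01.
  - by move=> x; rewrite in_itv /= => /andP[x0 x1]; apply: hd'; rewrite !ltW.
  - apply: derivable_within_continuous => x; rewrite in_itv /= => hx.
    by have [] := hd' _ hx.
  move: hc; rewrite subr0 mulr1 rmorph0 rmorph1 mul0r addr0 mul1r [z + v]addrC subrK.
  rewrite hpr => ->; apply: le_trans (hle _) _; rewrite normcM.
  by apply: ler_wpM2r; [exact: nrm_ge0|apply: hM; move: c01; rewrite in_itv].
apply: le_trans (nrm_le_ReIm _) _.
have h1 := aux _ (@ReB R) (@Re_le_nrm R) (@cderiv_line_Re G z v).
have h2 := aux _ (@ImB R) (@Im_le_nrm R) (@cderiv_line_Im G z v).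
by rewrite -mulrA mulr_natl mulr2n; exact: lerD.
Qed.

End ComplexDerivative.

(** * Series of complex numbers *)

Section Series.
Variable R : realType.
Local Notation C := R[i].
Local Notation nrm := (@normc R).
Implicit Types (c d : nat -> C) (s t z : C).

Definition chas c s := forall e : R, 0 < e -> exists N, forall n, (N <= n)%N ->
  nrm (\sum_(i < n) c i - s) < e.

Definition csum c : C := xget 0 [set s | chas c s].

(** The partial sums of [|u|] and of [|u| + u] are nondecreasing and bounded, and [u] is the
    difference of the two. *)
Lemma real_series_cvg (u : nat -> R) (M : R) :
  (forall n, \sum_(i < n) `|u i| <= M) ->
  exists s : R, forall e : R, 0 < e -> exists N, forall n, (N <= n)%N ->
    `|\sum_(i < n) u i - s| < e.
Proof.
have pos (w : nat -> R) (M' : R) : (forall i, 0 <= w i) ->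
    (forall n, \sum_(i < n) w i <= M') -> exists s : R, forall e : R, 0 < e ->
    exists N, forall n, (N <= n)%N -> `|\sum_(i < n) w i - s| < e.
  move=> w0 hw; pose S (n : nat) := \sum_(i < n) w i.
  have nd : nondecreasing_seq S.
    apply/nondecreasing_seqP => n; rewrite /S big_ord_recr /= lerDl; exact: w0.
  have cv : cvgn S.
    by apply: nondecreasing_is_cvgn => //; exists M' => _ [n _ <-]; exact: hw.
  exists (limn S) => e e0.
  have /cvgrPdist_lt /(_ _ e0) [N _ hN] := cv.
  by exists N => n Nn; rewrite distrC; exact: hN.
move=> hM.
have [s1 h1] := pos (fun i => `|u i|) M (fun i => normr_ge0 _) hM.
have [|n|s2 h2] := pos (fun i => `|u i| + u i) (M + M).
- by move=> i; rewrite -lerBlDr sub0r; apply: le_trans (ler_norm _) _; rewrite normrN.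
- rewrite big_split /=; apply: lerD (hM n) _; apply: le_trans (hM n).
  by apply: ler_sum => i _; exact: ler_norm.
exists (s2 - s1) => e e0; have e2 : 0 < e / 2 by rewrite divr_gt0.
have [N1 k1] := h1 _ e2; have [N2 k2] := h2 _ e2.
exists (maxn N1 N2) => n; rewrite geq_max => /andP[/k1 l1 /k2].
rewrite big_split /= => l2.
set A := \sum_(i < n) `|u i| in l1 l2 *; set B := \sum_(i < n) u i in l2 *.
have -> : B - (s2 - s1) = (A + B - s2) - (A - s1) by ring.
apply: le_lt_trans (ler_normB _ _) _.
by rewrite (splitr e); exact: ltrD.
Qed.

Lemma chas_exists c (M : R) : (forall n, \sum_(i < n) nrm (c i) <= M) ->
  exists s, chas c s.
Proof.
move=> hM.
have [|x hx] := @real_series_cvg (fun i => complex.Re (c i)) M.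
  move=> n; apply: le_trans (hM n); apply: ler_sum => i _; exact: Re_le_nrm.
have [|y hy] := @real_series_cvg (fun i => complex.Im (c i)) M.
  move=> n; apply: le_trans (hM n); apply: ler_sum => i _; exact: Im_le_nrm.
exists (x +i* y)%C => e e0; have e2 : 0 < e / 2 by rewrite divr_gt0.
have [N1 k1] := hx _ e2; have [N2 k2] := hy _ e2.
exists (maxn N1 N2) => n; rewrite geq_max => /andP[/k1 l1 /k2 l2].
apply: le_lt_trans (nrm_le_ReIm _) _; rewrite ReB ImB /=.
have hRe m : complex.Re (\sum_(i < m) c i) = \sum_(i < m) complex.Re (c i).
  by elim: m => [|m IH]; rewrite ?big_ord0 // !big_ord_recr /= ReD IH.
have hIm m : complex.Im (\sum_(i < m) c i) = \sum_(i < m) complex.Im (c i).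
  by elim: m => [|m IH]; rewrite ?big_ord0 // !big_ord_recr /= ImD IH.
by rewrite hRe hIm (splitr e); exact: ltrD.
Qed.

Lemma eq_le_eps s t : (forall e : R, 0 < e -> nrm (s - t) < e) -> s = t.
Proof.
move=> h; apply/eqP; rewrite -subr_eq0 -nrm_eq0 eq_le nrm_ge0 andbT.
by apply/ler_addgt0Pr => e /h /ltW; rewrite add0r.
Qed.

Lemma chas_unique c s t : chas c s -> chas c t -> s = t.
Proof.
move=> hs ht; apply: eq_le_eps => e e0; have e2 : 0 < e / 2 by rewrite divr_gt0.
have [N1 k1] := hs _ e2; have [N2 k2] := ht _ e2.
have l1 := k1 _ (leq_maxl N1 N2); have l2 := k2 _ (leq_maxr N1 N2).
move: l1 l2; set A := \sum_(i < _) _ => l1 l2; rewrite nrmB in l1.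
have -> : s - t = (s - A) + (A - t) by ring.
by apply: le_lt_trans (le_normcD _ _) _; rewrite (splitr e); exact: ltrD.
Qed.

Lemma csumE c s : chas c s -> csum c = s.
Proof. by move=> h; apply: xget_unique => // t /chas_unique; apply. Qed.

Definition abs_summable c := exists M : R, forall n, \sum_(i < n) nrm (c i) <= M.

Lemma chas_csum c : abs_summable c -> chas c (csum c).
Proof. by case=> M /chas_exists[s hs]; rewrite (csumE hs). Qed.

Lemma chasD c d s t : chas c s -> chas d t -> chas (fun n => c n + d n) (s + t).
Proof.
move=> hs ht e e0; have e2 : 0 < e / 2 by rewrite divr_gt0.
have [N1 k1] := hs _ e2; have [N2 k2] := ht _ e2.
exists (maxn N1 N2) => n; rewrite geq_max => /andP[/k1 l1 /k2 l2].
rewrite big_split /= opprD addrACA.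
by apply: le_lt_trans (le_normcD _ _) _; rewrite (splitr e); exact: ltrD.
Qed.

Lemma chasZ a c s : chas c s -> chas (fun n => a * c n) (a * s).
Proof.
move=> hs e e0; have a0 : 0 < nrm a + 1 by rewrite ltr_wpDl // nrm_ge0.
have [N k] := hs _ (divr_gt0 e0 a0); exists N => n /k l.
rewrite -mulr_sumr -mulrBr normcM.
apply: le_lt_trans (_ : _ <= (nrm a + 1) * nrm (\sum_(i < n) c i - s)) _.
  by apply: ler_wpM2r; rewrite ?nrm_ge0 // lerDl.
by rewrite mulrC -ltr_pdivlMr.
Qed.

Lemma chas_eq c d s : c =1 d -> chas c s -> chas d s.
Proof. by move=> /funext ->. Qed.

Lemma chas_bound c s (M : R) : chas c s ->
  (forall n, \sum_(i < n) nrm (c i) <= M) -> nrm s <= M.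
Proof.
move=> hs hM; apply/ler_addgt0Pr => e e0; have [N /(_ N (leqnn N)) k] := hs e e0.
have := nrm_le_dist s (\sum_(i < N) c i); rewrite nrmB => h.
have h2 := le_trans (nrm_sum _ _ _) (hM N); lra.
Qed.

Lemma chas_sum (n : nat) (f : nat -> nat -> C) (s : nat -> C) :
  (forall b, (b < n)%N -> chas (f b) (s b)) ->
  chas (fun i => \sum_(b < n) f b i) (\sum_(b < n) s b).
Proof.
elim: n => [|n IH] h.
  move=> e e0; exists 0 => m _; rewrite big1 => [|i _]; rewrite ?big_ord0 //.
  by rewrite subrr nrm0.
rewrite big_ord_recr; apply: chas_eq (chasD (IH (fun b hb => h b (ltnW hb))) (h n (ltnSn n))).
by move=> i; rewrite big_ord_recr.
Qed.

(** The partial sum of length [n] only sees the multiples of [l] below [n], so it is the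
    partial sum of the subseries of length the least [m] with [n <= l m]. *)
Lemma chas_multiples (l : nat) c s : (0 < l)%N ->
  chas (fun n => c (l * n)%N) s -> chas (fun n => if (l %| n)%N then c n else 0) s.
Proof.
move=> l0 hs e e0; have [N k] := hs e e0; exists (l * N)%N => n hn.
have [m [h1 h2 ->]] : exists m, [/\ (n <= l * m)%N, (l * m < n + l)%N &
    \sum_(i < n) (if (l %| i)%N then c i else 0) = \sum_(i < m) c (l * i)%N].
  elim: n {hn} => [|n [m [h1 h2 E]]].
    by exists 0%N; rewrite muln0 add0n !big_ord0.
  rewrite big_ord_recr /= E; case: ifPn => [/dvdnP[q hq]|hl].
    have mq : m = q by move: h1 h2; rewrite hq; nia.
    exists m.+1; split; [nia|nia|].
    by rewrite big_ord_recr /= mq mulnC -hq.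
  exists m; split; [|lia|by rewrite addr0].
  by rewrite ltn_neqAle h1 andbT; apply: contra hl => /eqP ->; exact: dvdn_mulr.
by apply: k; rewrite -(leq_pmul2l l0); apply: leq_trans hn h1.
Qed.

End Series.

(** * Power series in q *)

Section ExponentialSeries.
Variable R : realType.
Local Notation C := R[i].
Local Notation nrm := (@normc R).
Implicit Types (b c : nat -> C) (z w q : C).

Arguments qpar {R} z : simpl never.
Arguments normc {R} x : simpl never.

(** Radius of convergence at least 1, which is what convergence of a series in q on the
    whole upper half plane means for its coefficients. *)
Definition subexp b := forall r : R, 0 < r < 1 ->
  exists B : R, forall n, nrm (b n) * r ^+ n <= B.

Lemma geom_bound (x : R) N : 0 <= x < 1 -> \sum_(i < N) x ^+ i <= (1 - x)^-1.
Proof.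
move=> /andP[x0 x1]; have h : 0 < 1 - x by rewrite subr_gt0.
rewrite -[leRHS]mul1r ler_pdivlMr //.
have -> : (\sum_(i < N) x ^+ i) * (1 - x) = 1 - x ^+ N.
  elim: N => [|N IH]; first by rewrite big_ord0 mul0r expr0 subrr.
  by rewrite big_ord_recr /= mulrDl IH exprS; ring.
by rewrite lerBlDr lerDl exprn_ge0.
Qed.

(** Comparison with the geometric series of ratio [r / s], for [s] between [r] and 1. *)
Lemma subexp_summable b (r : R) : subexp b -> 0 <= r < 1 ->
  exists M : R, forall N, \sum_(i < N) nrm (b i) * r ^+ i <= M.
Proof.
move=> hb /andP[r0 r1]; pose s := (1 + r) / 2.
have s0 : 0 < s by rewrite /s; lra.
have s1 : s < 1 by rewrite /s; lra.
have rs : r < s by rewrite /s; lra.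
have [|B hB] := hb s; first by rewrite s0.
have x0 : 0 <= r / s < 1.
  by rewrite divr_ge0 ?(ltW s0) //= ltr_pdivrMr // mul1r.
exists (B * (1 - r / s)^-1) => N.
apply: le_trans (_ : _ <= \sum_(i < N) B * (r / s) ^+ i) _.
  apply: ler_sum => i _; have -> : r ^+ i = s ^+ i * (r / s) ^+ i.
    by rewrite -exprMn mulrC divfK // gt_eqF.
  rewrite mulrA; apply: ler_wpM2r; last exact: hB.
  by apply: exprn_ge0; case/andP: x0.
rewrite -mulr_sumr; apply: ler_wpM2l; last exact: geom_bound.
by apply: le_trans (hB 0); rewrite expr0 mulr1 nrm_ge0.
Qed.

Lemma bernoulli_ineq (x : R) n : 0 <= x -> n%:R * x <= (1 + x) ^+ n.
Proof.
move=> x0; suff h : 1 + n%:R * x <= (1 + x) ^+ n by apply: le_trans h; rewrite lerDr.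
elim: n => [|n IH]; first by rewrite mul0r addr0 expr0.
rewrite exprS; apply: le_trans (_ : _ <= (1 + x) * (1 + n%:R * x)) _; last first.
  by apply: ler_wpM2l IH; rewrite addr_ge0.
rewrite -natr1; have : 0 <= x * (n%:R * x) by rewrite !mulr_ge0.
by nra.
Qed.

(** By Bernoulli's inequality a slightly larger radius absorbs the factor [n]. *)
Lemma subexp_muln b : subexp b -> subexp (fun n => n%:R * b n).
Proof.
move=> hb r /andP[r0 r1]; pose s := (1 + r) / 2.
have s0 : 0 < s by rewrite /s; lra.
have s1 : s < 1 by rewrite /s; lra.
have rs : r < s by rewrite /s; lra.
have [|B hB] := hb s; first by rewrite s0.
pose x := s / r - 1.
have x0 : 0 < x by rewrite subr_gt0 ltr_pdivlMr // mul1r.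
exists (x^-1 * B) => n; rewrite normcM nrm_nat.
have hn : n%:R * r ^+ n <= x^-1 * s ^+ n.
  rewrite ler_pdivlMl // mulrCA mulrA -ler_pdivlMr ?exprn_gt0 // -expr_div_n.
  by have := bernoulli_ineq n (ltW x0); rewrite {2}/x [1 + _]addrC subrK.
rewrite mulrAC; apply: le_trans (_ : x^-1 * s ^+ n * nrm (b n) <= _).
  by apply: ler_wpM2r hn; exact: nrm_ge0.
rewrite -mulrA; apply: ler_wpM2l; first by rewrite invr_ge0 ltW.
by rewrite mulrC.
Qed.

Lemma subexp_le b c (K : R) : (forall n, nrm (c n) <= K * nrm (b n)) ->
  subexp b -> subexp c.
Proof.
move=> h hb r r01; have [B hB] := hb r r01; exists (`|K| * B) => n.
have rn : 0 <= r ^+ n by rewrite exprn_ge0 // ltW //; case/andP: r01.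
apply: le_trans (_ : _ <= `|K| * nrm (b n) * r ^+ n) _.
  apply: ler_wpM2r => //; apply: le_trans (h n) _.
  by apply: ler_wpM2r; rewrite ?nrm_ge0 ?ler_norm.
by rewrite -mulrA; apply: ler_wpM2l.
Qed.

Lemma subexpZ (a : C) b : subexp b -> subexp (fun n => a * b n).
Proof. by apply: (@subexp_le _ _ (nrm a)) => n; rewrite normcM. Qed.

Definition psum b q : C := csum (fun n => b n * q ^+ n).

Lemma chas_psum b q : subexp b -> nrm q < 1 -> chas (fun n => b n * q ^+ n) (psum b q).
Proof.
move=> hb q1; apply: chas_csum.
have [|M hM] := @subexp_summable b (nrm q) hb; first by rewrite nrm_ge0.
exists M => n; apply: le_trans (hM n); apply: ler_sum => i _.
by rewrite normcM nrmX.
Qed.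

(** The Taylor error of a power; the factor [rho ^+ 2] avoids the exponent [n - 2]. *)
Lemma powdiff_bound (q h : C) (rho : R) n : nrm q <= rho -> nrm (q + h) <= rho ->
  rho ^+ 2 * nrm ((q + h) ^+ n - q ^+ n - n%:R * q ^+ n.-1 * h) <=
  n%:R ^+ 2 * rho ^+ n * nrm h ^+ 2.
Proof.
move=> hq hqh; have rho0 : 0 <= rho by apply: le_trans hq; exact: nrm_ge0.
elim: n => [|n IH].
  by rewrite !expr0 subrr !mul0r subr0 nrm0 mulr0 expr0n /= !mul0r.
have -> : (q + h) ^+ n.+1 - q ^+ n.+1 - n.+1%:R * q ^+ n.+1.-1 * h =
  (q + h) * ((q + h) ^+ n - q ^+ n - n%:R * q ^+ n.-1 * h) + n%:R * q ^+ n.-1 * h ^+ 2.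
  case: n {IH} => [|n] /=; first by rewrite !expr0 !expr1; ring.
  by rewrite -[n.+2%:R]natr1 !exprS; ring.
set D := _ - _ - _ in IH *.
have nr : 0 <= (n%:R : R) by [].
have k1 : rho ^+ 2 * nrm ((q + h) * D) <= n%:R ^+ 2 * rho ^+ n.+1 * nrm h ^+ 2.
  rewrite normcM mulrCA; apply: le_trans (_ : _ <= rho * (rho ^+ 2 * nrm D)) _.
    by apply: ler_wpM2r hqh; rewrite mulr_ge0 ?nrm_ge0 ?exprn_ge0.
  have -> : n%:R ^+ 2 * rho ^+ n.+1 * nrm h ^+ 2 =
    rho * (n%:R ^+ 2 * rho ^+ n * nrm h ^+ 2).
    by rewrite (exprS rho n); move: (n%:R ^+ 2) (rho ^+ n) (nrm h ^+ 2) => *; ring.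
  exact: ler_wpM2l.
have k2 : rho ^+ 2 * nrm (n%:R * q ^+ n.-1 * h ^+ 2) <= n%:R * rho ^+ n.+1 * nrm h ^+ 2.
  case: n {IH D k1 nr} => [|n] /=.
    by rewrite mulr0n !mul0r nrm0 mulr0.
  rewrite normcM (nrmX h) normcM nrm_nat nrmX [_ ^+ 2 * (_ * _)]mulrA.
  apply: ler_wpM2r; first by rewrite exprn_ge0 ?nrm_ge0.
  rewrite mulrCA; apply: ler_wpM2l => //.
  rewrite -[n.+2]add2n exprD; apply: ler_wpM2l; first exact: exprn_ge0.
  by apply: lerXn2r; rewrite ?nnegrE ?nrm_ge0.
apply: le_trans (_ : _ <= rho ^+ 2 * (nrm ((q + h) * D) + nrm (n%:R * q ^+ n.-1 * h ^+ 2))) _.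
  by apply: ler_wpM2l; [exact: exprn_ge0|exact: le_normcD].
rewrite mulrDr; apply: le_trans (lerD k1 k2) _.
rewrite -!mulrDl; apply: ler_wpM2r; first by rewrite exprn_ge0 ?nrm_ge0.
apply: ler_wpM2r; first exact: exprn_ge0.
by rewrite -natr1; nra.
Qed.

(** Summing [powdiff_bound] against the coefficients gives a quadratic error for the series
    differentiated term by term. *)
Lemma cderiv_psum b q : subexp b -> nrm q < 1 ->
  cderiv (psum b) q (csum (fun n => n%:R * b n * q ^+ n.-1)) /\
  chas (fun n => n%:R * b n * q ^+ n.-1) (csum (fun n => n%:R * b n * q ^+ n.-1)).
Proof.
move=> hb q1; pose rho := (1 + nrm q) / 2; have q0 := nrm_ge0 q.
have rho0 : 0 < rho by rewrite /rho; lra.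
have rho1 : rho < 1 by rewrite /rho; lra.
have qrho : nrm q < rho by rewrite /rho; lra.
have rho01 : 0 <= rho < 1 by rewrite rho1 ltW.
have hb1 := subexp_muln hb; have hb2 := subexp_muln hb1.
have [M1 hM1] := subexp_summable hb1 rho01.
have [M2 hM2] := subexp_summable hb2 rho01.
have hl : chas (fun n => n%:R * b n * q ^+ n.-1) (csum (fun n => n%:R * b n * q ^+ n.-1)).
  apply: chas_csum; exists (rho^-1 * M1) => N.
  apply: le_trans (_ : _ <= rho^-1 * \sum_(i < N) nrm (i%:R * b i) * rho ^+ i) _; last first.
    by apply: ler_wpM2l (hM1 N); rewrite invr_ge0 ltW.
  rewrite mulr_sumr; apply: ler_sum => -[[|i] hi] _ /=.
    by rewrite !mul0r nrm0 !mul0r mulr0.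
  rewrite normcM nrmX mulrCA; apply: ler_wpM2l; first exact: nrm_ge0.
  rewrite exprS mulKf ?gt_eqF //; apply: lerXn2r; rewrite ?nnegrE // ltW //.
split=> //; apply: (@cderiv_quad _ _ _ _ (rho ^- 2 * M2) (rho - nrm q)).
  by rewrite subr_gt0.
move=> w hw; set h := w - q; have wE : w = q + h by rewrite /h addrC subrK.
have hqh : nrm (q + h) <= rho.
  by apply: le_trans (le_normcD _ _) _; rewrite -lerBrDl ltW.
have w1 : nrm w < 1 by rewrite wE; apply: le_lt_trans hqh rho1.
have hs : chas (fun n => b n * ((q + h) ^+ n - q ^+ n - n%:R * q ^+ n.-1 * h))
   (psum b w - psum b q - csum (fun n => n%:R * b n * q ^+ n.-1) * h).
  have := chasD (chasD (chas_psum hb w1) (chasZ (-1) (chas_psum hb q1))) (chasZ (- h) hl).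
  rewrite mulN1r mulNr [h * _]mulrC; apply: chas_eq => n.
  by rewrite wE; ring.
apply: chas_bound hs _ => N.
apply: le_trans (_ : _ <= rho ^- 2 * (\sum_(i < N) nrm (i%:R * (i%:R * b i)) * rho ^+ i) * nrm h ^+ 2) _.
  rewrite mulr_sumr mulr_suml; apply: ler_sum => i _.
  rewrite normcM !(normcM i%:R) nrm_nat -[_ * _ * nrm h ^+ 2]mulrA ler_pdivlMl ?exprn_gt0 //.
  rewrite mulrCA; have := powdiff_bound i (ltW qrho) hqh.
  move/(ler_wpM2l (nrm_ge0 (b i))) => k; apply: le_trans k _.
  by rewrite le_eqVlt; apply/orP; left; apply/eqP; ring.
apply: ler_wpM2r; first by rewrite exprn_ge0 ?nrm_ge0.
by apply: ler_wpM2l (hM2 N); rewrite invr_ge0 exprn_ge0 // ltW.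
Qed.

(** ** The parameter q *)

Definition tpi : C := (0 +i* (2 * pi))%C.

Lemma nrm_qpar z : nrm (qpar z) = expR (- (2 * pi * complex.Im z)).
Proof.
rewrite /qpar normcM nrm_real ger0_norm ?expR_ge0 //=.
by rewrite /normc cos2Dsin2 sqrtr1 mulr1.
Qed.

Lemma qparD z w : qpar (z + w) = qpar z * qpar w.
Proof.
rewrite /qpar ReD ImD !mulrDr opprD expRD cosD sinD.
set e1 := expR _; set e2 := expR _.
by apply: eqC => /=; ring.
Qed.

Lemma qpar0 : qpar (0 : C) = 1.
Proof. by rewrite /qpar /= !mulr0 oppr0 expR0 cos0 sin0 mul1r. Qed.

Lemma qparMn z n : qpar (n%:R * z) = qpar z ^+ n.
Proof.
elim: n => [|n IH]; first by rewrite mul0r qpar0 expr0.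
by rewrite -natr1 mulrDl mul1r qparD IH exprSr.
Qed.

Lemma qpar1 : qpar (1 : C) = 1.
Proof.
rewrite /qpar /= mulr0 oppr0 expR0 mulr1 mul1r.
have := @cosD2pi R 0; have := @sinD2pi R 0; rewrite !add0r sin0 cos0.
by rewrite mulr_natl => -> ->.
Qed.

Lemma qparDn z n : qpar (z + n%:R) = qpar z.
Proof. by rewrite qparD -[n%:R]mulr1 qparMn qpar1 expr1n mulr1. Qed.

Lemma sin_bound (x : R) : `|sin x| <= `|x|.
Proof.
have pos (y : R) : 0 <= y -> `|sin y| <= y.
  move=> y0; have [|c _] := @MVT_segment R (@sin R) (@cos R) 0 y y0.
  - by apply: continuous_subspaceT => t; exact: continuous_sin.
  rewrite sin0 !subr0 => ->; rewrite normrM (ger0_norm y0) ler_piMl //.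
  by rewrite ler_norml cos_geN1 cos_le1.
have [x0|x0] := leP 0 x; first by rewrite (ger0_norm x0); exact: pos.
by rewrite (ltr0_norm x0) -normrN -sinN; apply: pos; rewrite oppr_ge0 ltW.
Qed.

Lemma cos_bound (x : R) : `|cos x - 1| <= x ^+ 2.
Proof.
have -> : x = (x / 2) *+ 2 by rewrite mulr2n -splitr.
rewrite cos_mulr2n cos2sin2; set s := sin _.
have -> : (1 - s ^+ 2) *+ 2 - 1 - 1 = - (2 * s ^+ 2) by ring.
have -> : (x / 2 *+ 2) ^+ 2 = 4 * (x / 2) ^+ 2 by ring.
rewrite normrN ger0_norm; last by apply: mulr_ge0 => //; exact: sqr_ge0.
have h : s ^+ 2 <= (x / 2) ^+ 2.
  by rewrite -(real_normK (num_real s)) -(real_normK (num_real (x / 2))) lerXn2r ?nnegrE ?normr_ge0 // sin_bound.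
by have := sqr_ge0 (x / 2); nra.
Qed.

Lemma sin_bound2 (x : R) : `|x| <= 1 -> `|sin x - x| <= x ^+ 2.
Proof.
have pos (y : R) : 0 <= y <= 1 -> `|sin y - y| <= y ^+ 2.
  move=> /andP[y0 y1].
  have [|c] := @MVT_segment R (fun t => sin t - t) (fun t => cos t - 1) 0 y y0.
  - apply: continuous_subspaceT => t; apply: cvgB; [exact: continuous_sin|exact: cvg_id].
  rewrite in_itv /= sin0 !subr0 => /andP[c0 c1] ->; rewrite normrM (ger0_norm y0) expr2.
  apply: ler_wpM2r => //; apply: le_trans (cos_bound c) _.
  nra.
move=> hx; have [x0|x0] := leP 0 x.
  by apply: pos; rewrite x0 -(ger0_norm x0).
have := pos (- x); rewrite sinN opprK sqrrN [- sin x + x]addrC -[`|sin x - x|]normrN opprB.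
by apply; rewrite oppr_ge0 (ltW x0) -(ltr0_norm x0).
Qed.

Lemma expR_bound2 (u : R) : `|u| <= 2^-1 -> `|expR u - 1 - u| <= 2 * u ^+ 2.
Proof.
rewrite ler_norml => /andP[u1 u2].
have h1 := expR_ge1Dx u; have h2 := expR_ge1Dx (- u).
have e0 := expR_gt0 u; rewrite expRN in h2.
have h3 : (1 - u) * expR u <= 1.
  by rewrite -ler_pdivlMr // mul1r.
have := sqr_ge0 u => u0.
rewrite ler_norml; apply/andP; split; nra.
Qed.

(** The functional equation of the exponential reduces this to the point 0, where elementary
    bounds for exp, cos and sin give a quadratic error. *)
Lemma cderiv_qpar z : cderiv (@qpar R) z (tpi * qpar z).
Proof.
suff h0 : cderiv (@qpar R) 0 tpi.
  have h1 : cderiv (fun w => w - z) z 1.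
    by apply: cderiv_eq (cderivB (cderiv_id z) (cderiv_cst z z)) _; rewrite subr0.
  have h2 : cderiv (fun w => qpar (w - z)) z (tpi * 1).
    by apply: (cderiv_comp h1); rewrite subrr.
  have := cderivZ (qpar z) h2; rewrite mulr1 [_ * tpi]mulrC.
  by apply: cderiv_ext => w; rewrite -qparD addrC subrK.
have p0 : 0 < (pi : R) by exact: pi_gt0.
pose P := 2 * (pi : R); have P0 : 0 < P by rewrite mulr_gt0.
(* The terms [b1], [c1], [c2] and [c3] below are at most [2 n ^ 2] each. *)
apply: (@cderiv_quad _ _ _ _ (10 * P ^+ 2) (2^-1 / P)); first by rewrite divr_gt0.
move=> w; rewrite subr0 qpar0 => hw.
set x := complex.Re w; set y := complex.Im w.
have hx : `|P * x| <= P * nrm w.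
  by rewrite normrM gtr0_norm // ler_pM2l // Re_le_nrm.
have hy : `|- (P * y)| <= P * nrm w.
  by rewrite normrN normrM gtr0_norm // ler_pM2l // Im_le_nrm.
have hP : P * nrm w <= 2^-1 by rewrite mulrC -ler_pdivlMr // ltW.
have n0 : 0 <= P * nrm w by rewrite mulr_ge0 ?nrm_ge0 // ltW.
set n := P * nrm w in hx hy hP n0.
have -> : 10 * P ^+ 2 * nrm w ^+ 2 = 10 * n ^+ 2 by rewrite /n; ring.
set v := P * x in hx; set u := - (P * y) in hy.
have -> : qpar w - 1 - tpi * w = (((expR u - 1 - u) + expR u * (cos v - 1)) +i*
    (expR u * (sin v - v) + (expR u - 1) * v))%C.
  rewrite /qpar /tpi /u /v /x /y /P; move: (w) => [a b].
  by apply: eqC => /=; ring.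
apply: le_trans (nrm_le_ReIm _) _ => /=.
have b1 := expR_bound2 (le_trans hy hP).
have b2 := cos_bound v.
have b3 : `|sin v - v| <= v ^+ 2 by apply: sin_bound2; lra.
have vn : v ^+ 2 <= n ^+ 2.
  by rewrite -(real_normK (num_real v)) lerXn2r ?nnegrE ?normr_ge0.
have un : u ^+ 2 <= n ^+ 2.
  by rewrite -(real_normK (num_real u)) lerXn2r ?nnegrE ?normr_ge0.
have b4 : `|expR u - 1| <= 2 * n.
  have -> : expR u - 1 = (expR u - 1 - u) + u by ring.
  apply: le_trans (ler_normD _ _) _; nra.
have b5 : expR u <= 2.
  have := le_trans (ler_norm _) b4; lra.
have e0 := expR_ge0 u.
have c1 : `|expR u * (cos v - 1)| <= 2 * n ^+ 2.
  by rewrite normrM ger0_norm //; apply: ler_pM => //; apply: le_trans b2 vn.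
have c2 : `|expR u * (sin v - v)| <= 2 * n ^+ 2.
  by rewrite normrM ger0_norm //; apply: ler_pM => //; apply: le_trans b3 vn.
have c3 : `|(expR u - 1) * v| <= 2 * n ^+ 2.
  by rewrite normrM expr2 mulrA; apply: ler_pM.
have d1 := ler_normD (expR u - 1 - u) (expR u * (cos v - 1)).
have d2 := ler_normD (expR u * (sin v - v)) ((expR u - 1) * v).
nra.
Qed.

Definition Sser b z : C := psum b (qpar z).

Lemma nrm_qpar_lt1 z : 0 < complex.Im z -> nrm (qpar z) < 1.
Proof.
move=> hz; rewrite nrm_qpar expR_lt1 oppr_lt0 !mulr_gt0 // pi_gt0 //.
Qed.

Lemma chas_Sser b z : subexp b -> 0 < complex.Im z ->
  chas (fun n => b n * qpar z ^+ n) (Sser b z).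
Proof. by move=> hb hz; apply: chas_psum hb _; exact: nrm_qpar_lt1. Qed.

Lemma cderiv_Sser b z : subexp b -> 0 < complex.Im z ->
  cderiv (Sser b) z (Sser (fun n => tpi * n%:R * b n) z).
Proof.
move=> hb hz; have [h1 h2] := cderiv_psum hb (nrm_qpar_lt1 hz).
apply: cderiv_eq (cderiv_comp (cderiv_qpar z) h1) _.
have hb' : subexp (fun n => tpi * n%:R * b n).
  have := subexpZ tpi (subexp_muln hb).
  by congr subexp; apply/funext => n; rewrite mulrA.
apply: chas_unique (chas_Sser hb' hz).
rewrite mulrC; have := chasZ (tpi * qpar z) h2; apply: chas_eq => -[|n].
  by rewrite mulr0n !(mulr0, mul0r).
by rewrite exprS /=; ring.
Qed.

(** Without constant term, a power series in q is at most a multiple of [|q|] as long as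
    [|q|] stays away from 1. *)
Lemma Sser_decay b (Y : R) : subexp b -> b 0%N = 0 -> 0 < Y ->
  exists M : R, 0 <= M /\ forall z, Y <= complex.Im z ->
    nrm (Sser b z) <= M * expR (- (2 * pi * complex.Im z)).
Proof.
move=> hb b0 Y0; have p0 : 0 < 2 * (pi : R) by rewrite mulr_gt0 ?pi_gt0.
pose r := expR (- (2 * pi * Y)).
have r0 : 0 < r by exact: expR_gt0.
have r1 : r < 1 by rewrite expR_lt1 oppr_lt0 mulr_gt0.
have [|M hM] := @subexp_summable b r hb; first by rewrite ltW.
have M0 : 0 <= M by apply: le_trans (hM 0); rewrite big_ord0.
exists (r^-1 * M); split; first by rewrite mulr_ge0 // invr_ge0 ltW.
move=> z hz; have z0 : 0 < complex.Im z by apply: lt_le_trans hz.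
apply: chas_bound (chas_Sser hb z0) _ => N.
rewrite -nrm_qpar; set q := qpar z.
have qr : nrm q <= r by rewrite nrm_qpar ler_expR lerN2 ler_pM2l.
apply: le_trans (_ : _ <= r^-1 * (\sum_(i < N) nrm (b i) * r ^+ i) * nrm q) _; last first.
  apply: ler_wpM2r; first exact: nrm_ge0.
  by apply: ler_wpM2l; [rewrite invr_ge0 ltW|exact: hM].
rewrite mulr_sumr mulr_suml; apply: ler_sum => -[[|i] hi] _ /=.
  by rewrite b0 mul0r nrm0 !mul0r mulr0 mul0r.
rewrite normcM nrmX mulrCA -mulrA; apply: ler_wpM2l; first exact: nrm_ge0.
rewrite [r ^+ _]exprS mulKf ?gt_eqF // exprSr; apply: ler_wpM2r; first exact: nrm_ge0.
by apply: lerXn2r; rewrite ?nnegrE ?nrm_ge0 // ltW.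
Qed.

End ExponentialSeries.

(** * Integral matrices of order two *)

Section Matrices.
Implicit Types (M N : 'M[int]_2) (a b c d : int).

Lemma ord2P (i : 'I_2) : i = 0 \/ i = 1.
Proof. by case: i => [[|[|]]] // ?; [left|right]; exact/val_inj. Qed.

Lemma mx2E a b c d : (mx2 a b c d 0 0 = a) * (mx2 a b c d 0 1 = b) *
  (mx2 a b c d 1 0 = c) * (mx2 a b c d 1 1 = d).
Proof. by rewrite /mx2 !mxE. Qed.

Lemma mx2_eta M : M = mx2 (M 0 0) (M 0 1) (M 1 0) (M 1 1).
Proof.
apply/matrixP => i j.
by case: (ord2P i) => ->; case: (ord2P j) => ->; rewrite !mx2E.
Qed.

Lemma mulmx2E M N i j : (M *m N) i j = M i 0 * N 0 j + M i 1 * N 1 j.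
Proof. by rewrite mxE big_ord_recl big_ord1; congr (_ + M i _ * N _ j); exact/val_inj. Qed.

Lemma mulmx2 a b c d a' b' c' d' : mx2 a b c d *m mx2 a' b' c' d' =
  mx2 (a * a' + b * c') (a * b' + b * d') (c * a' + d * c') (c * b' + d * d').
Proof. by rewrite [LHS]mx2_eta !mulmx2E !mx2E. Qed.

Lemma det_mx2E M : \det M = M 0 0 * M 1 1 - M 0 1 * M 1 0.
Proof.
rewrite (expand_det_row _ 0) !big_ord_recl big_ord0 /cofactor !det_mx11 !mxE /=.
rewrite addr0 expr0 expr1 mul1r mulN1r mulrN.
by congr (M 0 _ * M _ _ - M _ _ * M _ _); exact/val_inj.
Qed.

Lemma det_mx2 a b c d : \det (mx2 a b c d) = a * d - b * c.
Proof. by rewrite det_mx2E !mx2E. Qed.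

End Matrices.

(** * Cusps *)

Section Cusps.
Implicit Types (M N : 'M[int]_2) (x y : int) (c : cusp).

(** A cusp is an integral vector up to scaling, on which matrices act linearly. *)
Definition cusp_of x y : cusp := if y == 0 then None else Some (x%:~R / y%:~R).

Lemma cusp_repr c : exists x y, (x != 0) || (y != 0) /\ c = cusp_of x y.
Proof.
case: c => [r|]; last by exists 1, 0; rewrite /cusp_of eqxx.
by exists (numq r), (denq r); rewrite /cusp_of (negbTE (denq_neq0 r)) orbT divq_num_den.
Qed.

Lemma mx_cusp_of M x y : \det M != 0 -> (x != 0) || (y != 0) ->
  mx_cusp M (cusp_of x y) = cusp_of (M 0 0 * x + M 0 1 * y) (M 1 0 * x + M 1 1 * y).
Proof.
move=> hM; rewrite /cusp_of; case: (eqVneq y 0) => [->|y0] /=.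
  rewrite orbF !mulr0 !addr0 => x0.
  rewrite mulf_eq0 (negbTE x0) orbF; case: eqVneq => // c0; congr Some.
  by rewrite !rmorphM /= -mulf_div divff ?mulr1 // intr_eq0.
move=> _; have y0' : (y%:~R : rat) != 0 by rewrite intr_eq0.
have E (u v : int) : (u%:~R * (x%:~R / y%:~R) + v%:~R : rat) = (u * x + v * y)%:~R / y%:~R.
  by rewrite rmorphD !rmorphM /=; field.
rewrite !E mulf_eq0 invr_eq0 (negbTE y0') orbF intr_eq0.
case: eqVneq => // h; congr Some; field.
by rewrite y0' andbT -!rmorphM -rmorphD /= intr_eq0.
Qed.

Lemma mx_vec_neq0 M x y : \det M != 0 -> (x != 0) || (y != 0) ->
  (M 0 0 * x + M 0 1 * y != 0) || (M 1 0 * x + M 1 1 * y != 0).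
Proof.
move=> hM; apply: contraLR; rewrite !negb_or !negbK => /andP[/eqP h1 /eqP h2].
have e1 : \det M * x = 0.
  transitivity (M 1 1 * (M 0 0 * x + M 0 1 * y) - M 0 1 * (M 1 0 * x + M 1 1 * y)).
    by rewrite det_mx2E; ring.
  by rewrite h1 h2 !mulr0 subrr.
have e2 : \det M * y = 0.
  transitivity (M 0 0 * (M 1 0 * x + M 1 1 * y) - M 1 0 * (M 0 0 * x + M 0 1 * y)).
    by rewrite det_mx2E; ring.
  by rewrite h1 h2 !mulr0 subrr.
by move/eqP: e1; move/eqP: e2; rewrite !mulf_eq0 (negbTE hM) /= => -> ->.
Qed.

Lemma mx_cuspM M N c : \det M != 0 -> \det N != 0 ->
  mx_cusp (M *m N) c = mx_cusp M (mx_cusp N c).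
Proof.
move=> hM hN; have [x [y [h ->]]] := cusp_repr c.
rewrite !mx_cusp_of ?det_mulmx ?mulf_neq0 ?mx_vec_neq0 // !mulmx2E.
by congr cusp_of; ring.
Qed.

Lemma mx_cusp1 c : mx_cusp 1%:M c = c.
Proof.
have [x [y [h ->]]] := cusp_repr c.
by rewrite mx_cusp_of ?det1 // !mxE /= !mul1r !mul0r addr0 add0r.
Qed.

(** By Bezout, a primitive vector is the first column of a matrix of determinant 1. *)
Lemma cusp_matrix c : exists2 M, SL2Z M & mx_cusp M None = c.
Proof.
case: c => [r|]; last first.
  by exists 1%:M; [exact: det1|rewrite mx_cusp1].
have cop : coprimez (numq r) (denq r) by exact: coprime_num_den.
have [[u v] /= h] := coprimezP _ _ cop.
exists (mx2 (numq r) (- v) (denq r) u).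
  by rewrite /SL2Z /= det_mx2 -[RHS]h; ring.
by rewrite /mx_cusp !mx2E (negbTE (denq_neq0 r)) divq_num_den.
Qed.

(** The inverse up to the determinant, which stays integral. *)
Definition adj2 M : 'M[int]_2 := mx2 (M 1 1) (- M 0 1) (- M 1 0) (M 0 0).

Lemma adj2_mul M : adj2 M *m M = (\det M)%:M.
Proof.
rewrite [M in _ *m M]mx2_eta mulmx2 [RHS]mx2_eta !mxE /= det_mx2E.
by congr mx2; ring.
Qed.

Lemma mul_adj2 M : M *m adj2 M = (\det M)%:M.
Proof.
rewrite [M in M *m _]mx2_eta mulmx2 [RHS]mx2_eta !mxE /= det_mx2E.
by congr mx2; ring.
Qed.

Lemma det_adj2 M : \det (adj2 M) = \det M.
Proof. by rewrite det_mx2 det_mx2E; ring. Qed.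

Lemma SL2Z_mul M N : SL2Z M -> SL2Z N -> SL2Z (M *m N).
Proof. by rewrite /SL2Z /= det_mulmx => -> ->. Qed.

Lemma SL2Z_adj M : SL2Z M -> SL2Z (adj2 M).
Proof. by rewrite /SL2Z /= det_adj2. Qed.

End Cusps.

(** * Cosets of congruence subgroups *)

Section PeriodicSums.
Variables (l : nat) (pl : prime l).

Lemma Fp_nat_eq0 (n : nat) : (n%:R == 0 :> 'F_l) = (l %| n)%N.
Proof. by rewrite (dvdn_pcharf (pchar_Fp pl)). Qed.

Lemma Fp_int_eq0 (n : int) : (n%:~R == 0 :> 'F_l) = (l%:Z %| n)%Z.
Proof.
rewrite dvdzE /= -Fp_nat_eq0; case: (intP n) => [|m|m] //=.
by rewrite rmorphN oppr_eq0 /= -pmulrn.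
Qed.

Lemma Fp_val (x : 'F_l) : (val x)%:R = x.
Proof. by rewrite natr_Zp. Qed.

Lemma Fp_valz (x : 'F_l) : (Posz (val x))%:~R = x.
Proof. by rewrite -pmulrn Fp_val. Qed.

Lemma dvdn_fermat (a : nat) : ~~ (l %| a)%N -> (l %| a ^ l.-1 - 1)%N.
Proof.
move=> la; have a1 : (1 <= a ^ l.-1)%N.
  by rewrite expn_gt0 lt0n; apply/orP; left; apply: contraNneq la => ->; rewrite dvdn0.
have := fermat_little a pl; rewrite -[in X in X -> _](prednK (prime_gt0 pl)) expnS.
move/eqP; rewrite prednK ?prime_gt0 // eqn_mod_dvd ?leq_pmulr //.
by rewrite -[X in (_ - X)%N]muln1 -mulnBr Euclid_dvdM // (negbTE la).
Qed.

Lemma Fp_exp_mod (x : 'F_l) i j : x != 0 -> (i = j %[mod l.-1])%N -> x ^+ i = x ^+ j.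
Proof.
move=> x0 ij; have l1 : (0 < l.-1)%N by have := prime_gt1 pl; lia.
have h : x ^+ l.-1 = 1.
  have la : ~~ (l %| x)%N by rewrite -Fp_nat_eq0 Fp_val.
  have a1 : (1 <= x ^ l.-1)%N.
    by rewrite expn_gt0 lt0n; apply/orP; left; apply: contraNneq la => ->; rewrite dvdn0.
  rewrite -[X in X ^+ _]Fp_val; apply/eqP.
  by rewrite -subr_eq0 -natrX -[X in _ - X]/(1%:R) -natrB // Fp_nat_eq0 dvdn_fermat.
have e k : x ^+ k = x ^+ (k %% l.-1).
  by rewrite {1}(divn_eq k l.-1) exprD mulnC exprM h expr1n mul1r.
by rewrite e [RHS]e ij.
Qed.

Variable V : zmodType.

Lemma sum_Fp (G : nat -> V) : \sum_(b < l) G b = \sum_(x : 'F_l) G x.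
Proof. by rewrite -[LHS](big_mkord xpredT) -[RHS](big_mkord xpredT) Fp_cast. Qed.

Variables (G : int -> V) (per : forall b, G (b + l%:Z) = G b).

Lemma periodic_eq (b c : int) : b%:~R = c%:~R :> 'F_l -> G b = G c.
Proof.
move=> /eqP; rewrite -subr_eq0 -rmorphB Fp_int_eq0 => /dvdzP[q hq].
have perM (m : nat) d : G (d + m%:Z * l%:Z) = G d.
  elim: m d => [|m IH] d; first by rewrite mul0r addr0.
  by have -> : d + m.+1%:Z * l%:Z = (d + m%:Z * l%:Z) + l%:Z by [rewrite intS; ring|]; rewrite per IH.
have -> : b = c + q * l%:Z by rewrite -hq addrC subrK.
case: (intP q) => [|m|m]; first by rewrite mul0r addr0.
  exact: perM.
by rewrite -[LHS](perM m.+1) mulNr subrK.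
Qed.

(** Multiplication by [u] permutes the residues modulo [l]. *)
Lemma periodic_sum_mul (u : int) : ~~ (l%:Z %| u)%Z ->
  \sum_(b < l) G (u * b%:Z) = \sum_(b < l) G b%:Z.
Proof.
rewrite -Fp_int_eq0 => u0.
rewrite (sum_Fp (fun b => G (u * b%:Z))) (sum_Fp (fun b => G b%:Z)).
rewrite [RHS](reindex_inj (mulfI u0)); apply: eq_bigr => x _; apply: periodic_eq.
by rewrite intrM !Fp_valz.
Qed.

End PeriodicSums.

Lemma sum_shift (V : zmodType) (G : nat -> V) n : G n = G 0%N ->
  \sum_(b < n) G b.+1 = \sum_(b < n) G b.
Proof.
move=> h; apply: (addrI (G 0%N)); rewrite -(big_ord_recl n (fun i => G i)).
by rewrite big_ord_recr /= addrC h.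
Qed.

(** ** Cosets and generators *)

Section Cosets.
Variables (l : nat) (pl : prime l).
Implicit Types (M N A : 'M[int]_2).

Definition mxS : 'M[int]_2 := mx2 0 1 (- 1) 0.
Definition mxT : 'M[int]_2 := mx2 1 1 0 1.

Lemma SL2Z_S : SL2Z mxS. Proof. by rewrite /SL2Z /= det_mx2. Qed.
Lemma SL2Z_T : SL2Z mxT. Proof. by rewrite /SL2Z /= det_mx2. Qed.

(** On such matrices, multiplication by an element of [Gamma0 l] from the left multiplies
    the first row, modulo [l], by the upper left entry of that element. *)
Definition hecke_mx A := [/\ \det A != 0, (l%:Z %| A 1%R 0%R)%Z & (l%:Z %| A 1%R 1%R)%Z].

(** The matrices of this sum have determinant [l], and their first rows run through the
    projective line over the field with [l] elements; every matrix of determinant [l] with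
    second row divisible by [l] is in the coset under [Gamma0 l] of exactly one of them. *)
Definition coset_sum (V : zmodType) (tau : 'M[int]_2 -> V) : V :=
  \sum_(b < l) tau (mx2 1 b%:Z 0 l%:Z) + tau (mx2 0 1 (- l%:Z) 0).

Let l_neq0 : l%:Z != 0. Proof. by rewrite eqz_nat -lt0n prime_gt0. Qed.

Lemma hecke_mx_translate (b : int) : hecke_mx (mx2 1 b 0 l%:Z).
Proof. by split; rewrite ?mx2E ?det_mx2 ?dvdz0 ?dvdzz // mul1r mulr0 subr0. Qed.

Lemma hecke_mx_infty : hecke_mx (mx2 0 1 (- l%:Z) 0).
Proof.
split; first by rewrite det_mx2 mul0r mul1r sub0r opprK.
  by rewrite mx2E rpredN dvdzz.
by rewrite mx2E dvdz0.
Qed.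

Variables (V : zmodType) (tau : 'M[int]_2 -> V).
Hypothesis tauG : forall M A, Gamma0 l M -> hecke_mx A -> tau (M *m A) = tau A.

(** Right multiplication by an element of [SL2(Z)] permutes the cosets. By [SL2Z_ind] it is
    enough to know this for the two generators. *)
Lemma coset_sum_T : coset_sum (fun A => tau (A *m mxT)) = coset_sum tau.
Proof.
rewrite /coset_sum /mxT; congr (_ + _); last first.
  rewrite -[RHS](@tauG (mx2 1 0 (- l%:Z) 1)).
  - by rewrite !mulmx2; congr (tau (mx2 _ _ _ _)); ring.
  - by split; [rewrite det_mx2 mulr1 mul0r subr0|rewrite mx2E rpredN dvdzz].
  - exact: hecke_mx_infty.
have h0 : tau (mx2 1 l%:Z 0 l%:Z) = tau (mx2 1 0%:Z 0 l%:Z).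
  rewrite -[RHS](@tauG (mx2 1 1 0 1)).
  - by rewrite mulmx2; congr (tau (mx2 _ _ _ _)); ring.
  - by split; rewrite ?det_mx2 ?mx2E ?dvdz0.
  - exact: hecke_mx_translate.
rewrite -(@sum_shift _ (fun b : nat => tau (mx2 1 b%:Z 0 l%:Z)) _ h0).
apply: eq_bigr => b _; rewrite mulmx2 intS.
by congr (tau (mx2 _ _ _ _)); ring.
Qed.

Lemma coset_sum_S : coset_sum (fun A => tau (A *m mxS)) = coset_sum tau.
Proof.
rewrite /coset_sum /mxS.
rewrite (sum_Fp pl (fun b => tau (mx2 1 b%:Z 0 l%:Z *m mx2 0 1 (- 1) 0))).
rewrite (sum_Fp pl (fun b => tau (mx2 1 b%:Z 0 l%:Z))).
rewrite (bigD1 0) //= [in RHS](bigD1 0) //= addrAC [RHS]addrAC; congr (_ + _).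
  rewrite addrC; congr (_ + _); last first.
    by congr tau; rewrite mulmx2; congr mx2; ring.
  rewrite -[RHS](@tauG (mx2 (- 1) 0 0 (- 1))).
  - by rewrite !mulmx2; congr (tau (mx2 _ _ _ _)); ring.
  - by split; rewrite ?det_mx2 ?mx2E ?dvdz0.
  - exact: hecke_mx_translate.
(* The first row of the product is [(- b, 1)], and it spans the same line modulo [l] as
   [(1, b')] when [b b'] is -1. *)
have inj : injective (fun x : 'F_l => - x^-1) by apply: inj_comp; [exact: oppr_inj|exact: invr_inj].
rewrite [RHS](reindex_inj inj) /=.
apply: eq_big => [x|x x0]; first by rewrite oppr_eq0 invr_eq0.
suff key (b b' : nat) : (l %| b * b' + 1)%N ->
    tau (mx2 1 b%:Z 0 l%:Z *m mx2 0 1 (- 1) 0) = tau (mx2 1 b'%:Z 0 l%:Z).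
  apply: key.
  by rewrite -(Fp_nat_eq0 pl) natrD natrM (Fp_val x) (Fp_val (- x^-1)) mulrN divff // addNr.
case/dvdnP=> q hq.
have {}hq : b%:Z * b'%:Z + 1 = q%:Z * l%:Z by rewrite -!PoszM -PoszD hq.
rewrite -[RHS](@tauG (mx2 (- b%:Z) q%:Z (- l%:Z) b'%:Z)).
- rewrite !mulmx2; congr (tau (mx2 _ _ _ _)); rewrite -?hq; ring.
- split; last by rewrite mx2E rpredN dvdzz.
  by rewrite det_mx2 mulrN opprK -hq; ring.
- exact: hecke_mx_translate.
Qed.

End Cosets.

(** Euclid's algorithm on the first column, with translations for the quotients and [mxS]
    for the exchange, reduces the lower left entry to 0. *)
Lemma SL2Z_ind (E : 'M[int]_2 -> Prop) : E mxS -> E mxT -> E (adj2 mxT) ->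
  (forall M N, SL2Z M -> SL2Z N -> E M -> E N -> E (M *m N)) ->
  forall M, SL2Z M -> E M.
Proof.
move=> eS eT eT' eM.
have sT' : SL2Z (adj2 mxT) by apply: SL2Z_adj; exact: SL2Z_T.
have sTq q : SL2Z (mx2 1 q 0 1) by rewrite /SL2Z /= det_mx2 mul1r mulr0 subr0.
have eN1 : E (mx2 (- 1) 0 0 (- 1)).
  by have := eM _ _ SL2Z_S SL2Z_S eS eS; rewrite mulmx2.
have sN1 : SL2Z (mx2 (- 1) 0 0 (- 1)) by rewrite /SL2Z /= det_mx2.
have e1 : E (mx2 1 0 0 1) by have := eM _ _ sN1 sN1 eN1 eN1; rewrite mulmx2.
have eTn (n : nat) : E (mx2 1 n%:Z 0 1) /\ E (mx2 1 (- n%:Z) 0 1).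
  elim: n => [|n [h1 h2]]; first by rewrite oppr0.
  have := eM _ _ (sTq _) SL2Z_T h1 eT; have := eM _ _ (sTq _) sT' h2 eT'.
  rewrite /adj2 /mxT !mx2E !mulmx2 !mul1r !mulr0 !mul0r !addr0 !add0r !mulr1 => k2 k1.
  by split; [move: k1|move: k2]; congr (E (mx2 _ _ _ _)); lia.
have eTq q : E (mx2 1 q 0 1).
  by case: (intP q) => [|n|n]; [have [] := eTn 0%N|have [] := eTn n.+1|have [] := eTn n.+1].
move=> M; move: {2}`|M 1%R 0%R|%N (leqnn `|M 1%R 0%R|%N) => n; elim: n M => [|n IH] M hn hM.
  have c0 : M 1 0 = 0 by apply/eqP; rewrite -absz_eq0 -leqn0.
  have hd : M 0 0 * M 1 1 = 1 by have := hM; rewrite /SL2Z /= det_mx2E c0 mulr0 subr0.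
  have : M 0 0 = 1 /\ M 1 1 = 1 \/ M 0 0 = - 1 /\ M 1 1 = - 1.
    have : `|M 0%R 0%R|%N = 1%N.
      by apply/eqP; rewrite -dvdn1; apply/dvdnP; exists `|M 1%R 1%R|%N; rewrite mulnC -abszM hd.
    by move: hd; set a := M 0 0; set d := M 1 1 => hd ha; have [h|h] : a = 1 \/ a = -1 by [lia|left|right]; nia.
  case=> -[h0 h1]; rewrite [M]mx2_eta c0 h0 h1; first exact: eTq.
  have -> : mx2 (- 1) (M 0 1) 0 (- 1) = mx2 (- 1) 0 0 (- 1) *m mx2 1 (- M 0 1) 0 1.
    by rewrite mulmx2; congr mx2; ring.
  exact: eM.
have [c0|c0] := eqVneq (M 1 0) 0; first by apply: IH => //; rewrite c0.
set q := divz (M 0 0) (M 1 0); set r := modz (M 0 0) (M 1 0).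
have qr : M 0 0 = q * M 1 0 + r by exact: divz_eq.
pose N := mx2 (M 1 0) (M 1 1) (- r) (- (M 0 1 - q * M 1 1)).
have eE : M = mx2 1 q 0 1 *m (mx2 (- 1) 0 0 (- 1) *m (mxS *m N)).
  by rewrite !mulmx2 [M in LHS]mx2_eta; congr mx2; rewrite ?qr; ring.
have sN : SL2Z N.
  by have := hM; rewrite /SL2Z /= det_mx2 det_mx2E qr => <-; ring.
have eNN : E N.
  apply: IH => //; rewrite /N !mx2E abszN; have := ltz_mod (M 0 0) c0; have := modz_ge0 (M 0 0) c0.
  by rewrite -/r; move: hn; set u := M 1 0; lia.
have sSN : SL2Z (mxS *m N) by apply: SL2Z_mul => //; exact: SL2Z_S.
rewrite eE; apply: (eM) => //; first exact: SL2Z_mul.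
by apply: (eM) => //; apply: (eM) => //; exact: SL2Z_S.
Qed.

(** * Moebius transformations *)

Section Mobius.
Variable R : realType.
Local Notation C := R[i].
Local Notation nrm := (@normc R).
Implicit Types (M N : 'M[int]_2) (z w : C).

Lemma intrC (m : int) : (m%:~R : C) = ((m%:~R : R)%:C)%C.
Proof. by rewrite rmorph_int. Qed.

Lemma natrC (n : nat) : (n%:R : C) = ((n%:R : R)%:C)%C.
Proof. by rewrite rmorph_nat. Qed.

Lemma Im_autfactor M z : complex.Im (autfactor M z) = (M 1 0)%:~R * complex.Im z.
Proof. by rewrite /autfactor !intrC ImD ImM_real /= addr0. Qed.

Lemma Re_autfactor M z :
  complex.Re (autfactor M z) = (M 1 0)%:~R * complex.Re z + (M 1 1)%:~R.
Proof. by rewrite /autfactor !intrC ReD ReM_real. Qed.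

Lemma autfactor_neq0 M z : \det M != 0 -> upper z -> autfactor M z != 0.
Proof.
move=> hM hz; apply: contra hM => /eqP h.
have := Im_autfactor M z; rewrite h /= => /esym/eqP.
rewrite mulf_eq0 (gt_eqF hz) orbF intr_eq0 => /eqP c0.
have := Re_autfactor M z; rewrite h /= c0 mul0r add0r => /esym/eqP.
by rewrite intr_eq0 => /eqP d0; rewrite det_mx2E c0 d0 !mulr0 subrr.
Qed.

Lemma nrm_sqr z : nrm z ^+ 2 = complex.Re z ^+ 2 + complex.Im z ^+ 2.
Proof. by case: z => a b; rewrite /normc sqr_sqrtr // addr_ge0 ?sqr_ge0. Qed.

Lemma Im_mx_upper M z : \det M != 0 -> upper z ->
  complex.Im (mx_upper M z) = (\det M)%:~R * complex.Im z / nrm (autfactor M z) ^+ 2.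
Proof.
move=> hM hz; have h0 := autfactor_neq0 hM hz.
set w := mx_upper M z.
have E : w * autfactor M z = (M 0 0)%:~R * z + (M 0 1)%:~R by rewrite divfK.
have n0 : nrm (autfactor M z) ^+ 2 != 0 by rewrite expf_eq0 /= nrm_eq0.
apply: (mulIf n0); rewrite divfK // nrm_sqr Re_autfactor Im_autfactor det_mx2E.
have eR : complex.Re (w * autfactor M z) = (M 0 0)%:~R * complex.Re z + (M 0 1)%:~R.
  by rewrite E !intrC ReD ReM_real.
have eI : complex.Im (w * autfactor M z) = (M 0 0)%:~R * complex.Im z.
  by rewrite E !intrC ImD ImM_real /= addr0.
have := Re_autfactor M z; have := Im_autfactor M z.
move: eR eI; clear; case: w (autfactor M z) => [p q] [u v] /= eR eI hv hu.
rewrite rmorphB /= !rmorphM /=; subst u v.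
set A := (M 0 0)%:~R in eR eI *; set B := (M 0 1)%:~R in eR eI *.
set C := (M 1 0)%:~R in eR eI *; set D := (M 1 1)%:~R in eR eI *.
transitivity ((C * complex.Re z + D) * (p * (C * complex.Im z) + q * (C * complex.Re z + D))
  - C * complex.Im z * (p * (C * complex.Re z + D) - q * (C * complex.Im z))); first by ring.
by rewrite eR eI; ring.
Qed.

Lemma upper_mx_upper M z : 0 < \det M -> upper z -> upper (mx_upper M z).
Proof.
move=> hM hz; rewrite /upper Im_mx_upper ?gt_eqF //; apply: divr_gt0.
  by apply: mulr_gt0; rewrite ?ltr0z.
by apply: exprn_gt0; rewrite nrm_gt0 autfactor_neq0 // gt_eqF.
Qed.

Lemma autfactorM M N z : \det N != 0 -> upper z ->
  autfactor (M *m N) z = autfactor M (mx_upper N z) * autfactor N z.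
Proof.
move=> hN hz; have h0 := autfactor_neq0 hN hz.
rewrite {1}/autfactor !mulmx2E {2}/autfactor mulrDl /mx_upper.
rewrite -/(autfactor N z) mulrA -[_ / _ * autfactor N z]mulrA mulVf // mulr1.
by rewrite {1}/autfactor !rmorphD !rmorphM /=; ring.
Qed.

Lemma mx_upperM M N z : \det M != 0 -> 0 < \det N -> upper z ->
  mx_upper (M *m N) z = mx_upper M (mx_upper N z).
Proof.
move=> hM hN' hz; have hN : \det N != 0 by rewrite gt_eqF.
have h0 := autfactor_neq0 hN hz.
have h1 := autfactor_neq0 hM (upper_mx_upper hN' hz).
rewrite {1}/mx_upper -/(autfactor (M *m N) z) autfactorM //.
rewrite {2}/mx_upper -/(autfactor M (mx_upper N z)).
apply: (mulIf (mulf_neq0 h1 h0)); rewrite divfK ?mulf_neq0 // mulrA divfK //.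
rewrite mulrDl /mx_upper -/(autfactor N z) mulrA -[_ / _ * autfactor N z]mulrA mulVf // mulr1.
by rewrite /autfactor !mulmx2E !rmorphD !rmorphM /=; ring.
Qed.

Lemma cderiv_mx_upper M z : \det M != 0 -> upper z ->
  cderiv (mx_upper M) z ((\det M)%:~R / autfactor M z ^+ 2).
Proof.
move=> hM hz; have h0 := autfactor_neq0 hM hz.
have hnum : cderiv (fun w => (M 0 0)%:~R * w + (M 0 1)%:~R) z (M 0 0)%:~R.
  by apply: cderiv_eq (cderivD (cderivZ _ (cderiv_id z)) (cderiv_cst _ z)) _; rewrite mulr1 addr0.
have hden : cderiv (autfactor M) z (M 1 0)%:~R.
  by apply: cderiv_eq (cderivD (cderivZ _ (cderiv_id z)) (cderiv_cst _ z)) _; rewrite mulr1 addr0.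
apply: cderiv_eq (cderivM hnum (cderiv_comp hden (cderivV h0))) _.
rewrite det_mx2E rmorphB !rmorphM /= /autfactor.
rewrite /autfactor in h0; by field.
Qed.

(** The mean value inequality on the segment between the two points, which stays in the half
    plane. *)
Lemma cderiv0_const (G : C -> C) z w : (forall u, upper u -> cderiv G u 0) ->
  upper z -> upper w -> G z = G w.
Proof.
move=> hG hz hw; apply/esym/eqP; rewrite -subr_eq0 -nrm_eq0 eq_le nrm_ge0 andbT.
have -> : (0 : R) = 2 * 0 * nrm (w - z) by rewrite mulr0 mul0r.
apply: (@cderiv_mvi _ _ (fun=> 0)) => [t /andP[t0 t1]|t _]; last by rewrite nrm0.
apply: hG; rewrite /upper ImD ImM_real ImB.
have -> : complex.Im z + t * (complex.Im w - complex.Im z) =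
   (1 - t) * complex.Im z + t * complex.Im w by ring.
move: hz hw; rewrite /upper; nra.
Qed.

Lemma const_lim0 (G : C -> C) z : (forall u w, upper u -> upper w -> G u = G w) ->
  (forall e : R, 0 < e -> exists Y : R, forall w, upper w -> Y < complex.Im w -> nrm (G w) < e) ->
  upper z -> G z = 0.
Proof.
move=> hc hl hz; apply/eqP; rewrite -nrm_eq0 eq_le nrm_ge0 andbT.
apply/ler_addgt0Pr => e /hl[Y hY]; rewrite add0r.
pose w : C := (0 +i* (`|Y| + 1))%C.
have hw : upper w by rewrite /upper /= ltr_wpDl.
rewrite (hc z w) // ltW // hY //= ltr_pwDr // ler_norm //.
Qed.

End Mobius.

(** * The q-expansion of a cusp form *)

Section QExpansion.
Variable R : realType.
Local Notation C := R[i].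
Local Notation nrm := (@normc R).
Implicit Types (z w : C) (a b : nat -> C).

Lemma q_expansion_chas (F : C -> C) a z : q_expansion F a -> upper z ->
  chas (fun n => a n * qpar z ^+ n) (F z).
Proof.
move=> h hz e e0; have e0' : 0 < (e%:C)%C by rewrite ltcR.
have [N _ hN] := (@cvgrPdist_lt C C^o _ _ _ _ _).1 (h z hz) _ e0'; exists N => n /hN /=.
by rewrite normc_def ltcR nrmB /normc; case: (F z - _).
Qed.

Lemma exists_qpar_norm (r : R) : 0 < r < 1 -> exists2 z : C, upper z & nrm (qpar z) = r.
Proof.
move=> /andP[r0 r1]; have p0 : 0 < 2 * (pi : R) by rewrite mulr_gt0 ?pi_gt0.
exists (0 +i* (- ln r / (2 * pi)))%C.
  by rewrite /upper /= divr_gt0 // oppr_gt0 ln_lt0 // r0.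
by rewrite nrm_qpar /= mulrC divfK ?gt_eqF // opprK lnK.
Qed.

Lemma chas_terms_bounded a (s : C) : chas a s -> exists B : R, forall n, nrm (a n) <= B.
Proof.
move=> /(_ 1 ltr01)[N hN]; exists (2 + \sum_(i < N) nrm (a i)) => n.
have S0 m : 0 <= \sum_(i < m) nrm (a i) by apply: sumr_ge0 => i _; exact: nrm_ge0.
have [hn|hn] := leqP N n.
  have h1 := hN n hn; have h2 := hN n.+1 (leqW hn).
  rewrite big_ord_recr /= in h2.
  have -> : a n = (\sum_(i < n) a i + a n - s) - (\sum_(i < n) a i - s) by ring.
  apply: le_trans (le_normcD _ _) _; rewrite normcN.
  have := S0 N; lra.
apply: le_trans (_ : _ <= \sum_(i < N) nrm (a i)) _; last by rewrite lerDr.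
rewrite (bigD1 (Ordinal hn)) //= lerDl; apply: sumr_ge0 => i _; exact: nrm_ge0.
Qed.

(** The terms of a convergent series are bounded, and [|q|] takes every value between 0 and
    1. *)
Lemma q_expansion_subexp (F : C -> C) a : q_expansion F a -> subexp a.
Proof.
move=> h r /exists_qpar_norm[z hz hr].
have [B hB] := chas_terms_bounded (q_expansion_chas h hz).
by exists B => n; rewrite -hr -nrmX -normcM.
Qed.

Lemma q_expansion_Sser (F : C -> C) a z : q_expansion F a -> upper z -> F z = Sser a z.
Proof. by move=> h hz; apply/esym/csumE; exact: q_expansion_chas. Qed.

Lemma expR_decay_lt (c : R) (e : R) : 0 < c -> 0 < e ->
  exists2 Y : R, 0 < Y & forall y, Y < y -> expR (- (c * y)) < e.
Proof.
move=> c0 e0; exists (`|ln e| / c + 1); first by rewrite ltr_wpDl // divr_ge0 // ltW.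
move=> y hy; rewrite -[ltRHS]lnK ?posrE // ltr_expR ltrNl.
have h : `|ln e| < c * y.
  rewrite mulrC -ltr_pdivrMr //; apply: le_lt_trans hy; by rewrite lerDl.
by apply: le_lt_trans h; rewrite -normrN ler_norm.
Qed.

Lemma Sser_lim0 b : subexp b -> b 0%N = 0 -> forall e : R, 0 < e ->
  exists2 Y : R, 0 < Y & forall z, Y < complex.Im z -> nrm (Sser b z) < e.
Proof.
move=> hb b0 e e0; have [M [M0 hM]] := Sser_decay hb b0 (@ltr01 R).
have p0 : 0 < 2 * (pi : R) by rewrite mulr_gt0 ?pi_gt0.
have M1 : 0 < M + 1 by rewrite ltr_wpDl.
have [Y Y0 hY] := expR_decay_lt p0 (divr_gt0 e0 M1).
exists (Num.max Y 1) => [|z]; first by rewrite lt_max Y0.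
rewrite gt_max => /andP[h1 h2]; apply: le_lt_trans (hM z (ltW h2)) _.
apply: le_lt_trans (_ : _ <= (M + 1) * expR (- (2 * pi * complex.Im z))) _.
  by apply: ler_wpM2r; rewrite ?expR_ge0 // lerDl.
by rewrite mulrC -ltr_pdivlMr //; exact: hY.
Qed.

(** The constant term is the limit of [F] at the cusp oo. *)
Lemma cusp_form_a0 (p k : nat) (F : C -> C) a : cusp_form p k F -> q_expansion F a ->
  a 0%N = 0.
Proof.
move=> [_ _ hc] hq; have ha := q_expansion_subexp hq.
pose b n := if n == 0%N then 0 else a n; pose d n := if n == 0%N then a 0%N else 0.
have hb : subexp b.
  by apply: (@subexp_le _ a _ 1) => // n; rewrite /b mul1r; case: eqP => // _; rewrite nrm0 nrm_ge0.
have hd z : chas (fun n => d n * qpar z ^+ n) (a 0%N).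
  move=> e e0; exists 1%N => -[//|n] _; rewrite big_ord_recl /= expr0 mulr1 big1 ?addr0 ?subrr ?nrm0 //.
  by move=> i _; rewrite /d /= mul0r.
have E z : upper z -> F z = a 0%N + Sser b z.
  move=> hz; rewrite (q_expansion_Sser hq hz); apply: csumE.
  apply: chas_eq (chasD (hd z) (chas_Sser hb hz)) => n.
  by rewrite /d /b -mulrDl; case: eqP => [->|]; rewrite ?addr0 ?add0r.
apply: eq_le_eps => e e0; rewrite subr0; have e2 : 0 < e / 2 by rewrite divr_gt0.
have [Y1 h1] := hc 1%:M (det1 _ _) _ e2.
have [Y2 Y20 h2] := Sser_lim0 hb (erefl _) e2.
pose w : C := (0 +i* (`|Y1| + Y2 + 1))%C.
have hw : upper w by rewrite /upper /= ltr_wpDl // addr_ge0 // ltW.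
have w1 : Y1 < complex.Im w.
  by rewrite /= -addrA ltr_pwDr ?ler_norm // addr_gt0.
have w2 : Y2 < complex.Im w by rewrite /= ltr_pwDr // lerDr.
have := h1 w hw w1; have := h2 w w2.
have au : autfactor 1%:M w = 1 by rewrite /autfactor !mxE /= mul0r add0r.
have mu : mx_upper 1%:M w = w.
  by rewrite /mx_upper -/(autfactor 1%:M w) au divr1 !mxE /= mul1r addr0.
rewrite mu au expr1n invr1 mul1r normc_def ltcR => k2 k1.
have -> : a 0%N = F w - Sser b w by rewrite E // addrK.
apply: le_lt_trans (le_normcD _ _) _; rewrite normcN (splitr e); apply: ltrD => //.
by move: k1; rewrite /normc; case: (F w).
Qed.

End QExpansion.

(** * Hecke operators on series in q *)

Section HeckeSeries.
Variable R : realType.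
Local Notation C := R[i].
Local Notation nrm := (@normc R).
Implicit Types (z w : C) (a b : nat -> C).

Lemma qpar_frac_neq1 (l n : nat) : (0 < l)%N -> ~~ (l %| n)%N ->
  qpar (n%:R / l%:R : C) != 1.
Proof.
move=> l0 hn; have l0' : (l%:R : C) != 0 by rewrite pnatr_eq0 -lt0n.
have -> : (n%:R / l%:R : C) = (n %% l)%:R / l%:R + (n %/ l)%:R.
  by rewrite {1}(divn_eq n l) natrD natrM; field.
rewrite qparDn; set m := (n %% l)%N.
have m0 : (0 < m)%N by rewrite lt0n.
have ml : (m < l)%N by rewrite ltn_mod.
pose t : R := m%:R / l%:R.
have -> : (m%:R / l%:R : C) = (t%:C)%C by rewrite rmorphM /= fmorphV /= !rmorph_nat.
have p0 := pi_gt0 R.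
have lR : 0 < (l%:R : R) by rewrite ltr0n.
have t0 : 0 < t by rewrite divr_gt0 // ltr0n.
have t1 : t < 1 by rewrite ltr_pdivrMr // mul1r ltr_nat.
apply/eqP => h; have : complex.Re (qpar ((t%:C)%C : C)) = 1 by rewrite h.
rewrite /qpar /= mulr0 oppr0 expR0 mul1r mul0r subr0.
have -> : 2 * pi * t = (pi * t) *+ 2 by ring.
rewrite cos_mulr2n cos2sin2.
have := @sin_gt0_pi R (pi * t); rewrite mulr_gt0 //=.
rewrite -[X in _ < X]mulr1 ltr_pM2l // t1 => /(_ isT) s0.
by have : 0 < sin (pi * t) ^+ 2; [exact: exprn_gt0|]; lra.
Qed.

(** The power sum of a root of unity other than 1 vanishes. *)
Lemma qpar_root_sum (l n : nat) : (0 < l)%N ->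
  \sum_(j < l) qpar (j%:R / l%:R : C) ^+ n = if (l %| n)%N then l%:R else 0.
Proof.
move=> l0; have l0' : (l%:R : C) != 0 by rewrite pnatr_eq0 -lt0n.
set x := qpar (n%:R / l%:R : C).
have E (j : nat) : qpar (j%:R / l%:R : C) ^+ n = x ^+ j.
  by rewrite /x -!qparMn; congr qpar; ring.
under eq_bigr do rewrite E.
have xl : x ^+ l = 1 by rewrite /x -qparMn mulrCA mulfV // qparMn qpar1 expr1n.
case: ifPn => hn.
  have -> : x = 1.
    case/dvdnP: hn => q hq; rewrite /x hq natrM mulfK // -[q%:R]mulr1 qparMn qpar1.
    exact: expr1n.
  by under eq_bigr do rewrite expr1n; rewrite sumr_const card_ord.
have x1 : x - 1 != 0 by rewrite subr_eq0; exact: qpar_frac_neq1.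
by apply: (mulfI x1); rewrite mulr0 -subrX1 xl subrr.
Qed.

Lemma chas_divn (l : nat) b z : (0 < l)%N -> subexp b -> upper z ->
  chas (fun n => (if (l %| n)%N then b (n %/ l)%N else 0) * qpar z ^+ n) (Sser b (l%:R * z)).
Proof.
move=> l0 hb hz.
have hlz : upper (l%:R * z) by rewrite /upper natrC ImM_real mulr_gt0 // ltr0n.
have := @chas_multiples R l (fun n => b (n %/ l)%N * qpar z ^+ n) (Sser b (l%:R * z)) l0.
have h := chas_eq _ (chas_Sser hb hlz).
move=> /(_ (h _ _)) h1; apply: chas_eq (h1 _) => n; first by case: ifP; rewrite ?mul0r.
by rewrite mulKn // qparMn exprM.
Qed.

(** Averaging over the translates by [j] keeps the exponents divisible by [l]. With [d = 0]
    this is the operator U_l, and with [d = l ^ k] it is T_l in weight [k], up to a factor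
    [l] on both sides. *)
Lemma Sser_hecke (l : nat) b (c d : C) z : (0 < l)%N -> subexp b -> upper z ->
  (forall n, l%:R * b (l * n)%N + d * (if (l %| n)%N then b (n %/ l)%N else 0) = c * b n) ->
  \sum_(j < l) Sser b ((z + j%:R) / l%:R) + d * Sser b (l%:R * z) = c * Sser b z.
Proof.
move=> l0 hb hz hl; have l0' : (l%:R : C) != 0 by rewrite pnatr_eq0 -lt0n.
have lR : 0 < (l%:R : R) by rewrite ltr0n.
have up (j : nat) : upper ((z + j%:R) / l%:R).
  have -> : (z + j%:R) / l%:R = ((l%:R^-1 : R)%:C)%C * (z + j%:R).
    by rewrite fmorphV /= rmorph_nat mulrC.
  by rewrite /upper ImM_real ImD natrC /= addr0 mulr_gt0 // invr_gt0.
have h1 := chas_sum (fun j _ => chas_Sser hb (up j)) (n := l).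
have h2 : chas (fun n => l%:R * b (l * n)%N * qpar z ^+ n)
    (c * Sser b z - d * Sser b (l%:R * z)).
  have := chasD (chasZ c (chas_Sser hb hz)) (chasZ (- d) (chas_divn l0 hb hz)).
  rewrite mulNr; apply: chas_eq => n; rewrite mulNr !mulrA -mulrBl -hl; congr (_ * _); ring.
have h3 : chas (fun n => if (l %| n)%N then l%:R * b n * qpar (z / l%:R) ^+ n else 0)
    (c * Sser b z - d * Sser b (l%:R * z)).
  apply: (@chas_multiples R l (fun n => l%:R * b n * qpar (z / l%:R) ^+ n)) => //.
  have e : qpar (z / l%:R) ^+ l = qpar z by rewrite -qparMn mulrCA mulfV // mulr1.
  by apply: chas_eq h2 => n; rewrite exprM e.
rewrite (chas_unique h1 (chas_eq _ h3)) ?subrK // => n.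
under eq_bigr do rewrite mulrDl qparD exprMn mulrA.
rewrite -mulr_sumr qpar_root_sum //; case: ifP => _; last by rewrite mulr0.
by rewrite [RHS]mulrC mulrA.
Qed.

End HeckeSeries.

(** ** A scaling equation for series *)

Section Renormalize.
Variable R : realType.
Local Notation C := R[i].
Local Notation nrm := (@normc R).

Lemma pow_small (A r : R) : 0 <= A -> 0 < r < 1 ->
  exists N, forall n, (N <= n)%N -> A * r ^+ n <= 2^-1.
Proof.
move=> A0 /andP[r0 r1]; pose x := r^-1 - 1.
have x0 : 0 < x by rewrite subr_gt0 invf_gt1.
exists (Num.truncn (2 * A / x)).+1 => n hn.
have h1 : 2 * A <= n%:R * x.
  rewrite -ler_pdivrMr //; apply: le_trans (ltW (truncnS_gt _)) _.
  by rewrite ler_nat.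
have h2 := bernoulli_ineq n (ltW x0).
have h3 : 2 * A <= r ^- n.
  by apply: le_trans h1 (le_trans h2 _); rewrite /x addrC subrK exprVn.
have rn : 0 < r ^+ n by exact: exprn_gt0.
rewrite -ler_pdivlMr // -[leLHS](mulKf (_ : 2 != 0)) //.
by apply: ler_wpM2l; rewrite ?invr_ge0.
Qed.

(** The recursion b_n = A (e_n + b_(n/p)), whose second term is present for the multiples of
    p, unfolded [f] times. As n / p is less than n, [f = n] is always enough. *)
Fixpoint renorm_fuel (p : nat) (A : C) (e : nat -> C) (f n : nat) : C :=
  if f is f'.+1 then
    A * (e n + if (p %| n)%N then renorm_fuel p A e f' (n %/ p) else 0)
  else 0.

(** The division of the index by [p] beats the constant [A]: in radius [r] the second term
    is multiplied by [A r ^ (n - n / p)], which is at most 1/2 for large [n]. *)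
Lemma renorm_series (p : nat) (A : C) (e : nat -> C) : (1 < p)%N ->
  subexp e -> e 0%N = 0 -> exists b : nat -> C, [/\ subexp b, b 0%N = 0 &
    forall n, b n = A * (e n + if (p %| n)%N then b (n %/ p)%N else 0)].
Proof.
move=> p1 he e0; have p0 := ltnW p1.
have fuel0 f : renorm_fuel p A e f 0 = 0.
  by elim: f => //= f IH; rewrite dvdn0 div0n IH e0 addr0 mulr0.
have fuelE f g n : (n <= f)%N -> (n <= g)%N ->
    renorm_fuel p A e f n = renorm_fuel p A e g n.
  elim: f g n => [|f IH] g [|n] //; rewrite ?fuel0 //.
  case: g => // g nf ng /=; congr (_ * (_ + _)); case: ifP => // _.
  have h : (n.+1 %/ p <= n)%N by rewrite -ltnS ltn_Pdiv.
  by apply: IH; apply: leq_trans h _.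
pose b n := renorm_fuel p A e n n.
have bE n : b n = A * (e n + if (p %| n)%N then b (n %/ p)%N else 0).
  case: n => [|n]; first by rewrite /b /= dvdn0 div0n e0 addr0 mulr0.
  rewrite /b /=; congr (_ * (_ + _)); case: ifP => // _.
  by apply: fuelE => //; rewrite -ltnS ltn_Pdiv.
exists b; split=> // r r01; have /andP[r0 r1] := r01.
have [B hB] := he r r01.
have B0 : 0 <= B by apply: le_trans (hB 0%N); rewrite e0 nrm0 mul0r.
have A0 := nrm_ge0 A.
have [N hN] := pow_small A0 r01.
have rn n : 0 <= r ^+ n by rewrite exprn_ge0 // ltW.
pose S := \sum_(i < N.*2) nrm (b i) * r ^+ i.
have t0 i : 0 <= nrm (b i) * r ^+ i by rewrite mulr_ge0 ?nrm_ge0.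
have S0 : 0 <= S by apply: sumr_ge0.
exists (S + 2 * (nrm A * B)) => n; elim/ltn_ind: n => n IH.
have AB : 0 <= nrm A * B by rewrite mulr_ge0.
have [hn|hn] := ltnP n N.*2.
  apply: le_trans (_ : _ <= S) _; last by rewrite lerDl mulr_ge0.
  by rewrite /S (bigD1 (Ordinal hn)) //= lerDl; apply: sumr_ge0.
rewrite bE normcM.
have h1 : nrm A * nrm (e n) * r ^+ n <= nrm A * B.
  by rewrite -mulrA; apply: ler_wpM2l.
case: ifPn => hp; last by rewrite addr0; lra.
have h2 : nrm A * nrm (b (n %/ p)%N) * r ^+ n <= 2^-1 * (S + 2 * (nrm A * B)).
  have [n0|n0] := posnP n; first by rewrite n0 div0n {1}/b nrm0 mulr0 mul0r; lra.
  have le : (n %/ p <= n)%N by exact: leq_div.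
  have -> : r ^+ n = r ^+ (n - n %/ p) * r ^+ (n %/ p) by rewrite -exprD subnK.
  rewrite mulrACA; apply: ler_pM; rewrite ?mulr_ge0 ?nrm_ge0 //.
    apply: hN; move: hn; rewrite -addnn => hn.
    have : (n %/ p * 2 <= n)%N.
      by apply: leq_trans (_ : n %/ p * p <= n)%N; rewrite ?leq_mul2l ?p1 ?orbT // leq_trunc_div.
    lia.
  by apply: IH; rewrite ltn_Pdiv.
apply: le_trans (_ : nrm A * nrm (e n) * r ^+ n + nrm A * nrm (b (n %/ p)%N) * r ^+ n <= _); last lra.
rewrite -mulrDl -mulrDr; apply: ler_wpM2r => //; apply: ler_wpM2l => //.
exact: le_normcD.
Qed.

End Renormalize.

(** * Decay at the cusp 0 *)

Section CuspZero.
Variable R : realType.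
Local Notation C := R[i].
Local Notation nrm := (@normc R).
Implicit Types (z w : C).
Variables (p k : nat) (F : C -> C) (a : nat -> C) (cp : C).
Hypothesis pp : prime p.
Hypothesis hq : q_expansion F a.
Hypothesis hc : cusp_form p k F.
Hypothesis hU : forall n, a (p * n)%N = cp * a n.
Hypothesis cp0 : cp != 0.

Let mxS := mx2 0 (-1) 1 0.
(** [F | S] for the inversion S. It has period [p], and its decay at oo is the decay of [F]
    at the cusp 0, deduced below from the eigenvalue equation of U_p. *)
Definition Wfun z : C := autfactor mxS z ^- k * F (mx_upper mxS z).
Let p0 : (p%:R : C) != 0.
Proof. by rewrite pnatr_eq0 -lt0n prime_gt0. Qed.

Lemma upperMn (n : nat) z : (0 < n)%N -> upper z -> upper (n%:R * z).
Proof. by move=> n0 hz; rewrite /upper natrC ImM_real mulr_gt0 // ltr0n. Qed.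

Lemma upperDint (m : int) z : upper z -> upper (z + m%:~R).
Proof. by rewrite /upper ImD intrC /= addr0. Qed.

Lemma upper_div (n : nat) z : (0 < n)%N -> upper z -> upper (z / n%:R).
Proof.
move=> n0; have -> : z / n%:R = ((n%:R^-1 : R)%:C)%C * z.
  by rewrite fmorphV /= rmorph_nat mulrC.
by move=> hz; rewrite /upper ImM_real mulr_gt0 // invr_gt0 ltr0n.
Qed.

Lemma upper_neq0 z : upper z -> z != 0.
Proof. by move=> h; apply: contraTneq h => ->; rewrite /upper /= ltxx. Qed.

Lemma bezout_p (b : nat) : (0 < b < p)%N -> exists d y : int, b%:Z * d - y * p%:Z = 1.
Proof.
move=> /andP[b0 bp].
have cop : coprimez b%:Z p%:Z.
  by rewrite /coprimez /gcdz /= eqz_nat -/(coprime b p) coprime_sym prime_coprime // gtnNdvd.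
have [[u v] /= h] := coprimezP _ _ cop.
by exists u, (- v); rewrite mulNr opprK mulrC.
Qed.

Lemma autS z : autfactor mxS z = z.
Proof. by rewrite /autfactor !mx2E /= mul1r addr0. Qed.

Lemma mobS z : mx_upper mxS z = - z^-1.
Proof. by rewrite /mx_upper -/(autfactor mxS z) autS !mx2E /= mul0r add0r mulN1r. Qed.

(** This is the equation of U_p at [S z]. The term [j = 0] of U_p is [F (S (p z))], and for
    [j > 0], with [d] an inverse of [j] modulo [p], an element of [Gamma0 p] carries [(z -
    d) / p] to [(S z + j) / p]. *)
Lemma Wfun_functional : exists d : nat -> int, forall z, upper z ->
  Wfun (p%:R * z) = p%:R * cp / p%:R ^+ k * Wfun z -
    p%:R ^- k * \sum_(b < p | b != 0%N :> nat) F ((z - (d b)%:~R) / p%:R).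
Proof.
have /choice[d hd] : forall b : nat, exists d : int, (0 < b < p)%N ->
    exists y : int, b%:Z * d - y * p%:Z = 1.
  move=> b; have [/bezout_p[d [y h]]|_] := boolP (0 < b < p)%N; last by exists 0.
  by exists d => _; exists y.
exists d => z hz; have z0 := upper_neq0 hz.
have hS : upper (mx_upper mxS z) by apply: upper_mx_upper hz; rewrite det_mx2.
have ha := q_expansion_subexp hq.
have := @Sser_hecke R p a (p%:R * cp) 0 (mx_upper mxS z) (prime_gt0 pp) ha hS.
rewrite mul0r addr0 => /(_ _) h.
have {h} : \sum_(j < p) F ((mx_upper mxS z + j%:R) / p%:R) = p%:R * cp * F (mx_upper mxS z).
  rewrite (q_expansion_Sser hq hS) -h => [|n]; last by rewrite mul0r addr0 hU mulrA.
  apply: eq_bigr => j _; apply: q_expansion_Sser hq _.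
  by apply: upper_div; rewrite ?prime_gt0 //; apply: (@upperDint j).
rewrite (bigD1 (Ordinal (prime_gt0 pp))) //= addr0 => hsum.
have e0 : F (mx_upper mxS z / p%:R) = (p%:R * z) ^+ k * Wfun (p%:R * z).
  rewrite /Wfun autS mulrA mulfV ?mul1r ?expf_neq0 ?mulf_neq0 //.
  by rewrite !mobS invfM mulNr [_^-1 * _]mulrC.
have e1 (j : 'I_p) : j != Ordinal (prime_gt0 pp) ->
    F ((mx_upper mxS z + j%:R) / p%:R) = z ^+ k * F ((z - (d j)%:~R) / p%:R).
  move=> hj; have j0 : (0 < j < p)%N.
    by rewrite ltn_ord andbT lt0n; apply: contra hj => /eqP h; apply/eqP/val_inj.
  have [y hy] := hd j j0; set u := (z - (d j)%:~R) / p%:R.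
  have hu : upper u.
    by apply: upper_div; rewrite ?prime_gt0 //; rewrite -rmorphN; exact: upperDint.
  have hG : Gamma0 p (mx2 j%:Z y p%:Z (d j)).
    by split; [rewrite det_mx2|rewrite mx2E].
  have aE : autfactor (mx2 j%:Z y p%:Z (d j)) u = z.
    by rewrite /autfactor !mx2E /u /= -pmulrn; field.
  rewrite -[in RHS]aE -(cusp_form_mod hc hG hu); congr F.
  rewrite mobS /mx_upper -/(autfactor (mx2 j%:Z y p%:Z (d j)) u) aE !mx2E.
  have hy' : (j%:R : C) * (d j)%:~R - y%:~R * p%:R = 1.
    by have := congr1 (fun m : int => (m%:~R : C)) hy; rewrite rmorphB !rmorphM.
  apply: (mulIf z0); rewrite divfK // /u.
  have -> : y%:~R = ((j%:R : C) * (d j)%:~R - 1) / p%:R.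
    by apply: (mulIf p0); rewrite divfK // -[X in _ - X]hy'; ring.
  by rewrite /= -pmulrn; field; rewrite p0.
have hFS : F (mx_upper mxS z) = z ^+ k * Wfun z.
  by rewrite /Wfun autS mulrA mulfV ?mul1r ?expf_neq0.
move: hsum; rewrite e0 hFS (eq_bigr _ e1) -mulr_sumr exprMn => hsum.
have zk : z ^+ k != 0 by rewrite expf_neq0.
have pk : (p%:R : C) ^+ k != 0 by rewrite expf_neq0.
apply: (mulfI pk); apply: (mulfI zk).
rewrite (eq_bigl (fun i : 'I_p => i != Ordinal (prime_gt0 pp))) //.
set S1 := \sum_(i < p | _) _ in hsum *.
transitivity (p%:R ^+ k * z ^+ k * Wfun (p%:R * z)); first by ring.
have -> : p%:R ^+ k * z ^+ k * Wfun (p%:R * z) = p%:R * cp * (z ^+ k * Wfun z) - z ^+ k * S1.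
  by rewrite -hsum addrK.
by field.
Qed.

Lemma Wfun_period z : upper z -> Wfun (z + p%:R) = Wfun z.
Proof.
move=> hz; have hzp : upper (z + p%:R) by apply: (@upperDint p).
have hS : upper (mx_upper mxS z) by apply: upper_mx_upper hz; rewrite det_mx2.
have hG : Gamma0 p (mx2 1 0 (- p%:Z) 1).
  split; first by rewrite det_mx2 mul0r subr0 mulr1.
  by rewrite mx2E; apply/dvdzP; exists (-1); rewrite mulN1r.
have z0 := upper_neq0 hz; have zp0 := upper_neq0 hzp.
have aE : autfactor (mx2 1 0 (- p%:Z) 1) (mx_upper mxS z) = (z + p%:R) / z.
  by rewrite /autfactor !mx2E mobS /= mulrNz -pmulrn; field.
have mE : mx_upper (mx2 1 0 (- p%:Z) 1) (mx_upper mxS z) = mx_upper mxS (z + p%:R).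
  rewrite /mx_upper -!/(autfactor _ _) aE !mx2E !autS /=.
  by field; rewrite z0 zp0.
rewrite /Wfun !autS -mE (cusp_form_mod hc hG hS) aE exprMn exprVn.
by rewrite mulrA mulrA mulVf ?mul1r // expf_neq0.
Qed.

Lemma nrm_qpar_real (t : R) : nrm (qpar ((t%:C)%C : C)) = 1.
Proof. by rewrite nrm_qpar /= mulr0 oppr0 expR0. Qed.

(** Each [F ((z - d) / p)] is a series in exp (2 pi i z / p), whose coefficients are those
    of [F] times roots of unity. *)
Lemma Wfun_error_series (d : nat -> int) : exists e : nat -> C,
  [/\ subexp e, e 0%N = 0 & forall z, upper z ->
    - (p%:R ^- k * \sum_(b < p | b != 0%N :> nat) F ((z - (d b)%:~R) / p%:R)) =
    Sser e (z / p%:R)].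
Proof.
have ha := q_expansion_subexp hq; have a0 := cusp_form_a0 hc hq.
pose x b : C := qpar (- (d b)%:~R / p%:R).
have x1 b : nrm (x b) = 1.
  rewrite /x; have -> : - (d b)%:~R / p%:R = ((- (d b)%:~R / p%:R : R)%:C)%C :> C.
    by rewrite rmorphM rmorphN /= rmorph_int fmorphV /= rmorph_nat.
  exact: nrm_qpar_real.
pose s n : C := \sum_(b < p | b != 0%N :> nat) x b ^+ n.
pose e n := - (p%:R ^- k * (a n * s n)).
have he : subexp e.
  apply: (@subexp_le _ a _ (nrm (p%:R ^- k) * p%:R)) => // n.
  rewrite normcN !normcM mulrCA [leRHS]mulrC; apply: ler_wpM2l; first exact: nrm_ge0.
  apply: ler_wpM2l; first exact: nrm_ge0.
  apply: le_trans (nrm_sum _ _ _) _.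
  apply: le_trans (_ : _ <= \sum_(b < p) 1) _; last by rewrite sumr_const card_ord.
  rewrite big_mkcond; apply: ler_sum => b _; case: ifP => // _.
  by rewrite nrmX x1 expr1n.
exists e; split=> //; first by rewrite /e a0 mul0r mulr0 oppr0.
move=> z hz; have pz := prime_gt0 pp.
have hu b : upper ((z - (d b)%:~R) / p%:R).
  by apply: upper_div => //; rewrite -rmorphN; exact: upperDint.
apply/esym/csumE; rewrite big_mkcond /= -mulNr.
have h b : (b < p)%N -> chas
    (fun n => if b != 0%N then a n * qpar ((z - (d b)%:~R) / p%:R) ^+ n else 0)
    (if b != 0%N then F ((z - (d b)%:~R) / p%:R) else 0).
  move=> _; case: ifP => _; last first.
    by move=> eps e0; exists 0%N => m _; rewrite big1 // subrr nrm0.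
  exact: q_expansion_chas.
apply: chas_eq (chasZ _ (chas_sum h)) => n.
rewrite /e -mulNr -mulrA; congr (_ * _).
rewrite /s [in RHS]big_mkcond /= mulr_sumr mulr_suml; apply: eq_bigr => b _.
case: ifP => _; last by rewrite mulr0 mul0r.
by rewrite mulrBl qparD -mulNr exprMn -/(x b) [qpar _ ^+ n * _]mulrC mulrA.
Qed.

Lemma Wfun_lim0 (eps : R) : 0 < eps -> exists Y : R, forall z, upper z ->
  Y < complex.Im z -> nrm (Wfun z) < eps.
Proof.
move=> e0; have [Y hY] := cusp_form_cusps hc (det_mx2 0 (-1) 1 0) e0.
exists Y => z hz zY; have := hY z hz zY; rewrite normc_def ltcR /Wfun.
by rewrite /normc; case: (_ * _).
Qed.

Lemma cderiv_F z : upper z -> exists l, cderiv F z l.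
Proof.
move=> hz; have ha := q_expansion_subexp hq.
exists (Sser (fun n => @tpi R * n%:R * a n) z).
apply: (cderiv_local (G := Sser a) hz) (cderiv_Sser ha hz) => w hw.
apply/esym/q_expansion_Sser => //; rewrite /upper.
have := le_lt_trans (Im_le_nrm _) hw; rewrite ImB ltr_norml => /andP[h1 _].
by move: h1; rewrite ltrBrDl subrr.
Qed.

Lemma cderiv_Wfun z : upper z -> exists l, cderiv Wfun z l.
Proof.
move=> hz; have hS : upper (mx_upper mxS z) by apply: upper_mx_upper hz; rewrite det_mx2.
have [l hl] := cderiv_F hS.
have h1 := cderiv_comp (cderiv_mx_upper (_ : \det mxS != 0) hz) hl.
have z0 := upper_neq0 hz.
have h2 := cderivX k (cderivV z0).
have := cderivM h2 (h1 _); rewrite det_mx2 => /(_ isT) h3.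
eexists; apply: cderiv_ext h3 => w /=; by rewrite /Wfun autS exprVn.
Qed.

(** The scaling relation divides the period [p] by [p] as often as wanted. *)
Lemma small_periods (V : C -> C) (al : C) n z : al != 0 ->
  (forall z, upper z -> V (p%:R * z) = al * V z) ->
  (forall z, upper z -> V (z + p%:R) = V z) ->
  upper z -> V (z + p%:R / p%:R ^+ n) = V z.
Proof.
move=> al0 Vp Vper; have pz := prime_gt0 pp.
have up m w : upper w -> upper (p%:R ^+ m * w).
  by move=> hw; rewrite -natrX; apply: upperMn; rewrite ?expn_gt0 ?pz.
have Vpn m w : upper w -> V (p%:R ^+ m * w) = al ^+ m * V w.
  move=> hw; elim: m => [|m IH]; first by rewrite !expr0 !mul1r.
  by rewrite (exprS p%:R) -mulrA (Vp _ (up m w hw)) IH exprS mulrA.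
move=> hz; have hz' : upper (z + p%:R / p%:R ^+ n).
  rewrite -natrX; have -> : p%:R / (p ^ n)%:R = ((p%:R / (p ^ n)%:R : R)%:C)%C :> C.
    by rewrite rmorphM fmorphV /= !rmorph_nat.
  by rewrite /upper ImD /= addr0.
apply: (mulfI (expf_neq0 n al0)); rewrite -!Vpn // mulrDr.
by rewrite [_ * (_ / _)]mulrC divfK ?expf_neq0 // (Vper _ (up n z hz)).
Qed.

(** The inhomogeneous functional equation of [- Wfun] also has a solution [eps] that is a
    series without constant term in exp (2 pi i z / p). The sum [V] of [Wfun] and [eps] is
    then multiplied by a constant under [z |-> p z] and has period [p], so it has
    arbitrarily small periods. As it is holomorphic it is constant, and as it tends to 0 at
    oo it vanishes: [Wfun] is [- eps], which decays exponentially. *)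
Lemma Wfun_decay : exists M : R, 0 <= M /\ forall z, 1 <= complex.Im z ->
  nrm (Wfun z) <= M * expR (- (2 * pi / p%:R * complex.Im z)).
Proof.
have pz := prime_gt0 pp; have pR : 0 < (p%:R : R) by rewrite ltr0n.
have [d hd] := Wfun_functional.
have [e [he e0 hE]] := Wfun_error_series d.
set al := p%:R * cp / p%:R ^+ k in hd.
have al0 : al != 0 by rewrite mulf_neq0 ?invr_eq0 ?expf_neq0 // mulf_neq0.
clearbody al; have [b [hb b0 bE]] := renorm_series al^-1 (prime_gt1 pp) he e0.
pose eps z := Sser b (z / p%:R).
have epsE z : upper z -> eps (p%:R * z) = al * eps z - Sser e (z / p%:R).
  move=> hz; have hu := upper_div pz hz.
  have E1 : eps (p%:R * z) = Sser b (p%:R * (z / p%:R)) by rewrite /eps; congr Sser; field.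
  rewrite E1; apply: chas_unique (chas_divn pz hb hu) _.
  have := chasD (chasZ al (chas_Sser hb hu)) (chasZ (-1) (chas_Sser he hu)).
  rewrite mulN1r; apply: chas_eq => n; rewrite bE mulN1r; set s := if _ then _ else _.
  by field.
pose V z := Wfun z + eps z.
have Vp z : upper z -> V (p%:R * z) = al * V z.
  by move=> hz; rewrite /V epsE // hd // -hE //; ring.
have Vper z : upper z -> V (z + p%:R) = V z.
  move=> hz; have E : eps (z + p%:R) = eps z.
    by rewrite /eps /Sser mulrDl (mulfV p0) (qparDn _ 1).
  by rewrite /V (Wfun_period hz) E.
have Vsmall n z : upper z -> V (z + p%:R / p%:R ^+ n) = V z.
  exact: (small_periods n al0 Vp Vper).
have Vder z : upper z -> cderiv V z 0.
  move=> hz; have [l1 h1] := cderiv_Wfun hz; have hu := upper_div pz hz.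
  have h2 : cderiv (fun w => w / p%:R) z (p%:R^-1).
    by apply: cderiv_ext (cderiv_eq (cderivZ (p%:R^-1) (cderiv_id z)) _) => [w|]; rewrite ?mulr1 // mulrC.
  have h := cderivD h1 (cderiv_comp h2 (cderiv_Sser hb hu)).
  apply: cderiv_eq h (cderiv_small_periods h _) => r r0.
  have p01 : 0 < (p%:R^-1 : R) < 1 by rewrite invr_gt0 pR invf_lt1 // ltr1n prime_gt1.
  have [N hN] := pow_small (divr_ge0 (ltW pR) (ltW r0)) p01.
  exists (p%:R / p%:R ^+ N); split.
  - by rewrite mulf_neq0 ?invr_eq0 ?expf_neq0.
  - rewrite normcM normcV nrmX nrm_nat -exprVn.
    have := hN N (leqnn N); rewrite mulrAC ler_pdivrMr // => h'.
    by apply: le_lt_trans h' _; lra.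
  - exact: Vsmall.
have V0 z : upper z -> V z = 0.
  apply: const_lim0 => [u w hu hw|eps' eps0]; first exact: (cderiv0_const Vder).
  have e2 : 0 < eps' / 2 by rewrite divr_gt0.
  have [Y1 h1] := Wfun_lim0 e2; have [Y2 Y20 h2] := Sser_lim0 hb b0 e2.
  exists (Num.max Y1 (Y2 * p%:R)) => w hw; rewrite gt_max => /andP[w1 w2].
  apply: le_lt_trans (le_normcD _ _) _; rewrite (splitr eps'); apply: ltrD.
    exact: h1.
  apply: h2; have -> : w / p%:R = ((p%:R^-1 : R)%:C)%C * w by rewrite fmorphV /= rmorph_nat mulrC.
  by rewrite ImM_real mulrC ltr_pdivlMr.
have pV0 : 0 < (p%:R^-1 : R) by rewrite invr_gt0.
have [M [M0 hM]] := Sser_decay hb b0 pV0.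
exists M; split=> // z hz; have hz' : upper z by apply: lt_le_trans hz.
have -> : Wfun z = - eps z by apply/eqP; rewrite -addr_eq0; apply/eqP/V0.
have e1 : complex.Im (z / p%:R) = p%:R^-1 * complex.Im z.
  have -> : z / p%:R = ((p%:R^-1 : R)%:C)%C * z by rewrite fmorphV /= rmorph_nat mulrC.
  by rewrite ImM_real.
rewrite normcN; apply: le_trans (hM _ _) _; rewrite e1.
  by rewrite ler_peMr // ltW.
by rewrite mulrA.
Qed.

End CuspZero.

(** * Integrals of functions of exponential decay *)

Section RealLimits.
Variable R : realType.
Implicit Types (u U : R -> R).

Lemma is_derive_expRc (c t : R) : is_derive t 1 (fun s : R => expR (- (c * s))) (- c * expR (- (c * t))).
Proof.
have h : is_derive t 1 (fun s : R => - (c * s)) (- c).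
  have -> : (fun s : R => - (c * s)) = (fun s : R => (- c) *: s).
    by apply/funext => s; rewrite /GRing.scale /= mulNr.
  by apply: (is_derive_eq (is_deriveZ _ _)); rewrite /GRing.scale /= mulr1.
have := is_derive1_comp (f := expR) (g := fun s : R => - (c * s)) (is_derive_expR _) h.
by move=> H; rewrite [- c * _]mulrC; exact: H.
Qed.

Lemma MVT_le (u du : R -> R) (s t : R) : s <= t ->
  (forall x, s <= x <= t -> is_derive x 1 u (du x)) ->
  (forall x, s <= x <= t -> du x <= 0) -> u t <= u s.
Proof.
move=> st hd hle; rewrite -subr_le0.
have [x xst||x xst ->] := @MVT_segment R u du s t st.
- by apply: hd; move: xst; rewrite in_itv /= => /andP[? ?]; rewrite !ltW.
- apply: derivable_within_continuous => x; rewrite in_itv /= => hx.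
  by have [] := hd _ hx.
by apply: mulr_le0_ge0; [apply: hle; move: xst; rewrite in_itv|rewrite subr_ge0].
Qed.

(** Adding the primitive of the bound to [u] gives a nonincreasing function, subtracting it
    a nondecreasing one. *)
Lemma decay_limit (u du : R -> R) (c M : R) : 0 < c ->
  (forall t : R, 1 <= t -> is_derive t 1 u (du t)) ->
  (forall t : R, 1 <= t -> `|du t| <= M * expR (- (c * t))) ->
  exists L : R, forall t : R, 1 <= t -> `|u t - L| <= M / c * expR (- (c * t)).
Proof.
move=> c0 hd hM; pose E t := M / c * expR (- (c * t)).
have dE (t : R) : is_derive t 1 E (- (M * expR (- (c * t)))).
  apply: (is_derive_eq (is_deriveZ (M / c) (is_derive_expRc c t))).
  by rewrite /GRing.scale /= mulrA mulrN divfK ?gt_eqF // mulNr.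
have M0 : 0 <= M.
  by have := le_trans (normr_ge0 _) (hM 1 (lexx 1)); rewrite pmulr_lge0 // expR_gt0.
have hB (s t : R) : 1 <= s -> s <= t -> u t + E t <= u s + E s.
  move=> s1 st; apply: (MVT_le (u := fun t => u t + E t) (du := fun t => du t + - (M * expR (- (c * t))))) st _ _ => x /andP[sx xt].
    by apply: is_deriveD; apply: hd; exact: le_trans s1 sx.
  by rewrite subr_le0; apply: le_trans (hM x (le_trans s1 sx)); exact: ler_norm.
have hA (s t : R) : 1 <= s -> s <= t -> u s - E s <= u t - E t.
  move=> s1 st; rewrite -lerN2 !opprB.
  apply: (MVT_le (u := fun t => E t - u t) (du := fun t => - (M * expR (- (c * t))) - du t)) st _ _ => x /andP[sx xt].
    by apply: is_deriveB; apply: hd; exact: le_trans s1 sx.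
  rewrite -opprD oppr_le0 -[X in _ + X]opprK subr_ge0.
  by apply: le_trans (hM x (le_trans s1 sx)); rewrite -normrN ler_norm.
have E0 (t : R) : 0 <= E t by rewrite mulr_ge0 ?expR_ge0 // divr_ge0 // ltW.
have hAB (s t : R) : 1 <= s -> 1 <= t -> u s - E s <= u t + E t.
  move=> s1 t1; have [st|ts] := leP s t.
    by apply: le_trans (hA s t s1 st) _; apply: lerD => //; rewrite ge0_cp.
  by apply: le_trans (hB t s t1 (ltW ts)); apply: lerD => //; rewrite ge0_cp.
pose A := [set u s - E s | s in [set s : R | 1 <= s]].
have Aub (t : R) : 1 <= t -> ubound A (u t + E t).
  by move=> t1 _ [s s1 <-]; exact: hAB.
have hs : has_sup A by split; [exists (u 1 - E 1); exists 1 => //=|exists (u 1 + E 1); exact: Aub].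
exists (sup A) => t t1; rewrite ler_norml; apply/andP; split.
  by rewrite lerBrDr addrC lerBlDr; apply: ge_sup; [case: hs|exact: Aub].
by rewrite lerBlDr -lerBlDl; apply: ub_le_sup; [case: hs|exists t].
Qed.

(** The integrand and its primitive are extended to 0 by their limits, which reduces the
    open half line to the fundamental theorem on the closed one. *)
Lemma ge0_FTC_0y (w W : R -> R) (w0 L l : R) : 0 <= w0 ->
  (forall t : R, 0 < t -> 0 <= w t) ->
  (forall t : R, 0 < t -> is_derive t 1 W (w t)) ->
  (forall t : R, 0 < t -> {for t, continuous w}) ->
  w t @[t --> 0^'+] --> w0 -> W t @[t --> 0^'+] --> L -> W t @[t --> +oo] --> l ->
  lebesgue_measure.-integrable `]0%R, +oo[ (EFin \o w) /\
  \int[lebesgue_measure]_(t in `]0%R, +oo[) w t = l - L.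
Proof.
move=> w00 wge dW cw ww WL Wl.
pose w' (t : R) := if 0 < t then w t else w0.
pose W' (t : R) := if 0 < t then W t else L.
have nearw (t : R) : 0 < t -> \near t, w' t = w t.
  move=> t0; near=> s; rewrite /w' ifT //; near: s; exact: lt_nbhsr.
have nearW (t : R) : 0 < t -> \near t, W' t = W t.
  move=> t0; near=> s; rewrite /W' ifT //; near: s; exact: lt_nbhsr.
have dW' (t : R) : 0 < t -> is_derive t 1 W' (w t).
  move=> t0; apply: near_eq_is_derive (dW t t0).
  by near=> s; apply/esym; near: s; exact: nearW.
have mw : measurable_fun (`]0%R, +oo[ : set R) w.
  apply: open_continuous_measurable_fun => // t; rewrite inE /= in_itv /= andbT => t0.
  exact: cw.
have I : (\int[lebesgue_measure]_(x in `[0%R, +oo[) (w' x)%:E = l%:E - (W' 0)%:E)%E.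
  apply: ge0_continuous_FTC2y.
  - move=> x; rewrite le_eqVlt => /orP[/eqP <-|x0]; rewrite /w' ?ltxx //.
    by rewrite x0; exact: wge.
  - apply/continuous_within_itvcyP; split.
      move=> t; rewrite in_itv /= andbT => t0.
      have := cw t t0; rewrite /continuous_at /w' t0; apply: cvg_trans.
      apply: near_eq_cvg; near do rewrite -/(w' _) (near (nearw t t0)) //.
    rewrite /w' ltxx; apply: cvg_trans ww; apply: near_eq_cvg.
    near=> t; rewrite ifT //; near: t; exact: nbhs_right_gt.
  - apply: cvg_trans Wl; apply: near_eq_cvg; near=> t; by rewrite /W' ifT.
  - by move=> x x0; have [] := dW' x x0.
  - rewrite /W' ltxx; apply: cvg_trans WL; apply: near_eq_cvg.
    near=> t; rewrite ifT //; near: t; exact: nbhs_right_gt.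
  - move=> x; rewrite in_itv /= andbT => x0; rewrite derive1E /w' x0.
    by have [_ ->] := dW' x x0.
have ww' (x : R) : x \in `]0%R, +oo[%classic -> w' x = w x.
  by rewrite inE /= in_itv /= andbT /w' => ->.
have mw' : measurable_fun (`]0%R, +oo[ : set R) w'.
  apply: eq_measurable_fun mw => x hx; by rewrite ww'.
have I2 : (\int[lebesgue_measure]_(x in `]0%R, +oo[) (w x)%:E = l%:E - L%:E)%E.
  transitivity (\int[lebesgue_measure]_(x in `]0%R, +oo[) (w' x)%:E)%E.
    by apply: eq_integral => x hx; rewrite ww'.
  rewrite integral_itv_obnd_cbnd //; last exact/measurable_EFinP.
  by rewrite I /W' ltxx.
split.
  apply/integrableP; split; first exact/measurable_EFinP.
  suff -> : (\int[lebesgue_measure]_(x in `]0%R, +oo[) `|(EFin \o w) x| =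
    \int[lebesgue_measure]_(x in `]0%R, +oo[) (w x)%:E)%E by rewrite I2 -EFinB ltry.
  apply: eq_integral => x; rewrite inE /= in_itv /= andbT => x0.
  by rewrite ger0_norm // wge.
by rewrite /Rintegral I2.
Unshelve. all: by end_near. Qed.

(** Adding [C exp (- t)] to the integrand makes it nonnegative. *)
Lemma integral_decay_primitive (u U : R -> R) (L C : R) :
  (forall t : R, 0 < t -> is_derive t 1 U (u t)) ->
  (forall t : R, 0 < t -> {for t, continuous u}) ->
  (forall t : R, 0 < t -> `|u t| <= C * expR (- t)) ->
  u t @[t --> 0^'+] --> 0 -> U t @[t --> 0^'+] --> L -> U t @[t --> +oo] --> 0 ->
  \int[lebesgue_measure]_(t in `]0%R, +oo[) u t = - L.
Proof.
move=> dU cu hu u0 UL U0.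
have C0 : 0 <= C.
  by have := le_trans (normr_ge0 _) (hu 1 ltr01); rewrite pmulr_lge0 // expR_gt0.
pose v (t : R) := C * expR (- t); pose V (t : R) := - (C * expR (- t)).
have dV (t : R) : is_derive t 1 V (v t).
  have h := is_derive_expRc 1 t.
  have -> : V = (- C) *: (fun s => expR (- (1 * s))).
    by apply/funext => s; rewrite /V -mulNr -[s in LHS]mul1r.
  apply: (is_derive_eq (is_deriveZ _ h)).
  by rewrite /GRing.scale /= /v !mul1r mulN1r mulrN mulNr opprK.
have cv (t : R) : {for t, continuous v}.
  apply: cvgM; first exact: cvg_cst.
  apply: (@continuous_comp _ _ _ (fun s : R => - s) expR); last exact: continuous_expR.
  exact: opp_continuous.
have cV (t : R) : {for t, continuous V} by apply: cvgN; exact: cv.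
have v0 : v t @[t --> 0^'+] --> C.
  have -> : C = v 0 by rewrite /v oppr0 expR0 mulr1.
  by apply: cvg_at_right_filter; exact: cv.
have V0 : V t @[t --> 0^'+] --> - C by exact: cvgN.
have Vy : V t @[t --> +oo] --> 0.
  rewrite -[X in _ --> X]oppr0; apply: cvgN; rewrite -[X in _ --> X](mulr0 C).
  by apply: cvgM; [exact: cvg_cst|exact: cvgr_expR].
have v_ge0 (t : R) : 0 < t -> 0 <= v t by move=> _; rewrite /v mulr_ge0 // expR_ge0.
have [iv Iv] := ge0_FTC_0y C0 v_ge0 (fun t _ => dV t) (fun t _ => cv t) v0 V0 Vy.
have uv_ge0 (t : R) : 0 < t -> 0 <= u t + v t.
  by move=> t0; have := hu t t0; rewrite ler_norml => /andP[h _]; rewrite -lerBlDr sub0r.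
have duv (t : R) : 0 < t -> is_derive t 1 (fun t => U t + V t) (u t + v t).
  by move=> t0; exact: is_deriveD (dU t t0) (dV t).
have cuv (t : R) : 0 < t -> {for t, continuous (fun t => u t + v t)}.
  by move=> t0; apply: cvgD; [exact: cu|exact: cv].
have uv0 : u t + v t @[t --> 0^'+] --> C by rewrite -[X in _ --> X]add0r; exact: cvgD.
have UVy : U t + V t @[t --> +oo] --> 0 by rewrite -[X in _ --> X]addr0; exact: cvgD.
have [iw Iw] := ge0_FTC_0y C0 uv_ge0 duv cuv uv0 (cvgD UL V0) UVy.
have := RintegralB _ iw iv; rewrite Iw Iv => /(_ (measurable_itv _)) h.
transitivity (\int[lebesgue_measure]_(x in `]0%R, +oo[) (u x + v x - v x)).
  by apply: eq_Rintegral => x _; rewrite addrK.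
by rewrite h; ring.
Qed.

End RealLimits.

(** * Limits in vertical strips *)

Section PolynomialGrowth.
Variable R : realType.
Local Notation C := R[i].
Local Notation nrm := (@normc R).

Lemma horner_exp_bound (P : {poly C}) (X eps : R) : 0 <= X -> 0 < eps ->
  exists2 M : R, 0 <= M & forall z, `|complex.Re z| <= X -> 0 <= complex.Im z ->
    nrm P.[z] <= M * expR (eps * complex.Im z).
Proof.
move=> X0; elim/poly_ind: P eps => [|P c IH] eps e0.
  by exists 0 => // z _ _; rewrite horner0 nrm0 mul0r.
have e2 : 0 < eps / 2 by rewrite divr_gt0.
have [M M0 hM] := IH _ e2.
exists (M * (X + (eps / 2)^-1) + nrm c).
  by rewrite addr_ge0 ?nrm_ge0 // mulr_ge0 // addr_ge0 // invr_ge0 ltW.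
move=> z zX z0; rewrite hornerMXaddC.
set y := complex.Im z in z0 *.
have E1 : 1 <= expR (eps / 2 * y).
  by apply: le_trans (expR_ge1Dx _); rewrite lerDl mulr_ge0 // ltW.
have Ey : y <= (eps / 2)^-1 * expR (eps / 2 * y).
  rewrite ler_pdivlMl //; apply: le_trans (expR_ge1Dx _); by rewrite lerDr.
have hz : nrm z <= (X + (eps / 2)^-1) * expR (eps / 2 * y).
  apply: le_trans (nrm_le_ReIm _) _; rewrite mulrDl; apply: lerD.
    by apply: le_trans zX _; rewrite ler_peMr.
  by rewrite ger0_norm.
have E2 : expR (eps * y) = expR (eps / 2 * y) * expR (eps / 2 * y).
  by rewrite -expRD -mulrDl -splitr.
apply: le_trans (le_normcD _ _) _; rewrite mulrDl; apply: lerD.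
  rewrite normcM E2 mulrACA; apply: ler_pM; rewrite ?nrm_ge0 //; exact: hM.
rewrite ler_peMr ?nrm_ge0 // E2; apply: (le_trans (E1)).
by rewrite ler_peMr ?expR_ge0.
Qed.

(** [decay_limit] provides the limit along the imaginary axis, and the mean value inequality
    on horizontal segments extends it to the strips. *)
Lemma strip_limit (K dK : C -> C) (kap : R) : 0 < kap ->
  (forall X : R, 0 <= X -> exists M : R, forall z, `|complex.Re z| <= X ->
     1 <= complex.Im z -> cderiv K z (dK z) /\
       nrm (dK z) <= M * expR (- (kap * complex.Im z))) ->
  exists L : C, forall X e : R, 0 < e -> exists Y : R, forall z,
    `|complex.Re z| <= X -> Y < complex.Im z -> nrm (K z - L) < e.
Proof.
move=> k0 hK; have [M0 hM0] := hK 0 (lexx 0).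
have lineE (t : R) : (0 : C) + (t%:C)%C * 'i%C = (0 +i* t)%C.
  by apply: eqC; rewrite /=; ring.
have line t : 1 <= t -> cderiv K (0 + (t%:C)%C * 'i%C) (dK (0 +i* t)%C) /\
    nrm (dK (0 +i* t)%C) <= M0 * expR (- (kap * t)).
  by move=> t1; rewrite lineE; apply: hM0; rewrite /= ?normr0.
have iN l : nrm (l * 'i%C) <= nrm l.
  by rewrite normcM [X in _ * X]/normc expr0n expr1n add0r sqrtr1 mulr1.
have [L1 h1] := @decay_limit R (fun t => complex.Re (K (0 + (t%:C)%C * 'i%C)))
   (fun t => complex.Re (dK (0 +i* t)%C * 'i%C)) kap M0 k0
   (fun t t1 => cderiv_line_Re (line t t1).1)
   (fun t t1 => le_trans (Re_le_nrm _) (le_trans (iN _) (line t t1).2)).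
have [L2 h2] := @decay_limit R (fun t => complex.Im (K (0 + (t%:C)%C * 'i%C)))
   (fun t => complex.Im (dK (0 +i* t)%C * 'i%C)) kap M0 k0
   (fun t t1 => cderiv_line_Im (line t t1).1)
   (fun t t1 => le_trans (Im_le_nrm _) (le_trans (iN _) (line t t1).2)).
exists (L1 +i* L2)%C => X e e0; pose X' := `|X|.
have [M hM] := hK X' (normr_ge0 X).
have Mge : 0 <= M.
  have h := hM (0 +i* 1)%C; rewrite /= normr0 in h; have [_ h'] := h (normr_ge0 X) (lexx 1).
  by have := le_trans (nrm_ge0 _) h'; rewrite pmulr_lge0 // expR_gt0.
pose B := `|2 * M0 / kap| + `|2 * M * X'| + 1.
have B0 : 0 < B by rewrite ltr_wpDl // addr_ge0.
have [Y Y0 hY] := expR_decay_lt k0 (divr_gt0 e0 B0).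
exists (Num.max Y 1) => z zX; rewrite gt_max => /andP[zY z1].
have zX' : `|complex.Re z| <= X' by apply: le_trans zX (ler_norm _).
set y := complex.Im z in zY z1 *; have {}z1 := ltW z1.
have a1 := h1 y z1; have a2 := h2 y z1.
have a3 : nrm (K (0 +i* y)%C - (L1 +i* L2)%C) <= 2 * M0 / kap * expR (- (kap * y)).
  apply: le_trans (nrm_le_ReIm _) _; rewrite ReB ImB -lineE.
  have -> : 2 * M0 / kap * expR (- (kap * y)) =
    M0 / kap * expR (- (kap * y)) + M0 / kap * expR (- (kap * y)) by ring.
  exact: lerD.
have a4 : nrm (K z - K (0 +i* y)%C) <= 2 * (M * expR (- (kap * y))) * nrm (z - (0 +i* y)%C).
  have aux (t : R) : 0 <= t <= 1 ->
     `|complex.Re ((0 +i* y)%C + (t%:C)%C * (z - (0 +i* y)%C))| <= X' /\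
     complex.Im ((0 +i* y)%C + (t%:C)%C * (z - (0 +i* y)%C)) = y.
    move=> /andP[t0 t1]; rewrite ReD ImD ReM_real ImM_real ReB ImB /= add0r !subr0.
    rewrite -/y subrr mulr0 addr0; split => //; rewrite normrM ger0_norm //.
    by apply: le_trans zX'; rewrite ler_piMl.
  apply: (cderiv_mvi (dG := dK)) => t /aux[b1 b2].
    by have [] := hM _ b1 (_ : 1 <= _); rewrite ?b2.
  by have [] := hM _ b1 (_ : 1 <= _); rewrite b2.
have a5 : nrm (z - (0 +i* y)%C) <= X'.
  by apply: le_trans (nrm_le_ReIm _) _; rewrite ReB ImB /= subr0 -/y subrr normr0 addr0.
have E0 := expR_gt0 (- (kap * y)).
have -> : K z - (L1 +i* L2)%C = (K z - K (0 +i* y)%C) + (K (0 +i* y)%C - (L1 +i* L2)%C) by ring.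
apply: le_lt_trans (le_normcD _ _) _.
apply: le_lt_trans (_ : B * expR (- (kap * y)) < e); last first.
  by rewrite mulrC -ltr_pdivlMr //; exact: hY.
have b3 : 2 * M0 / kap * expR (- (kap * y)) <= `|2 * M0 / kap| * expR (- (kap * y)).
  by apply: ler_wpM2r; [exact: ltW|exact: ler_norm].
have b4 : 2 * (M * expR (- (kap * y))) * nrm (z - (0 +i* y)%C) <=
    `|2 * M * X'| * expR (- (kap * y)).
  rewrite mulrA mulrAC; apply: ler_wpM2r; first exact: ltW.
  apply: le_trans (ler_norm _); apply: ler_wpM2l => //.
  by rewrite mulr_ge0.
apply: le_trans (lerD (le_trans a4 b4) (le_trans a3 b3)) _.
rewrite /B -mulrDl; apply: ler_wpM2r; first exact: ltW.
by rewrite [leLHS]addrC lerDl.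
Qed.

End PolynomialGrowth.

(** * Period integrals of a cusp form *)

Section EichlerIntegrals.
Variable R : realType.
Local Notation C := R[i].
Local Notation nrm := (@normc R).
Implicit Types (z w : C) (P Q : {poly C}).
Variables (p k : nat) (F : C -> C) (a : nat -> C) (cp : C).
Hypothesis pp : prime p.
Hypothesis hq : q_expansion F a.
Hypothesis hc : cusp_form p k F.
Hypothesis hU : forall n, a (p * n)%N = cp * a n.
Hypothesis cp0 : cp != 0.

Let a_subexp : subexp a := q_expansion_subexp hq.
Let a_0 : a 0%N = 0 := cusp_form_a0 hc hq.

(** ** Exponential decay at every cusp *)

(** Either [M] is in [Gamma0 p], or its lower left entry is prime to [p] and [M = G S T^n]
    with [G] in [Gamma0 p], so that the cusp is equivalent to 0 and [Wfun_decay] applies. *)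
Lemma decay_at_cusp M : SL2Z M -> exists2 kap : R, 0 < kap & exists2 B : R, 0 <= B &
  forall z, 1 <= complex.Im z ->
    nrm (F (mx_upper M z)) <= B * nrm (autfactor M z) ^+ k * expR (- (kap * complex.Im z)).
Proof.
move=> hM; have pR : 0 < (p%:R : R) by rewrite ltr0n prime_gt0.
have p2 : 0 < 2 * (pi : R) by rewrite mulr_gt0 ?pi_gt0.
have [hp|hp] := boolP (p%:Z %| M 1%R 0%R)%Z.
  have hG : Gamma0 p M by split.
  have [B [B0 hB]] := Sser_decay a_subexp a_0 (@ltr01 R).
  exists (2 * pi) => //; exists B => // z hz.
  have hz' : upper z by apply: lt_le_trans hz.
  rewrite (cusp_form_mod hc hG hz') normcM nrmX (q_expansion_Sser hq hz').
  rewrite mulrC mulrAC; apply: ler_wpM2r; first by rewrite exprn_ge0 ?nrm_ge0.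
  exact: hB.
have [n hn] : exists n : int, (p%:Z %| M 1%R 0%R * n - M 1%R 1%R)%Z.
  have cop : coprimez (M 1 0) p%:Z.
    rewrite coprimez_sym /coprimez /gcdz /=; rewrite eqz_nat -/(coprime p `|M 1 0|).
    by rewrite prime_coprime.
  have [[u v] /= h] := coprimezP _ _ cop.
  exists (u * M 1 1); rewrite mulrA -[X in _ - X]mul1r -mulrBl.
  apply: dvdz_mulr; apply/dvdzP; exists (- v); rewrite -h; ring.
pose S := mx2 0 (-1) 1 0; pose T := mx2 1 n 0 1.
pose G := mx2 (M 0 0 * n - M 0 1) (M 0 0) (M 1 0 * n - M 1 1) (M 1 0).
have MS : M = G *m (S *m T).
  by rewrite !mulmx2 [LHS]mx2_eta; congr mx2; ring.
have dM : M 0 0 * M 1 1 - M 0 1 * M 1 0 = 1 by rewrite -det_mx2E.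
have hG : Gamma0 p G.
  split; last by rewrite mx2E.
  by rewrite det_mx2 -[RHS]dM; ring.
have dS : \det S = 1 by rewrite det_mx2; ring.
have dT : \det T = 1 by rewrite det_mx2; ring.
have dG : \det G = 1 by case: hG.
have [B [B0 hB]] := Wfun_decay pp hq hc hU cp0.
exists (2 * pi / p%:R); first by rewrite divr_gt0.
exists B => // z hz; have hz' : upper z by apply: lt_le_trans hz.
have aT : autfactor T z = 1 by rewrite /autfactor !mx2E mul0r add0r.
have mT : mx_upper T z = z + n%:~R by rewrite /mx_upper -/(autfactor T z) aT !mx2E divr1 mul1r.
have hT : upper (z + n%:~R) by exact: upperDint.
have hST : upper (mx_upper (S *m T) z) by apply: upper_mx_upper; rewrite // det_mulmx dS dT.
have F1 : F (mx_upper M z) = autfactor M z ^+ k * Wfun k F (z + n%:~R).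
  rewrite {1}MS mx_upperM ?dG ?det_mulmx ?dS ?dT // (cusp_form_mod hc hG hST).
  rewrite mx_upperM ?dS ?dT // mT /Wfun -/S.
  rewrite [in RHS]MS autfactorM ?det_mulmx ?dS ?dT // autfactorM ?dT // aT mulr1 mT.
  rewrite mx_upperM ?dS ?dT // mT exprMn -mulrA mulVKf // expf_neq0 // autfactor_neq0 // dS //.
rewrite F1 normcM nrmX mulrC mulrAC; apply: ler_wpM2r; first by rewrite exprn_ge0 ?nrm_ge0.
have E : complex.Im (z + n%:~R) = complex.Im z by rewrite ImD intrC /= addr0.
by have := hB (z + n%:~R); rewrite E; apply.
Qed.

(** ** Primitives *)

(** Integrating [m] times a series in q divides its coefficients by powers of 2 pi i n. At
    [n = 0] the coefficient vanishes along with [a 0]. *)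
Definition prim m (n : nat) : C := a n / (@tpi R * n%:R) ^+ m.
Definition Fprim m z : C := Sser (prim m) z.

Lemma tpi_neq0 : @tpi R != 0.
Proof.
rewrite /tpi; apply/eqP => -[] /eqP; rewrite mulf_eq0 pnatr_eq0 /=.
by rewrite gt_eqF ?pi_gt0.
Qed.

Lemma subexp_prim m : subexp (prim m).
Proof.
apply: (@subexp_le _ a _ 1) => // n; rewrite mul1r /prim.
case: n => [|n]; first by rewrite a_0 mul0r nrm0.
rewrite normcM normcV nrmX ler_pdivrMr; last first.
  by rewrite exprn_gt0 // nrm_gt0 mulf_neq0 ?tpi_neq0 // pnatr_eq0.
rewrite ler_peMr ?nrm_ge0 // exprn_ege1 // normcM nrm_nat.
have h : 1 <= nrm (@tpi R).
  rewrite /normc /= expr0n add0r sqrtr_sqr ger0_norm ?mulr_ge0 ?pi_ge0 //.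
  have := pi_ge2 R; lra.
apply: le_trans h _; rewrite ler_peMr ?nrm_ge0 // ler1n //.
Qed.

Lemma prim0 m : prim m 0%N = 0.
Proof. by rewrite /prim a_0 mul0r. Qed.

Lemma cderiv_Fprim m z : upper z -> cderiv (Fprim m.+1) z (Fprim m z).
Proof.
move=> hz; apply: cderiv_eq (cderiv_Sser (subexp_prim m.+1) hz) _.
congr (Sser _ z); apply/funext => -[|n]; first by rewrite !prim0 mulr0.
rewrite /prim exprS; have h : @tpi R * n.+1%:R != 0 by rewrite mulf_neq0 ?tpi_neq0 // pnatr_eq0.
by rewrite invfM (mulrCA (a _)) mulVKf.
Qed.

(** Repeated integration by parts in the integral of [F P] ends when the derivatives of [P]
    vanish; the primitive obtained is 0 at oo. *)
Definition Fint (P : {poly C}) z : C :=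
  \sum_(m < k) (-1) ^+ m * (Fprim m.+1 z * P^`(m).[z]).

Lemma cderiv_Fint P z : (size P <= k)%N -> upper z -> cderiv (Fint P) z (F z * P.[z]).
Proof.
move=> hP hz.
have h m : (m < k)%N -> cderiv (fun w => (-1) ^+ m * (Fprim m.+1 w * P^`(m).[w])) z
    ((-1) ^+ m * (Fprim m z * P^`(m).[z] + Fprim m.+1 z * P^`(m.+1).[z])).
  move=> _; apply: cderivZ; apply: cderivM; first exact: cderiv_Fprim.
  by rewrite derivnS; exact: cderiv_horner.
apply: cderiv_eq (cderiv_sum h) _.
have tele n : \sum_(i < n) (-1) ^+ i * (Fprim i z * P^`(i).[z] + Fprim i.+1 z * P^`(i.+1).[z]) =
    Fprim 0 z * P.[z] - (-1) ^+ n * (Fprim n z * P^`(n).[z]).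
  elim: n => [|n IH]; first by rewrite big_ord0 derivn0 expr0 mul1r subrr.
  by rewrite big_ord_recr /= IH exprS; ring.
rewrite tele; have -> : P^`(k) = 0.
  by apply: derivn_poly0.
rewrite horner0 !mulr0 subr0; congr (_ * _).
rewrite (q_expansion_Sser hq hz) /Fprim; congr (Sser _ z).
by apply/funext => n; rewrite /prim expr0 divr1.
Qed.

Lemma FintD P Q z : Fint (P + Q) z = Fint P z + Fint Q z.
Proof.
rewrite /Fint -big_split /=; apply: eq_bigr => m _.
by rewrite derivnD hornerD !mulrDr.
Qed.

Lemma FintZ c P z : Fint (c *: P) z = c * Fint P z.
Proof.
rewrite /Fint mulr_sumr; apply: eq_bigr => m _.
by rewrite derivnZ hornerZ; ring.
Qed.

Lemma Fint_strip_bound P (X : R) : 0 <= X -> exists2 B : R, 0 <= B &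
  forall z, `|complex.Re z| <= X -> 1 <= complex.Im z ->
    nrm (Fint P z) <= B * expR (- complex.Im z).
Proof.
move=> X0.
have one (m : 'I_k) : exists B : R, 0 <= B /\ forall z, `|complex.Re z| <= X -> 1 <= complex.Im z ->
    nrm ((-1) ^+ m * (Fprim m.+1 z * P^`(m).[z])) <= B * expR (- complex.Im z).
  have [B1 [B10 h1]] := Sser_decay (subexp_prim m.+1) (prim0 m.+1) (@ltr01 R).
  have [B2 B20 h2] := horner_exp_bound P^`(m) X0 (@ltr01 R).
  exists (B1 * B2); split; first exact: mulr_ge0.
  move=> z zX z1; rewrite normcM nrmX normcN nrm1 expr1n mul1r normcM.
  have z0 : 0 <= complex.Im z by apply: le_trans z1.
  apply: le_trans (ler_pM (nrm_ge0 _) (nrm_ge0 _) (h1 z z1) (h2 z zX z0)) _.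
  rewrite mulrACA -expRD; apply: ler_wpM2l; first exact: mulr_ge0.
  rewrite ler_expR; have := pi_ge2 R; nra.
have /choice[B hB] := one.
exists (\sum_(m < k) B m); first by apply: sumr_ge0 => m _; have [] := hB m.
move=> z zX z1; apply: le_trans (nrm_sum _ _ _) _.
rewrite mulr_suml; apply: ler_sum => m _; have [_] := hB m; exact.
Qed.

(** ** Limits at the cusps *)

(** The condition bears on all matrices [M] of positive determinant which move oo to [c], so
    that it is stable under substitutions ([cusp_lim_comp]). *)
Definition cusp_lim (G : C -> C) (c : cusp) (L : C) := forall M, 0 < \det M ->
  mx_cusp M None = c -> forall X e : R, 0 < e -> exists Y : R, forall z, upper z ->
  `|complex.Re z| <= X -> Y < complex.Im z -> nrm (G (mx_upper M z) - L) < e.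

(** Two matrices moving oo to the same cusp differ by an upper triangular one, which maps
    vertical strips into vertical strips. *)
Lemma cusp_lim_one G M0 L : SL2Z M0 ->
  (forall X e : R, 0 < e -> exists Y : R, forall z, upper z ->
    `|complex.Re z| <= X -> Y < complex.Im z -> nrm (G (mx_upper M0 z) - L) < e) ->
  cusp_lim G (mx_cusp M0 None) L.
Proof.
move=> d0 h M dM hM X e e0; have d0' : \det M0 = 1 := d0.
pose U := adj2 M0 *m M.
have MU : M = M0 *m U by rewrite mulmxA mul_adj2 d0' mul1mx.
have dU : \det U = \det M by rewrite det_mulmx det_adj2 d0' mul1r.
have U10 : U 1 0 = 0.
  have dU0 : \det U != 0 by rewrite dU gt_eqF.
  have : mx_cusp U None = None.
    rewrite /U mx_cuspM ?det_adj2 ?d0' ?gt_eqF // hM -mx_cuspM ?det_adj2 ?d0' //.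
    by rewrite adj2_mul d0' mx_cusp1.
  by rewrite /=; case: eqP.
have dUE : U 0 0 * U 1 1 = \det M by rewrite -dU det_mx2E U10 mulr0 subr0.
have U11 : U 1 1 != 0 by apply: contraTneq dM => h0; rewrite -dUE h0 mulr0 ltxx.
pose r : R := (U 1 1)%:~R; have r0 : r != 0 by rewrite intr_eq0.
have aU z : autfactor U z = (r%:C)%C by rewrite /autfactor U10 mul0r add0r intrC.
have mU z : mx_upper U z = ((r^-1)%:C)%C * ((U 0 0)%:~R * z + (U 0 1)%:~R).
  by rewrite /mx_upper -/(autfactor U z) aU mulrC fmorphV.
have dR : 0 < ((\det M)%:~R : R) by rewrite ltr0z.
have q0 : 0 < r^-1 * (U 0 0)%:~R.
  have -> : r^-1 * (U 0 0)%:~R = (\det M)%:~R / r ^+ 2.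
    by rewrite -dUE rmorphM /= -/r; field.
  by apply: divr_gt0 => //; rewrite exprn_even_gt0.
have [Y hY] := h (`|r^-1| * (`|(U 0 0)%:~R| * `|X| + `|(U 0 1)%:~R|)) e e0.
exists (Y / (r^-1 * (U 0 0)%:~R)) => z hz zX zY.
rewrite MU mx_upperM ?dU ?d0' //; apply: hY.
- by apply: upper_mx_upper; rewrite ?dU.
- rewrite mU ReM_real ReD !intrC ReM_real /= normrM; apply: ler_wpM2l => //.
  apply: le_trans (ler_normD _ _) _; apply: lerD => //; rewrite normrM.
  by apply: ler_wpM2l => //; apply: le_trans zX (ler_norm _).
- rewrite mU ImM_real ImD !intrC ImM_real /= addr0 mulrA.
  by rewrite mulrC -ltr_pdivrMr.
Qed.

Lemma cusp_lim_unique G c L L' : cusp_lim G c L -> cusp_lim G c L' -> L = L'.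
Proof.
move=> h h'; have [M hM hc'] := cusp_matrix c.
have dM : 0 < \det M by rewrite hM.
apply: eq_le_eps => e e0; have e2 : 0 < e / 2 by rewrite divr_gt0.
have [Y1 k1] := h M dM hc' 0 _ e2; have [Y2 k2] := h' M dM hc' 0 _ e2.
pose w : C := (0 +i* (`|Y1| + `|Y2| + 1))%C.
have hw : upper w by rewrite /upper /= ltr_wpDl // addr_ge0.
have w0 : `|complex.Re w| <= 0 by rewrite /= normr0.
have w1 : Y1 < complex.Im w by rewrite /= -addrA ltr_pwDr ?ler_norm // ltr_wpDl.
have w2 : Y2 < complex.Im w by rewrite /= ltr_pwDr // ler_wpDl // ler_norm.
have l1 := k1 w hw w0 w1; have l2 := k2 w hw w0 w2; rewrite nrmB in l1.
have -> : L - L' = (L - G (mx_upper M w)) + (G (mx_upper M w) - L') by ring.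
by apply: le_lt_trans (le_normcD _ _) _; rewrite (splitr e); exact: ltrD.
Qed.

Lemma cusp_limD G H c L L' : cusp_lim G c L -> cusp_lim H c L' ->
  cusp_lim (fun z => G z + H z) c (L + L').
Proof.
move=> h h' M dM hM X e e0; have e2 : 0 < e / 2 by rewrite divr_gt0.
have [Y1 k1] := h M dM hM X _ e2; have [Y2 k2] := h' M dM hM X _ e2.
exists (Num.max Y1 Y2) => z hz zX; rewrite gt_max => /andP[z1 z2].
rewrite opprD addrACA; apply: le_lt_trans (le_normcD _ _) _.
by rewrite (splitr e); apply: ltrD; [exact: k1|exact: k2].
Qed.

Lemma cusp_limZ b G c L : cusp_lim G c L -> cusp_lim (fun z => b * G z) c (b * L).
Proof.
move=> h M dM hM X e e0; have b0 : 0 < nrm b + 1 by rewrite ltr_wpDl // nrm_ge0.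
have [Y k1] := h M dM hM X _ (divr_gt0 e0 b0); exists Y => z hz zX zY.
rewrite -mulrBr normcM; apply: le_lt_trans (_ : _ <= (nrm b + 1) * nrm (G (mx_upper M z) - L)) _.
  by apply: ler_wpM2r; rewrite ?nrm_ge0 // lerDl.
by rewrite mulrC -ltr_pdivlMr //; exact: k1.
Qed.

Lemma cusp_lim_cst b c : cusp_lim (fun=> b) c b.
Proof. by move=> M _ _ X e e0; exists 0 => z _ _ _; rewrite subrr nrm0. Qed.

Lemma cusp_lim_sum n (G : nat -> C -> C) c (L : nat -> C) :
  (forall i, (i < n)%N -> cusp_lim (G i) c (L i)) ->
  cusp_lim (fun z => \sum_(i < n) G i z) c (\sum_(i < n) L i).
Proof.
elim: n => [|n IH] h.
  rewrite big_ord0; have -> : (fun z => \sum_(i < 0) G i z) = (fun=> 0).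
    by apply/funext => z; rewrite big_ord0.
  exact: cusp_lim_cst.
rewrite big_ord_recr /=; have -> : (fun z => \sum_(i < n.+1) G i z) =
    fun z => \sum_(i < n) G i z + G n z.
  by apply/funext => z; rewrite big_ord_recr.
apply: cusp_limD; first by apply: IH => i hi; apply: h; exact: ltnW.
exact: h.
Qed.

Lemma cusp_lim_ext G H c L : (forall z, upper z -> G z = H z) ->
  cusp_lim G c L -> cusp_lim H c L.
Proof.
move=> gh h M dM hM X e e0; have [Y hY] := h M dM hM X e e0.
by exists Y => z hz zX zY; rewrite -gh ?hY //; exact: upper_mx_upper.
Qed.

Lemma cusp_lim_comp G N c L : 0 < \det N ->
  cusp_lim G (mx_cusp N c) L -> cusp_lim (fun z => G (mx_upper N z)) c L.
Proof.
move=> dN h M dM hM X e e0.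
have dNM : 0 < \det (N *m M) by rewrite det_mulmx mulr_gt0.
have [|Y hY] := h (N *m M) dNM _ X e e0.
  by rewrite mx_cuspM ?gt_eqF // hM.
exists Y => z hz zX zY; rewrite -mx_upperM ?gt_eqF //; exact: hY.
Qed.

(** ** Existence of the limits, and the period integrals *)

Hypothesis k2 : (2 <= k)%N.

(** The polynomial [(c z + d)^(k-2) P (M z)]. *)
Definition homog_subst (M : 'M[int]_2) (P : {poly C}) : {poly C} := \sum_(i < k.-1)
  P`_i *: (((M 0 0)%:~R *: 'X + (M 0 1)%:~R%:P) ^+ i *
           ((M 1 0)%:~R *: 'X + (M 1 1)%:~R%:P) ^+ (k - 2 - i)).

Lemma homog_substE M P z : (size P <= k.-1)%N -> \det M != 0 -> upper z ->
  (homog_subst M P).[z] = autfactor M z ^+ (k - 2) * P.[mx_upper M z].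
Proof.
move=> hP dM hz; have h0 := autfactor_neq0 dM hz.
rewrite /homog_subst horner_sum (horner_coef_wide _ hP) mulr_sumr.
apply: eq_bigr => i _; rewrite hornerZ hornerM !horner_exp !hornerD !hornerZ !hornerX !hornerC.
rewrite -/(autfactor M z) [RHS]mulrCA; congr (_ * _).
have hi : (i <= k - 2)%N by have := ltn_ord i; lia.
rewrite /mx_upper -/(autfactor M z) expr_div_n -[in RHS](subnK hi) exprD.
by field; rewrite expf_neq0.
Qed.

(** The weights match: two factors of automorphy come from the differential, [k - 2] from
    the homogenised polynomial, and [k] from [F]. *)
Lemma Fint_strip_decay M P : SL2Z M -> (size P <= k.-1)%N ->
  exists2 kap : R, 0 < kap & forall X : R, 0 <= X -> exists B : R, forall z,
    `|complex.Re z| <= X -> 1 <= complex.Im z ->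
    nrm (F (mx_upper M z) * P.[mx_upper M z] / autfactor M z ^+ 2) <=
      B * expR (- (kap * complex.Im z)).
Proof.
move=> hM hP; have [kap kap0 [B B0 hB]] := decay_at_cusp hM.
have kap2 : 0 < kap / 2 by rewrite divr_gt0.
exists (kap / 2) => // X X0.
have [B' B'0 hB'] := horner_exp_bound (homog_subst M P) X0 kap2.
exists (B * B') => z zX z1; have hz : upper z by apply: lt_le_trans z1.
have dM : \det M != 0 by rewrite (hM : \det M = 1).
have h0 := autfactor_neq0 dM hz; have h0' : 0 < nrm (autfactor M z) by rewrite nrm_gt0.
have := hB' z zX (ltW hz); rewrite homog_substE // normcM nrmX => hQ.
rewrite !normcM normcV nrmX.
have -> : expR (- (kap / 2 * complex.Im z)) =
    expR (- (kap * complex.Im z)) * expR (kap / 2 * complex.Im z).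
  by rewrite -expRD; congr expR; field.
apply: le_trans (_ : _ <= (B * expR (- (kap * complex.Im z))) *
   (nrm (autfactor M z) ^+ (k - 2) * nrm P.[mx_upper M z])) _; last first.
  rewrite [leRHS]mulrACA; apply: ler_wpM2l hQ.
  by rewrite mulr_ge0 ?expR_ge0.
apply: le_trans (ler_wpM2r _ (ler_wpM2r _ (hB z z1))) _; rewrite ?invr_ge0 ?exprn_ge0 ?nrm_ge0 //.
have E : nrm (autfactor M z) ^+ k = nrm (autfactor M z) ^+ (k - 2) * nrm (autfactor M z) ^+ 2.
  by rewrite -exprD subnK.
rewrite E le_eqVlt; apply/orP; left; apply/eqP; field.
by rewrite gt_eqF.
Qed.

(** The function of [Fint_strip_decay] is the derivative of the primitive after the
    substitution [M]. *)
Lemma Fint_cusp_lim P c : (size P <= k.-1)%N -> exists L, cusp_lim (Fint P) c L.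
Proof.
move=> hP; have [M hM <-] := cusp_matrix c.
have [kap kap0 hdec] := Fint_strip_decay hM hP.
have dM : \det M = 1 := hM.
have hPk : (size P <= k)%N by apply: leq_trans hP (leq_pred k).
have [X X0|L hL] := @strip_limit R (fun z => Fint P (mx_upper M z))
  (fun z => F (mx_upper M z) * P.[mx_upper M z] / autfactor M z ^+ 2) kap kap0.
  have [B hB] := hdec X X0; exists B => z zX z1; split; last exact: hB.
  have hz : upper z by apply: lt_le_trans z1.
  have hMz : upper (mx_upper M z) by apply: upper_mx_upper; rewrite // dM.
  apply: cderiv_eq (cderiv_comp (cderiv_mx_upper _ hz) (cderiv_Fint hPk hMz)) _.
    by rewrite dM.
  by rewrite dM mul1r.
exists L; apply: cusp_lim_one => // X e e0.
by have [Y hY] := hL X e e0; exists Y => z _; exact: hY.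
Qed.

Lemma Fint_lim_infty P : cusp_lim (Fint P) None 0.
Proof.
rewrite -{1}(mx_cusp1 None); apply: cusp_lim_one; first exact: det1.
move=> X e e0; have [B B0 hB] := Fint_strip_bound P (normr_ge0 X).
have B1 : 0 < B + 1 by rewrite ltr_wpDl.
have [Y Y0 hY] := expR_decay_lt (@ltr01 R) (divr_gt0 e0 B1).
exists (Num.max Y 1) => z hz zX; rewrite gt_max => /andP[z1 z2].
have au : autfactor 1%:M z = 1 by rewrite /autfactor !mxE /= mul0r add0r.
have mu : mx_upper 1%:M z = z.
  by rewrite /mx_upper -/(autfactor 1%:M z) au divr1 !mxE /= mul1r addr0.
rewrite mu subr0; apply: le_lt_trans (hB z (le_trans zX (ler_norm X)) (ltW z2)) _.
apply: le_lt_trans (_ : _ <= (B + 1) * expR (- complex.Im z)) _.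
  by apply: ler_wpM2r; rewrite ?expR_ge0 // lerDl.
by rewrite mulrC -ltr_pdivlMr //; have := hY _ z1; rewrite mul1r.
Qed.

Lemma ccont_line (pr : C -> R) G z v (t : R) : (forall x y, pr (x - y) = pr x - pr y) ->
  (forall x, `|pr x| <= nrm x) -> ccont G (z + (t%:C)%C * v) ->
  {for t, continuous (fun s : R => pr (G (z + (s%:C)%C * v)))}.
Proof.
move=> prB prle hG; apply/cvgrPdist_lt => e e0; have [d d0 hd] := hG e e0.
have v0 : 0 < nrm v + 1 by rewrite ltr_wpDl // nrm_ge0.
near=> s; rewrite distrC -prB; apply: le_lt_trans (prle _) _; apply: hd.
have -> : z + (s%:C)%C * v - (z + (t%:C)%C * v) = ((s - t)%:C)%C * v.
  by rewrite rmorphB /=; ring.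
rewrite normcM nrm_real.
apply: le_lt_trans (_ : _ <= `|s - t| * (nrm v + 1)) _.
  by apply: ler_wpM2l => //; rewrite lerDl.
rewrite -ltr_pdivlMr // distrC; near: s.
apply: (@cvgr_dist_lt _ R^o); last exact: divr_gt0.
exact: cvg_id.
Unshelve. all: by end_near. Qed.

Section VerticalLine.
Variables (P : {poly C}) (s : rat).
Hypothesis hP : (size P <= k.-1)%N.
Let z (t : R) : C := (ratr s +i* t)%C.
Let G (t : R) : C := F (z t) * P.[z t] * 'i%C.

Let zE (t : R) : z t = ((ratr s)%:C)%C + (t%:C)%C * 'i%C.
Proof. by apply: eqC; rewrite /=; ring. Qed.

Let hPk : (size P <= k)%N.
Proof. by apply: leq_trans hP (leq_pred k). Qed.

Let nrm_i w : nrm (w * 'i%C) = nrm w.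
Proof. by rewrite normcM [X in _ * X]/normc expr0n expr1n add0r sqrtr1 mulr1. Qed.

(** Near the cusp [s], the vertical line is the image under [M] of the upper end of another
    vertical line, run through in the opposite direction. *)
Lemma vertical_line_cusp : exists M (x c : R), [/\ SL2Z M, mx_cusp M None = Some s, 0 < c &
  forall t : R, 0 < t -> let w := (x +i* (c * t)^-1)%C in
    [/\ upper w, mx_upper M w = z t & nrm (autfactor M w) ^+ 2 = (c * t ^+ 2)^-1]].
Proof.
have [M hM hMs] := cusp_matrix (Some s); have dM : \det M = 1 := hM.
exists M; pose A : R := (M 0 0)%:~R; pose D : R := (M 1 1)%:~R.
pose c : R := (M 1 0)%:~R; pose B : R := (M 0 1)%:~R.
have c0 : c != 0.
  rewrite intr_eq0; apply: contra_eqN hMs => /eqP h; by rewrite /= h.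
have sE : (ratr s : R) = A / c.
  have hz : M 1 0 != 0 by move: c0; rewrite intr_eq0.
  move: hMs; rewrite /= (negbTE hz) => -[<-].
  by rewrite fmorph_div /= !ratr_int.
have dE : A * D - B * c = 1.
  by rewrite /A /B /c /D -!rmorphM -rmorphB -det_mx2E dM.
exists (- D / c), (c ^+ 2); split => //; first by rewrite exprn_even_gt0.
move=> t t0; set w : C := (_ +i* _)%C.
have c2 : 0 < c ^+ 2 by rewrite exprn_even_gt0.
have hw : upper w by rewrite /upper /= invr_gt0 mulr_gt0.
have t0' : t != 0 by rewrite gt_eqF.
have aE : autfactor M w = (0 +i* (c * t)^-1)%C.
  apply: eqC; rewrite ?Re_autfactor ?Im_autfactor /= -/c -/D.
    by field.
  by field; rewrite t0'.
split=> //.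
  have h0 : autfactor M w != 0 by rewrite autfactor_neq0 ?dM.
  apply: (mulIf h0); rewrite divfK // aE !intrC.
  apply: eqC; rewrite ?ReD ?ImD ?ReM_real ?ImM_real /= sE -/A -/B.
    have -> : B = (A * D - 1) / c by rewrite -dE; field.
    by field; rewrite t0'.
  by field; rewrite t0'.
rewrite aE /normc expr0n add0r sqrtr_sqr real_normK ?num_real //.
by field; rewrite t0'.
Qed.

(** Exponential decay in 1 / t beats the factor of automorphy; the first power of [t] is
    enough for what follows. *)
Lemma vertical_small : exists B t0 : R, [/\ 0 <= B, 0 < t0 &
  forall t, 0 < t <= t0 -> nrm (G t) <= B * t].
Proof.
have [M [x [c [hM hMs c0 hw]]]] := vertical_line_cusp.
have [kap kap0 /(_ _ (normr_ge0 x))[B hB]] := Fint_strip_decay hM hP.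
have k2' : 0 < kap ^+ 3 by rewrite exprn_gt0.
exists (`|B| * c ^+ 2 * (6 / kap ^+ 3)), (c^-1); split.
- by rewrite !mulr_ge0 ?sqr_ge0 ?invr_ge0 // ltW.
- by rewrite invr_gt0.
move=> t /andP[t0 tc]; have [h1 h2 h3] := hw t t0; set w := (_ +i* _)%C in h1 h2 h3.
have y1 : 1 <= complex.Im w.
  by rewrite /= invf_ge1 ?mulr_gt0 // -ler_pdivlMl // mulr1.
have := hB w (lexx _) y1; rewrite h2.
have a0 : autfactor M w != 0 by rewrite autfactor_neq0 // (hM : \det M = 1).
have a0' : 0 < nrm (autfactor M w) ^+ 2 by rewrite exprn_gt0 // nrm_gt0.
rewrite normcM normcV nrmX ler_pdivrMr // h3 => h.
rewrite /G nrm_i; apply: le_trans h _.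
set y := complex.Im w in y1 *; have y0 : 0 < y by apply: lt_le_trans y1.
have ty : t = (c * y)^-1 by rewrite /y /=; field; rewrite !gt_eqF.
(* Two powers of [y] pay for the factor of automorphy, the third gives the factor [t]. *)
have e3 : expR (- (kap * y)) <= 6 / (kap * y) ^+ 3.
  have ky : 0 <= kap * y by rewrite mulr_ge0 // ltW.
  have := expR_ge1Dxn 2 ky; rewrite expRN => h'.
  have ky3 : 0 < (kap * y) ^+ 3 by rewrite exprn_gt0 // mulr_gt0.
  rewrite invf_ple ?posrE ?expR_gt0 ?divr_gt0 // invf_div.
  apply: le_trans h'; rewrite [3`!%:R](_ : _ = 6) //; lra.
apply: le_trans (_ : `|B| * (6 / (kap * y) ^+ 3) * (c * t ^+ 2)^-1 <= _).
  apply: ler_wpM2r; first by rewrite invr_ge0 mulr_ge0 ?sqr_ge0 // ltW.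
  apply: le_trans (ler_wpM2r (expR_ge0 _) (ler_norm B)) _.
  exact: ler_wpM2l.
rewrite ty le_eqVlt; apply/orP; left; apply/eqP; field.
by rewrite !gt_eqF.
Qed.

Lemma vertical_bound : exists B : R, forall t, 0 < t -> nrm (G t) <= B * expR (- t).
Proof.
have [B [t0 [B0 t00 hB]]] := vertical_small.
have [B1 [B10 h1]] := Sser_decay a_subexp a_0 t00.
have [B2 B20 h2] := horner_exp_bound P (normr_ge0 (ratr s)) (@ltr01 R).
exists (B * t0 * expR t0 + B1 * B2) => t tp; rewrite mulrDl.
have BE : 0 <= B * t0 * expR t0 * expR (- t) by rewrite !mulr_ge0 ?expR_ge0 // ltW.
have B12E : 0 <= B1 * B2 * expR (- t) by rewrite !mulr_ge0 ?expR_ge0.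
have [tt0|tt0] := leP t t0.
  have h : nrm (G t) <= B * t by apply: hB; rewrite tp.
  apply: le_trans h _; rewrite -[leLHS]addr0; apply: lerD => //.
  rewrite -!mulrA; apply: ler_wpM2l => //; rewrite -expRD.
  apply: (le_trans (tt0)); rewrite ler_peMr ?(ltW t00) //.
  by rewrite -[leLHS]expR0 ler_expR subr_ge0.
rewrite -[leLHS]add0r; apply: lerD => //.
have hz : upper (z t) by [].
rewrite /G nrm_i normcM (q_expansion_Sser hq hz).
have := ler_pM (nrm_ge0 _) (nrm_ge0 _) (h1 (z t) (ltW tt0)) (h2 (z t) (lexx _) (ltW tp)).
move/le_trans; apply; rewrite mulrACA; apply: ler_wpM2l; first exact: mulr_ge0.
rewrite -expRD ler_expR /=; have := pi_ge2 R; nra.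
Qed.

(** The integral is the difference of the limits of the primitive at the two ends, and the
    limit at oo is 0. *)
Lemma vert_integral_lim L : cusp_lim (Fint P) (Some s) L -> vert_integral F P s = - L.
Proof.
move=> hL.
have hder (t : R) : 0 < t -> cderiv (Fint P) (((ratr s)%:C)%C + (t%:C)%C * 'i%C) (F (z t) * P.[z t]).
  by move=> t0; rewrite -zE; apply: cderiv_Fint.
have hcont (t : R) : 0 < t -> ccont (fun w => F w * P.[w] * 'i%C) (((ratr s)%:C)%C + (t%:C)%C * 'i%C).
  move=> t0; have [l hl] := cderiv_F hq (t0 : upper (z t)); rewrite -zE.
  apply: ccontM (@ccont_cst _ _ _); apply: ccontM (cderiv_cont hl) _.
  exact: cderiv_cont (cderiv_horner _ _).
have [B hB] := vertical_bound; have [B1 [t1 [B10 t10 hB1]]] := vertical_small.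
have [M [x [c [hM hMs c0 hw]]]] := vertical_line_cusp.
have [B2 B20 hB2] := Fint_strip_bound P (normr_ge0 (ratr s)).
have aux (pr : C -> R) (prB : forall x y, pr (x - y) = pr x - pr y)
    (prle : forall x, `|pr x| <= nrm x) (pr0 : pr 0 = 0)
    (prder : forall (t : R) l, cderiv (Fint P) (((ratr s)%:C)%C + (t%:C)%C * 'i%C) l ->
       is_derive t (1 : R) (fun s' : R => pr (Fint P (((ratr s)%:C)%C + (s'%:C)%C * 'i%C))) (pr (l * 'i%C))) :
    \int[lebesgue_measure]_(t in `]0%R, +oo[) pr (G t) = - pr L.
  apply: (@integral_decay_primitive R (fun t => pr (G t)) (fun t => pr (Fint P (z t))) (pr L) B).
  - move=> t t0; have := prder t _ (hder t t0).
    by congr (is_derive t 1 _ _); apply/funext => s'; rewrite -zE.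
  - move=> t t0; have := ccont_line prB prle (hcont t t0).
    rewrite (_ : (fun s' => _) = (fun t => pr (G t))) //.
    by apply/funext => s'; rewrite /G zE.
  - by move=> t t0; apply: le_trans (prle _) (hB t t0).
  - apply/cvgrPdist_lt => e e0; near=> t.
    have t0 : 0 < t by near: t; exact: nbhs_right_gt.
    have tt1 : t <= t1 by apply/ltW; near: t; exact: nbhs_right_lt.
    rewrite sub0r normrN; apply: le_lt_trans (prle _) _.
    apply: le_lt_trans (hB1 t _) _; first by rewrite t0.
    apply: le_lt_trans (_ : _ <= (B1 + 1) * t) _; first by rewrite ler_wpM2r ?(ltW t0) // lerDl.
    rewrite mulrC -ltr_pdivlMr; last by rewrite ltr_wpDl.
    near: t; apply: nbhs_right_lt; apply: divr_gt0 => //; by rewrite ltr_wpDl.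
  - apply/cvgrPdist_lt => e e0.
    have dM : 0 < \det M by rewrite (hM : \det M = 1).
    have [Y hY] := hL M dM hMs `|x| e e0.
    near=> t; have t0 : 0 < t by near: t; exact: nbhs_right_gt.
    have [h1 h2 _] := hw t t0; rewrite distrC -prB -h2; apply: le_lt_trans (prle _) _.
    apply: hY => //=; apply: le_lt_trans (ler_norm Y) _.
    have Y1 : 0 < `|Y| + 1 by rewrite ltr_wpDl.
    apply: lt_trans (_ : `|Y| + 1 < _); first by rewrite ltrDl.
    rewrite -[ltLHS]invrK ltf_pV2 ?posrE ?mulr_gt0 ?invr_gt0 // mulrC -ltr_pdivlMr //.
    near: t; apply: nbhs_right_lt; apply: divr_gt0 => //; by rewrite invr_gt0.
  - apply/cvgrPdist_lt => e e0; have B2' : 0 < B2 + 1 by rewrite ltr_wpDl.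
    have [Y Y0 hY] := expR_decay_lt (@ltr01 R) (divr_gt0 e0 B2').
    near=> t; rewrite sub0r normrN; apply: le_lt_trans (prle _) _.
    have tY : Y < t by near: t; apply: nbhs_pinfty_gt; exact: num_real.
    have t2 : 1 <= t by near: t; apply: nbhs_pinfty_ge; exact: num_real.
    apply: le_lt_trans (hB2 (z t) (lexx _) t2) _ => /=.
    apply: le_lt_trans (_ : _ <= (B2 + 1) * expR (- t)) _.
      by apply: ler_wpM2r; rewrite ?expR_ge0 // lerDl.
    by rewrite mulrC -ltr_pdivlMr //; have := hY _ tY; rewrite mul1r.
rewrite /vert_integral /Cintegral.
apply: eqC; rewrite ?ReN ?ImN /=.
  by apply: (aux _ (@ReB R) (@Re_le_nrm R)) => // t l; exact: cderiv_line_Re.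
by apply: (aux _ (@ImB R) (@Im_le_nrm R)) => // t l; exact: cderiv_line_Im.
Unshelve. all: by end_near. Qed.

End VerticalLine.

(** ** Relations between the period integrals *)

(** The integral of 2 pi i F P from oo to [c]; [xi] is its additive extension to divisors.
    *)
Definition Xi (P : {poly C}) (c : cusp) : C :=
  if c is Some r then - ((0 +i* (2 * pi))%C * vert_integral F P r) else 0.

Lemma XiE P c L : (size P <= k.-1)%N -> cusp_lim (Fint P) c L -> Xi P c = @tpi R * L.
Proof.
case: c => [r|] hP hL; first by rewrite /Xi (vert_integral_lim hP hL) mulrN opprK.
by rewrite (cusp_lim_unique hL (Fint_lim_infty P)) mulr0.
Qed.

Lemma Xi_lin b P Q c : (size P <= k.-1)%N -> (size Q <= k.-1)%N ->
  Xi (b *: P + Q) c = b * Xi P c + Xi Q c.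
Proof.
move=> hP hQ; have [L1 h1] := Fint_cusp_lim c hP; have [L2 h2] := Fint_cusp_lim c hQ.
have hbP : (size (b *: P + Q)%R <= k.-1)%N.
  apply: leq_trans (size_polyD _ _) _; rewrite geq_max hQ andbT.
  exact: leq_trans (size_scale_leq _ _) hP.
rewrite (XiE hP h1) (XiE hQ h2) (XiE (L := b * L1 + L2) hbP) ?mulrDr ?(mulrCA b) //.
apply: (cusp_lim_ext (G := fun z => b * Fint P z + Fint Q z)) => [z _|].
  by rewrite FintD FintZ.
by apply: cusp_limD h2; exact: cusp_limZ.
Qed.

(** An identity between differential forms gives one between their primitives, up to a
    constant, and then one between the limits of the primitives at the cusps. The constant
    disappears on divisors of degree 0. *)
Lemma Xi_relation (n : nat) (N : nat -> 'M[int]_2) (Q : nat -> {poly C}) (co : nat -> C)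
    (P : {poly C}) (cc : C) :
  (forall i, (i < n)%N -> 0 < \det (N i)) ->
  (forall i, (i < n)%N -> (size (Q i) <= k.-1)%N) -> (size P <= k.-1)%N ->
  (forall z, upper z -> \sum_(i < n) co i * (F (mx_upper (N i) z) *
     (Q i).[mx_upper (N i) z] * ((\det (N i))%:~R / autfactor (N i) z ^+ 2)) =
     cc * (F z * P.[z])) ->
  exists C0, forall c, \sum_(i < n) co i * Xi (Q i) (mx_cusp (N i) c) = cc * Xi P c + C0.
Proof.
move=> dN sQ sP hF; have le_k m : (m <= k.-1)%N -> (m <= k)%N.
  by move=> h; apply: leq_trans h (leq_pred k).
pose G z : C := \sum_(i < n) co i * Fint (Q i) (mx_upper (N i) z) - cc * Fint P z.
have dG z : upper z -> cderiv G z 0.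
  move=> hz; have h i : (i < n)%N -> cderiv (fun w => co i * Fint (Q i) (mx_upper (N i) w)) z
      (co i * (F (mx_upper (N i) z) * (Q i).[mx_upper (N i) z] *
        ((\det (N i))%:~R / autfactor (N i) z ^+ 2))).
    move=> hi; apply: cderivZ; apply: cderiv_comp.
      by apply: cderiv_mx_upper => //; rewrite gt_eqF // dN.
    apply: cderiv_Fint; first by apply: le_k; exact: sQ.
    by apply: upper_mx_upper => //; exact: dN.
  have := cderivB (cderiv_sum h) (cderivZ cc (cderiv_Fint (le_k _ sP) hz)).
  by rewrite hF // subrr.
pose z0 : C := (0 +i* 1)%C; have hz0 : upper z0 by rewrite /upper /= ltr01.
exists (@tpi R * G z0) => c.
have hL i : exists L, (i < n)%N -> cusp_lim (Fint (Q i)) (mx_cusp (N i) c) L.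
  have [hi|_] := boolP (i < n)%N; last by exists 0.
  by have [L hL] := Fint_cusp_lim (mx_cusp (N i) c) (sQ i hi); exists L.
have /choice[L hL'] := hL; have [LP hLP] := Fint_cusp_lim c sP.
rewrite (XiE sP hLP).
rewrite (eq_bigr (fun i : 'I_n => @tpi R * (co i * L i))); last first.
  by move=> i _; rewrite (XiE (sQ i (ltn_ord i)) (hL' i (ltn_ord i))) mulrCA.
rewrite -mulr_sumr mulrCA -mulrDr; congr (_ * _).
have h1 : cusp_lim G c (\sum_(i < n) co i * L i + - cc * LP).
  apply: (cusp_lim_ext (G := fun z => \sum_(i < n) co i * Fint (Q i) (mx_upper (N i) z)
     + - cc * Fint P z)) => [z _|]; first by rewrite /G mulNr.
  apply: cusp_limD; last exact: cusp_limZ.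
  apply: (@cusp_lim_sum n (fun i z => co i * Fint (Q i) (mx_upper (N i) z)) c
    (fun i => co i * L i)) => i hi.
  by apply: cusp_limZ; apply: cusp_lim_comp (dN i hi) _; exact: hL'.
have h2 : cusp_lim G c (G z0).
  have hG z : upper z -> G z0 = G z by move=> hz; exact: (cderiv0_const dG).
  by apply: (@cusp_lim_ext (fun=> G z0)) => //; exact: cusp_lim_cst.
by rewrite -(cusp_lim_unique h1 h2) addrC mulNr subrK.
Qed.

Lemma mx_upper_translate (l : nat) (b : int) z : (0 < l)%N -> upper z ->
  mx_upper (mx2 1 b 0 l%:Z) z = (z + b%:~R) / l%:R /\
  (\det (mx2 1 b 0 l%:Z))%:~R / autfactor (mx2 1 b 0 l%:Z) z ^+ 2 = l%:R^-1 :> C.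
Proof.
move=> l0 hz; have l0' : (l%:R : C) != 0 by rewrite pnatr_eq0 -lt0n.
have aE : autfactor (mx2 1 b 0 l%:Z) z = l%:R by rewrite /autfactor !mx2E mul0r add0r -pmulrn.
rewrite {1}/mx_upper -/(autfactor (mx2 1 b 0 l%:Z) z) aE !mx2E mul1r.
by split=> //; rewrite det_mx2 mul1r mulr0 subr0 -pmulrn; field.
Qed.

Lemma mx_upper_dilate (l : nat) z : (0 < l)%N -> upper z ->
  mx_upper (mx2 l%:Z 0 0 1) z = l%:R * z /\
  (\det (mx2 l%:Z 0 0 1))%:~R / autfactor (mx2 l%:Z 0 0 1) z ^+ 2 = l%:R :> C.
Proof.
move=> l0 hz; have aE : autfactor (mx2 l%:Z 0 0 1) z = 1 by rewrite /autfactor !mx2E mul0r add0r.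
rewrite {1}/mx_upper -/(autfactor (mx2 l%:Z 0 0 1) z) aE !mx2E addr0 -pmulrn divr1.
by split=> //; rewrite det_mx2 mulr1 mul0r subr0 -pmulrn expr1n divr1.
Qed.

(** [F] has period 1. *)
Lemma sum_translates (l : nat) (e : int) z : prime l -> upper z -> ~~ (l%:Z %| e)%Z ->
  \sum_(j < l) F ((z + (e * j%:Z)%:~R) / l%:R) = \sum_(j < l) F ((z + j%:R) / l%:R).
Proof.
move=> pl hz he; have l0 := prime_gt0 pl.
have l0' : (l%:R : C) != 0 by rewrite pnatr_eq0 -lt0n.
have per (b : int) : F ((z + (b + l%:Z)%:~R) / l%:R) = F ((z + b%:~R) / l%:R).
  have hT : Gamma0 p (mx2 1 1 0 1) by split; rewrite ?det_mx2 ?mx2E ?dvdz0.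
  have hw : upper ((z + b%:~R) / l%:R) by apply: upper_div => //; exact: upperDint.
  have := cusp_form_mod hc hT hw; rewrite /mx_upper /autfactor !mx2E.
  rewrite !mul0r !add0r !mul1r divr1 expr1n mul1r => <-; congr F.
  by rewrite intrD -pmulrn; field.
rewrite (periodic_sum_mul pl (G := fun b : int => F ((z + b%:~R) / l%:R))) //.
Qed.

(** The two signs [e = 1] and [e = - 1] are needed later for the symbol and for its
    conjugate under diag (-1, 1). *)
Lemma Xi_Up (e : int) P : ~~ (p%:Z %| e)%Z -> (size P <= k.-1)%N -> exists C0, forall c,
  \sum_(b < p) Xi (P \Po (p%:R *: 'X - (e * b%:Z)%:~R%:P)) (mx_cusp (mx2 1 (e * b%:Z) 0 p%:Z) c) =
  cp * Xi P c + C0.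
Proof.
move=> he sP; have p0 := prime_gt0 pp.
have p0' : (p%:R : C) != 0 by rewrite pnatr_eq0 -lt0n.
have [| | | |C0 hC0] := @Xi_relation p (fun b => mx2 1 (e * b%:Z) 0 p%:Z)
   (fun b => P \Po (p%:R *: 'X - (e * b%:Z)%:~R%:P)) (fun=> 1) P cp; last first.
- by exists C0 => c; rewrite -hC0; apply: eq_bigr => b _; rewrite mul1r.
- move=> z hz.
  have h := @Sser_hecke R p a (p%:R * cp) 0 z p0 a_subexp hz.
  have {}h : \sum_(j < p) F ((z + j%:R) / p%:R) = p%:R * cp * F z.
    rewrite (q_expansion_Sser hq hz) -h => [|m]; last by rewrite mul0r addr0 hU mulrA.
    rewrite mul0r addr0; apply: eq_bigr => j _; apply: q_expansion_Sser hq _.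
    by apply: upper_div => //; apply: (@upperDint R j).
  transitivity (p%:R^-1 * (\sum_(j < p) F ((z + j%:R) / p%:R)) * P.[z]).
    rewrite -(sum_translates pp hz he) mulr_sumr mulr_suml; apply: eq_bigr => j _.
    have [-> ->] := mx_upper_translate (e * j%:Z) p0 hz.
    rewrite mul1r horner_comp hornerD hornerN hornerZ hornerX hornerC.
    have -> : p%:R * ((z + (e * j%:Z)%:~R) / p%:R) - (e * j%:Z)%:~R = z by field.
    by rewrite mulrC mulrA.
  by rewrite h; field.
- exact: sP.
- move=> b _; rewrite size_comp_poly2 //.
  have -> : p%:R *: 'X - (e * b%:Z)%:~R%:P = p%:R%:P * 'X + (- (e * b%:Z)%:~R)%:P :> {poly C}.
    by rewrite mul_polyC polyCN.
  by rewrite size_MXaddC polyC_eq0 (negbTE p0') /= size_polyC p0'.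
- by move=> b _; rewrite det_mx2 mul1r mulr0 subr0 ltz_nat.
Qed.

Lemma Xi_Tl (l : nat) (e : int) (cl : C) : prime l -> ~~ (l%:Z %| e)%Z ->
  (forall n, a (l * n)%N + (if (l %| n)%N then l%:R ^+ k.-1 * a (n %/ l)%N else 0) = cl * a n) ->
  exists C0, forall c, \sum_(b < l) Xi 1 (mx_cusp (mx2 1 (e * b%:Z) 0 l%:Z) c) +
    l%:R ^+ (k - 2) * Xi 1 (mx_cusp (mx2 l%:Z 0 0 1) c) = cl * Xi 1 c + C0.
Proof.
move=> pl he hl; have l0 := prime_gt0 pl; have l0' : (l%:R : C) != 0 by rewrite pnatr_eq0 -lt0n.
have s1 : (size (1%R : {poly C}) <= k.-1)%N by rewrite size_poly1; lia.
pose N i := if (i < l)%N then mx2 1 (e * i%:Z) 0 l%:Z else mx2 l%:Z 0 0 1.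
pose co i : C := if (i < l)%N then 1 else l%:R ^+ (k - 2).
have [| | | |C0 hC0] := @Xi_relation l.+1 N (fun=> 1) co 1 cl; last first.
- exists C0 => c; rewrite -hC0 big_ord_recr /= /N /co ltnn; congr (_ + _).
  by apply: eq_bigr => b _; rewrite ltn_ord mul1r.
- move=> z hz; have Nl : N l = mx2 l%:Z 0 0 1 by rewrite /N ltnn.
  have col : co l = l%:R ^+ (k - 2) by rewrite /co ltnn.
  rewrite big_ord_recr /= Nl col.
  have [-> ->] := mx_upper_dilate l0 hz; rewrite !hornerC !mulr1.
  have h := @Sser_hecke R l a (l%:R * cl) (l%:R ^+ k) z l0 a_subexp hz.
  have hlz : upper (l%:R * z) by exact: upperMn.
  have kE : l%:R ^+ k = l%:R * l%:R ^+ k.-1 :> C by rewrite -exprS prednK //; lia.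
  have {}h : \sum_(j < l) F ((z + j%:R) / l%:R) + l%:R ^+ k * F (l%:R * z) = l%:R * cl * F z.
    rewrite (q_expansion_Sser hq hz) -h => [|m].
      rewrite (q_expansion_Sser hq hlz); congr (_ + _); apply: eq_bigr => j _.
      by apply: q_expansion_Sser hq _; apply: upper_div => //; apply: (@upperDint R j).
    by rewrite -mulrA -hl kE; case: ifP => _; ring.
  transitivity (l%:R^-1 * (\sum_(j < l) F ((z + j%:R) / l%:R) + l%:R ^+ k * F (l%:R * z))).
    rewrite mulrDr -(sum_translates pl hz he) mulr_sumr; congr (_ + _).
      apply: eq_bigr => j _; rewrite /N /co ltn_ord mul1r.
      have [-> ->] := mx_upper_translate (e * j%:Z) l0 hz.
      by rewrite hornerC mulr1 mulrC.
    have -> : l%:R ^+ k = l%:R ^+ 2 * l%:R ^+ (k - 2) :> C by rewrite -exprD addnC subnK.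
    by field.
  by rewrite h; field.
- exact: s1.
- by move=> i _; exact: s1.
- move=> i _; rewrite /N; case: ifP => _; rewrite det_mx2.
    by rewrite mul1r mulr0 subr0 ltz_nat.
  by rewrite mulr1 mul0r subr0 ltz_nat.
Qed.

Lemma Xi_Gamma0 M P Q : Gamma0 p M -> (size P <= k.-1)%N -> (size Q <= k.-1)%N ->
  (forall z, upper z -> autfactor M z ^+ (k - 2) * Q.[mx_upper M z] = P.[z]) ->
  exists C0, forall c, Xi Q (mx_cusp M c) = Xi P c + C0.
Proof.
move=> hM sP sQ hQ; have dM : \det M = 1 by case: hM.
have [| | | |C0 hC0] := @Xi_relation 1 (fun=> M) (fun=> Q) (fun=> 1) P 1; last first.
- by exists C0 => c; have := hC0 c; rewrite big_ord1 !mul1r.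
- move=> z hz; have h0 : autfactor M z != 0 by rewrite autfactor_neq0 // dM.
  rewrite big_ord1 !mul1r dM (cusp_form_mod hc hM hz) -hQ //.
  by rewrite -[in X in X * F z](subnK k2) exprD; field.
- exact: sP.
- by move=> i _; exact: sQ.
- by move=> i _; rewrite dM.
Qed.

End EichlerIntegrals.

(** * Divisors on the cusps *)

Section Divisors.
Implicit Types (D E : divisor) (c : cusp) (M N : 'M[int]_2).

Section Lift.
Variables (G : zmodType) (h : cusp -> G).

Lemma div_lift_sub (s : seq cusp) D : uniq s -> {subset dom D <= s} ->
  div_lift h D = \sum_(c <- s) h c *~ coeff c D.
Proof.
move=> us sub; rewrite (bigID (mem (dom D))) /= [X in _ + X]big1 => [|c hc]; last first.
  by rewrite coeff_outdom // mulr0z.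
rewrite addr0 -big_filter /div_lift; apply: perm_big; apply: uniq_perm.
- exact: uniq_dom.
- exact: filter_uniq.
by move=> c; rewrite mem_filter; case: (boolP (c \in dom D)) => //= /sub ->.
Qed.

Lemma div_lift_is_zmod_morphism : zmod_morphism (div_lift h).
Proof.
move=> D E; pose s := undup (dom D ++ dom E).
have us : uniq s by exact: undup_uniq.
rewrite !(@div_lift_sub s) // => [|c hc|c hc|c hc].
- by rewrite -sumrB; apply: eq_bigr => c _; rewrite coeffB mulrzBr.
- by rewrite mem_undup mem_cat hc orbT.
- by rewrite mem_undup mem_cat hc.
- by rewrite mem_undup; exact: domB.
Qed.

HB.instance Definition _ := GRing.isZmodMorphism.Build divisor G (div_lift h)
  div_lift_is_zmod_morphism.

Lemma div_lift_pt c : div_lift h (pt c) = h c.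
Proof. by rewrite /div_lift /pt domU ?oner_eq0 // big_seq1 coeffU eqxx mulr1 mulr1z. Qed.

End Lift.

HB.instance Definition _ M := GRing.isZmodMorphism.Build divisor divisor (mx_div M)
  (div_lift_is_zmod_morphism (fun c => pt (mx_cusp M c))).

Lemma mx_div_pt M c : mx_div M (pt c) = pt (mx_cusp M c).
Proof. exact: div_lift_pt. Qed.

Lemma div_lift_mx (G : zmodType) (h : cusp -> G) M D :
  div_lift h (mx_div M D) = div_lift (fun c => h (mx_cusp M c)) D.
Proof.
rewrite /mx_div {2 3}/div_lift raddf_sum.
by apply: eq_bigr => c _; rewrite raddfMz /= div_lift_pt.
Qed.

Lemma div_liftD (G : zmodType) (f g : cusp -> G) D :
  div_lift (fun c => f c + g c) D = div_lift f D + div_lift g D.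
Proof. by rewrite /div_lift -big_split; apply: eq_bigr => c _; rewrite mulrzDl. Qed.

Lemma div_lift_sum (G : zmodType) n (f : 'I_n -> cusp -> G) D :
  div_lift (fun c => \sum_i f i c) D = \sum_i div_lift (f i) D.
Proof.
by rewrite /div_lift exchange_big; apply: eq_bigr => c _; rewrite mulrz_suml.
Qed.

Lemma div_liftZ (A : pzRingType) (a : A) (f : cusp -> A) D :
  div_lift (fun c => a * f c) D = a * div_lift f D.
Proof. by rewrite /div_lift mulr_sumr; apply: eq_bigr => c _; rewrite mulrzAr. Qed.

Lemma eq_div_lift (G : zmodType) (f g : cusp -> G) D :
  f =1 g -> div_lift f D = div_lift g D.
Proof. by move=> fg; apply: eq_bigr => c _; rewrite fg. Qed.

Lemma pt_sum D : D = \sum_(c <- dom D) pt c *~ coeff c D.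
Proof.
rewrite -[LHS]freeg_sumE; apply: eq_bigr => c _.
by rewrite /pt freeg_mulz intz.
Qed.

Lemma additive_ext (G : zmodType) (f g : {additive divisor -> G}) :
  (forall c, f (pt c) = g (pt c)) -> f =1 g.
Proof.
move=> h D; rewrite (pt_sum D) !raddf_sum; apply: eq_bigr => c _.
by rewrite !raddfMz h.
Qed.

Lemma mx_div_mul M N : \det M != 0 -> \det N != 0 ->
  forall D, mx_div (M *m N) D = mx_div M (mx_div N D).
Proof.
move=> hM hN; apply: (@additive_ext _ (mx_div (M *m N)) (mx_div M \o mx_div N)) => c /=.
by rewrite !mx_div_pt mx_cuspM.
Qed.

Lemma mx_div1 D : mx_div 1%:M D = D.
Proof.
by apply: (@additive_ext _ (mx_div 1%:M) idfun) => c /=; rewrite mx_div_pt mx_cusp1.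
Qed.

Lemma deg_sumE D : deg D = \sum_(c <- dom D) coeff c D.
Proof.
rewrite {1}(pt_sum D) /pt; elim/big_rec2: _ => [|c x y _ <-]; first by rewrite deg0.
by rewrite degD freeg_mulz degU intz.
Qed.

Lemma deg_mx_div M D : deg (mx_div M D) = deg D.
Proof.
rewrite [RHS]deg_sumE /mx_div /div_lift; elim/big_rec2: _ => [|c x y _ <-]; first by rewrite deg0.
by rewrite degD /pt freeg_mulz degU intz.
Qed.

Lemma Delta0_mx_div M D : Delta0 D -> Delta0 (mx_div M D).
Proof. by rewrite /Delta0 /= deg_mx_div. Qed.

Lemma Delta0_ptB c c' : Delta0 (pt c - pt c').
Proof. by rewrite /Delta0 /= degB /pt !degU subrr. Qed.

Lemma Delta0D D E : Delta0 D -> Delta0 E -> Delta0 (D + E).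
Proof. by rewrite /Delta0 /= degD => -> ->. Qed.

Lemma Delta0N D : Delta0 D -> Delta0 (- D).
Proof. by rewrite /Delta0 /= degN => ->. Qed.

Lemma Delta0_0 : Delta0 0.
Proof. by rewrite /Delta0 /= deg0. Qed.

Lemma Delta0_sum D : Delta0 D ->
  D = \sum_(c <- dom D) (pt c - pt None) *~ coeff c D.
Proof.
move=> hD; rewrite [LHS](pt_sum D).
rewrite [RHS](eq_bigr (fun c => pt c *~ coeff c D - pt None *~ coeff c D)); last first.
  by move=> c _; rewrite mulrzBl.
by rewrite sumrB -mulrz_sumr -deg_sumE hD mulr0z subr0.
Qed.

Lemma Delta0_ind (Pr : divisor -> Prop) : Pr 0 ->
  (forall D E, Delta0 D -> Delta0 E -> Pr D -> Pr E -> Pr (D + E)) ->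
  (forall D, Delta0 D -> Pr D -> Pr (- D)) -> (forall c, Pr (pt c - pt None)) ->
  forall D, Delta0 D -> Pr D.
Proof.
move=> P0 PD PN Pc D hD; rewrite (Delta0_sum hD).
suff : Delta0 (\sum_(c <- dom D) (pt c - pt None) *~ coeff c D) /\
  Pr (\sum_(c <- dom D) (pt c - pt None) *~ coeff c D) by case.
have hMn E n : Delta0 E /\ Pr E -> Delta0 (E *+ n) /\ Pr (E *+ n).
  move=> [h1 h2]; elim: n => [|n [h3 h4]]; first by rewrite mulr0n; split=> //; exact: Delta0_0.
  by rewrite mulrS; split; [exact: Delta0D|exact: PD].
elim/big_ind: _ => [|E E' [h1 h2] [h3 h4]|c _]; first by split=> //; exact: Delta0_0.
  by split; [exact: Delta0D|exact: PD].
have hc : Delta0 (pt c - pt None) /\ Pr (pt c - pt None) by split=> //; exact: Delta0_ptB.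
case: (intP (coeff c D)) => [|k|k]; first by rewrite mulr0z; split=> //; exact: Delta0_0.
  by rewrite -pmulrn; exact: hMn.
rewrite mulrNz -pmulrn; have [h1 h2] := hMn _ k.+1 hc.
by split; [exact: Delta0N|exact: PN].
Qed.

(** Divisors of degree zero are generated by the differences with the cusp oo. *)
Lemma Delta0_lift (G : zmodType) (f : divisor -> G) :
  (forall D E, Delta0 D -> Delta0 E -> f (D + E) = f D + f E) ->
  forall D, Delta0 D -> f D = div_lift (fun c => f (pt c - pt None)) D.
Proof.
move=> fD; have f0 : f 0 = 0.
  by apply: (addrI (f 0)); rewrite -fD ?addr0 //; exact: Delta0_0.
have fN D : Delta0 D -> f (- D) = - f D.
  by move=> hD; apply: (addrI (f D)); rewrite -fD ?subrr //; exact: Delta0N.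
have hMn D n : Delta0 D -> Delta0 (D *+ n) /\ f (D *+ n) = f D *+ n.
  move=> hD; elim: n => [|n [h1 h2]]; first by rewrite !mulr0n; split=> //; exact: Delta0_0.
  by rewrite !mulrS fD // h2; split=> //; exact: Delta0D.
have hMz D (n : int) : Delta0 D -> Delta0 (D *~ n) /\ f (D *~ n) = f D *~ n.
  move=> hD; case: n => n; first by rewrite -!pmulrn; exact: hMn.
  rewrite NegzE !mulrNz -!pmulrn; have [h1 h2] := hMn D n.+1 hD.
  by split; [exact: Delta0N|rewrite fN // h2].
move=> D hD; rewrite {1}(Delta0_sum hD) /div_lift.
suff : Delta0 (\sum_(c <- dom D) (pt c - pt None) *~ coeff c D) /\
  f (\sum_(c <- dom D) (pt c - pt None) *~ coeff c D) =
  \sum_(c <- dom D) f (pt c - pt None) *~ coeff c D by case.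
elim: (dom D) => [|c s [h1 h2]]; first by rewrite !big_nil; split=> //; exact: Delta0_0.
have [h3 h4] := hMz _ (coeff c D) (Delta0_ptB c None).
rewrite !(big_cons _ _ c s); split; first exact: Delta0D.
by rewrite -h2 -h4 -fD.
Qed.

(** The constant is multiplied by the degree. *)
Lemma Delta0_ext (G : zmodType) (f g : {additive divisor -> G}) (C : G) :
  (forall c, f (pt c) = g (pt c) + C) -> forall D, Delta0 D -> f D = g D.
Proof.
move=> h D hD; rewrite (Delta0_sum hD) !raddf_sum; apply: eq_bigr => c _.
by rewrite !raddfMz !raddfB !h opprD addrACA subrr addr0.
Qed.

End Divisors.

(** * The action of integral matrices on polynomials *)

Section Hev.
Variable g : nat.

(** The binary form of degree [g] attached to [P], with the variable of [P] in the place of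
    [y / x]. *)
Definition hev (A : comNzRingType) (P : {poly A}) (x y : A) : A :=
  \sum_(i < g.+1) P`_i * (y ^+ i * x ^+ (g - i)).

Lemma hev_lin (A : comNzRingType) (c : A) P Q x y :
  hev (c *: P + Q) x y = c * hev P x y + hev Q x y.
Proof.
rewrite /hev mulr_sumr -big_split; apply: eq_bigr => i _ /=.
by rewrite coefD coefZ mulrDl -!mulrA.
Qed.

Lemma hev_sum (A : comNzRingType) n (c : 'I_n -> A) (P : 'I_n -> {poly A}) x y :
  hev (\sum_i c i *: P i) x y = \sum_i c i * hev (P i) x y.
Proof.
elim/big_rec2: _ => [|i u w _ <-]; last by rewrite hev_lin.
by rewrite /hev big1 // => i _; rewrite coef0 mul0r.
Qed.

Lemma hev_scale (A : comNzRingType) (P : {poly A}) u x y :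
  hev P (u * x) (u * y) = u ^+ g * hev P x y.
Proof.
rewrite /hev mulr_sumr; apply: eq_bigr => i _.
have hi : (i <= g)%N by rewrite -ltnS.
have -> : u ^+ g = u ^+ (g - i) * u ^+ i by rewrite -exprD subnK.
by rewrite !exprMn; ring.
Qed.

Lemma hev_neg (A : comNzRingType) (P : {poly A}) x y : ~~ odd g -> hev P (- x) (- y) = hev P x y.
Proof.
move=> hg; rewrite -(mulN1r x) -(mulN1r y) hev_scale.
by rewrite -signr_odd (negbTE hg) mul1r.
Qed.

Lemma hev1 (A : comNzRingType) (x y : A) : hev 1 x y = x ^+ g.
Proof.
rewrite /hev big_ord_recl big1 => [|i _]; last by rewrite coef1 mul0r.
by rewrite coef1 /= mul1r expr0 mul1r subn0 addr0.
Qed.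

Lemma hev01 (A : comNzRingType) (P : {poly A}) : hev P 0 1 = P`_g.
Proof.
rewrite /hev big_ord_recr /= subnn expr0 expr1n !mulr1 big1 ?add0r // => i _.
by rewrite expr0n subn_eq0 leqNgt ltn_ord mulr0 mulr0.
Qed.

Lemma hev_horner (A : comNzRingType) (P : {poly A}) y : (size P <= g.+1)%N -> hev P 1 y = P.[y].
Proof.
move=> hP; rewrite (horner_coef_wide _ hP) /hev; apply: eq_bigr => i _.
by rewrite expr1n mulr1.
Qed.

(** The action substitutes linear forms in the binary form, which makes it functorial in the
    matrix. *)
Lemma poly_actE (A : comNzRingType) (M : 'M[int]_2) (P : {poly A}) :
  poly_act g M P = hev (map_poly polyC P) ((M 0 0)%:~R%:P + (M 1 0)%:~R *: 'X)
    ((M 0 1)%:~R%:P + (M 1 1)%:~R *: 'X).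
Proof. by apply: eq_bigr => i _; rewrite coef_map -mul_polyC. Qed.

Lemma poly_act_map (A B : comNzRingType) (f : {rmorphism A -> B}) M P :
  map_poly f (poly_act g M P) = poly_act g M (map_poly f P).
Proof.
rewrite /poly_act rmorph_sum; apply: eq_bigr => i _ /=.
rewrite linearZ /= coef_map; congr (_ *: _).
rewrite rmorphM !rmorphXn !rmorphD /= !linearZ /= !map_polyX !map_polyC /=.
by rewrite !rmorph_int.
Qed.

Lemma poly_act_lin (A : comNzRingType) M (c : A) P Q :
  poly_act g M (c *: P + Q) = c *: poly_act g M P + poly_act g M Q.
Proof.
rewrite /poly_act scaler_sumr -big_split; apply: eq_bigr => i _.
by rewrite coefD coefZ scalerDl scalerA.
Qed.

Lemma size_linear_exp (A : comNzRingType) (u v : A) n : (size ((u%:P + v *: 'X) ^+ n)%R <= n.+1)%N.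
Proof.
have h1 : (size (u%:P + v *: 'X)%R <= 2)%N.
  rewrite (leq_trans (size_polyD _ _)) // geq_max (leq_trans (size_polyC_leq1 _)) //=.
  by rewrite (leq_trans (size_scale_leq _ _)) // size_polyX.
apply: leq_trans (size_exp_leq _ _) _; rewrite ltnS.
by rewrite -[X in (_ <= X)%N]mul1n leq_mul2r; case: (size _) h1 => [|[|[|]]] //; rewrite orbT.
Qed.

Lemma size_poly_act (A : comNzRingType) M (P : {poly A}) : (size (poly_act g M P) <= g.+1)%N.
Proof.
apply: (leq_trans (size_sum _ _ _)); apply/bigmax_leqP => i _.
apply: leq_trans (size_scale_leq _ _) _; apply: leq_trans (size_mul_leq _ _) _.
have hi : (i <= g)%N by rewrite -ltnS.
have h1 := size_linear_exp ((M 0 1)%:~R : A) (M 1 1)%:~R i.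
have h2 := size_linear_exp ((M 0 0)%:~R : A) (M 1 0)%:~R (g - i).
by move: h1 h2; set s1 := size _; set s2 := size _ => h1 h2; lia.
Qed.

Lemma hev_linear_forms (A : comNzRingType) (u v s t x y : A) i : (i <= g)%N ->
  hev ((u%:P + v *: 'X) ^+ i * (s%:P + t *: 'X) ^+ (g - i)) x y =
  (u * x + v * y) ^+ i * (s * x + t * y) ^+ (g - i).
Proof.
(* The degree varies in the induction: homogenisation in degree [n] is [f _ n], and multiplying
   the polynomial by a linear form raises [n] by one. *)
move=> hi; pose f (P : {poly A}) (n : nat) : A := \sum_(j < n.+1) P`_j * (y ^+ j * x ^+ (n - j)).
have fS (P : {poly A}) n : (size P <= n.+1)%N -> f P n.+1 = x * f P n.
  move=> hP; rewrite /f big_ord_recr /= nth_default // mul0r addr0 mulr_sumr.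
  apply: eq_bigr => j _; have hj : (j <= n)%N by rewrite -ltnS.
  by rewrite subSn // exprS; ring.
have fX (P : {poly A}) n : f ('X * P) n.+1 = y * f P n.
  rewrite /f big_ord_recl coefXM eqxx mul0r add0r mulr_sumr.
  by apply: eq_bigr => j _; rewrite coefXM /= subSS exprS; ring.
have fL (P : {poly A}) n u' v' : (size P <= n.+1)%N -> f ((u'%:P + v' *: 'X) * P) n.+1 = (u' * x + v' * y) * f P n.
  move=> hP; transitivity (u' * f P n.+1 + v' * f ('X * P) n.+1).
    rewrite /f !mulr_sumr -big_split; apply: eq_bigr => j _.
    by rewrite mulrDl coefD coefCM -scalerAl coefZ /=; ring.
  by rewrite fS // fX; ring.
have fE n u' v' (P : {poly A}) m : (size P <= m.+1)%N ->
    f ((u'%:P + v' *: 'X) ^+ n * P) (n + m)%N = (u' * x + v' * y) ^+ n * f P m.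
  move=> hP; elim: n => [|n IH]; first by rewrite !expr0 !mul1r.
  rewrite !exprS -!mulrA; rewrite addSn fL ?IH //.
  apply: leq_trans (size_mul_leq _ _) _; have := size_linear_exp u' v' n.
  by move: hP; set s1 := size _; set s2 := size _ => h1 h2; lia.
have e : (i + (g - i))%N = g by rewrite subnKC.
have h := fE i u v _ _ (size_linear_exp s t (g - i)).
rewrite e in h; rewrite /hev -/(f _ g) h.
congr (_ * _); have := fE (g - i)%N s t 1 0%N; rewrite addn0 mulr1 => ->; last by rewrite size_poly1.
by rewrite /f big_ord1 coef1 !expr0 !mulr1.
Qed.

Lemma hev_act (A : comNzRingType) M (P : {poly A}) x y :
  hev (poly_act g M P) x y =
  hev P (x * (M 0 0)%:~R + y * (M 1 0)%:~R) (x * (M 0 1)%:~R + y * (M 1 1)%:~R).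
Proof.
rewrite /poly_act (hev_sum (fun i : 'I_g.+1 => P`_i)); apply: eq_bigr => i _; congr (_ * _).
rewrite hev_linear_forms; last by rewrite -ltnS.
by congr (_ ^+ _ * _ ^+ _); ring.
Qed.

Lemma poly_actM (A : comNzRingType) M N (P : {poly A}) :
  poly_act g (M *m N) P = poly_act g M (poly_act g N P).
Proof.
rewrite [LHS]poly_actE [RHS]poly_actE poly_act_map hev_act !mulmx2E.
have hC (n : int) : (n%:~R : A)%:P = n%:~R by rewrite rmorph_int.
by congr hev; rewrite -!mul_polyC !hC !rmorphD !rmorphM /=; ring.
Qed.

Lemma poly_act1 (A : comNzRingType) M :
  poly_act g M 1 = ((M 0 0)%:~R%:P + (M 1 0)%:~R *: 'X) ^+ g :> {poly A}.
Proof. by rewrite poly_actE rmorph1 hev1. Qed.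

End Hev.

(** * Hecke operators on symbols *)

(** The operators T_l, before any symbol is involved: relations between them are relations
    between sums over matrices. *)
Definition tri_sum (V : zmodType) (l : nat) (tau : 'M[int]_2 -> V) : V :=
  \sum_(b < l) tau (mx2 1 b%:Z 0 l%:Z) + tau (mx2 l%:Z 0 0 1).

(** The product of two translation matrices is a translation matrix whose upper right entry
    runs through the residues modulo [l p], written in mixed radix in one order or the
    other. The mixed products agree once multiplication by one prime has permuted the
    residues modulo the other. *)
Lemma tri_sum_comm (V : zmodType) (l p : nat) (tau : 'M[int]_2 -> V) :
  prime l -> prime p -> l != p ->
  (forall a b d, a != 0 -> d != 0 -> tau (mx2 a (b + d) 0 d) = tau (mx2 a b 0 d)) ->
  tri_sum p (fun M => tri_sum l (fun N => tau (N *m M))) =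
  tri_sum l (fun N => tri_sum p (fun M => tau (M *m N))).
Proof.
move=> pl pp lp per.
have l0 : l%:Z != 0 by rewrite eqz_nat -lt0n prime_gt0.
have p0 : p%:Z != 0 by rewrite eqz_nat -lt0n prime_gt0.
have digits (m n : nat) (G : nat -> V) :
    \sum_(c < m) \sum_(b < n) G (c + b * m)%N = \sum_(0 <= i < n * m) G i.
  rewrite exchange_big /= big_nat_mul big_mkord; apply: eq_bigr => b _.
  by rewrite mulSn -[X in \big[_/_]_(X <= _ < _) _]add0n big_addn addnK big_mkord.
have step (m n : nat) : prime m -> prime n -> m != n -> n%:Z != 0 -> m%:Z != 0 ->
    \sum_(b < n) tau (mx2 m%:Z 0 0 1 *m mx2 1 b%:Z 0 n%:Z) =
    \sum_(b < n) tau (mx2 1 b%:Z 0 n%:Z *m mx2 m%:Z 0 0 1).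
  move=> pm pn mn n0 m0.
  rewrite (eq_bigr (fun b : 'I_n => tau (mx2 m%:Z (m%:Z * b%:Z) 0 n%:Z))); last first.
    by move=> b _; rewrite mulmx2; congr (tau (mx2 _ _ _ _)); ring.
  rewrite (periodic_sum_mul pn (G := fun b => tau (mx2 m%:Z b 0 n%:Z))).
  - by apply: eq_bigr => b _; rewrite mulmx2; congr (tau (mx2 _ _ _ _)); ring.
  - by move=> b; apply: per.
  - by rewrite dvdzE /= dvdn_prime2 // eq_sym.
rewrite /tri_sum !big_split /= -!addrA; congr (_ + _).
  rewrite (eq_bigr (fun c : 'I_p => \sum_(b < l) tau (mx2 1 (c + b * p)%N%:Z 0 (l * p)%N%:Z))).
    rewrite (digits p l (fun i => tau (mx2 1 i%:Z 0 (l * p)%N%:Z))).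
    rewrite [RHS](eq_bigr (fun b : 'I_l => \sum_(c < p) tau (mx2 1 (b + c * l)%N%:Z 0 (l * p)%N%:Z))).
      by rewrite (digits l p (fun i => tau (mx2 1 i%:Z 0 (l * p)%N%:Z))) mulnC.
    move=> b _; apply: eq_bigr => c _; rewrite mulmx2 PoszD !PoszM.
    by congr (tau (mx2 _ _ _ _)); ring.
  move=> b _; apply: eq_bigr => c _; rewrite mulmx2 PoszD !PoszM.
  by congr (tau (mx2 _ _ _ _)); ring.
have pl' : p != l by rewrite eq_sym.
rewrite (step l p) // (step p l) //.
have -> : mx2 l%:Z 0 0 1 *m mx2 p%:Z 0 0 1 = mx2 p%:Z 0 0 1 *m mx2 l%:Z 0 0 1.
  by rewrite !mulmx2; congr mx2; ring.
by rewrite addrCA.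
Qed.

Lemma tri_sum_sub (A : comNzRingType) l (tau tau' : 'M[int]_2 -> A) c :
  tri_sum l (fun M => tau M - c * tau' M) = tri_sum l tau - c * tri_sum l tau'.
Proof. by rewrite /tri_sum mulrDr mulr_sumr opprD addrACA -sumrB. Qed.

Section Equivariant.
Variables (A : comNzRingType) (V : zmodType) (g : nat) (S : set divisor).
Hypothesis hS : forall M D, S D -> S (mx_div M D).
Implicit Types (phi : divisor -> {poly A} -> V) (D : divisor) (P : {poly A}).

Definition equivariant phi := forall M, SL2Z M -> forall D P, S D ->
  phi (mx_div M D) (poly_act g M P) = phi D P.

Definition hecke_op l phi D P :=
  tri_sum l (fun M => phi (mx_div M D) (poly_act g M P)).

Let det_neq0 M : SL2Z M -> \det M != 0. Proof. by move=> ->. Qed.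

Lemma equivariant_gens phi :
  (forall D P, phi D (poly_act g 1%:M P) = phi D P) ->
  (forall D P, S D -> phi (mx_div mxS D) (poly_act g mxS P) = phi D P) ->
  (forall D P, S D -> phi (mx_div mxT D) (poly_act g mxT P) = phi D P) ->
  equivariant phi.
Proof.
move=> h1 eS eT; apply: (SL2Z_ind (E := fun M => forall D P, S D ->
  phi (mx_div M D) (poly_act g M P) = phi D P)) => //.
- move=> D P hD; rewrite -[LHS]eT; last exact: hS.
  have dT : \det mxT = 1 by exact: SL2Z_T.
  by rewrite -mx_div_mul ?det_adj2 ?dT // -poly_actM mul_adj2 dT mx_div1 h1.
- move=> M N hM hN eM eN D P hD; rewrite mx_div_mul ?det_neq0 // poly_actM eM ?eN //.
  exact: hS.
Qed.

Lemma equivariant_act1 phi D P : equivariant phi -> S D ->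
  phi D (poly_act g 1%:M P) = phi D P.
Proof. by move=> h hD; rewrite -{1}(mx_div1 D) h // /SL2Z /= det1. Qed.

Variables (l : nat) (pl : prime l).

Let l_neq0 : l%:Z != 0. Proof. by rewrite eqz_nat -lt0n prime_gt0. Qed.

(** On an equivariant symbol the last matrix may be multiplied from the left by an element
    of [SL2(Z)], which gives it a second row divisible by [l] like the others. *)
Lemma hecke_op_coset phi D P : equivariant phi -> S D ->
  hecke_op l phi D P = coset_sum l (fun M => phi (mx_div M D) (poly_act g M P)).
Proof.
move=> hphi hD; rewrite /hecke_op /tri_sum /coset_sum; congr (_ + _).
have -> : mx2 l%:Z 0 0 1 = adj2 mxS *m mx2 0 1 (- l%:Z) 0.
  by rewrite /adj2 /mxS !mx2E mulmx2; congr mx2; ring.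
have sS : SL2Z (adj2 mxS) by apply: SL2Z_adj; exact: SL2Z_S.
have dl : \det (mx2 0 1 (- l%:Z) 0) != 0 by rewrite det_mx2 mul0r mul1r sub0r opprK.
by rewrite (mx_div_mul (det_neq0 sS) dl) poly_actM hphi //; exact: hS.
Qed.

(** The generators of [SL2(Z)] permute the cosets. *)
Lemma hecke_op_equivariant phi : equivariant phi -> equivariant (hecke_op l phi).
Proof.
move=> hphi.
have gen M : SL2Z M -> (forall tau : 'M[int]_2 -> V,
    (forall N A, Gamma0 l N -> hecke_mx l A -> tau (N *m A) = tau A) ->
    coset_sum l (fun A => tau (A *m M)) = coset_sum l tau) ->
    forall D P, S D -> hecke_op l phi (mx_div M D) (poly_act g M P) = hecke_op l phi D P.
  move=> hM hc D P hD; rewrite !hecke_op_coset //; last exact: hS.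
  rewrite -(hc (fun M => phi (mx_div M D) (poly_act g M P))); last first.
    move=> N B [hN _] [hB _ _]; rewrite (mx_div_mul (det_neq0 hN) hB) poly_actM hphi //.
    exact: hS.
  congr (_ + _); first (apply: eq_bigr => b _).
    by rewrite poly_actM (mx_div_mul _ (det_neq0 hM)) // det_mx2 mul1r mulr0 subr0.
  by rewrite poly_actM (mx_div_mul _ (det_neq0 hM)) // det_mx2 mul0r mul1r sub0r opprK.
apply: equivariant_gens => [D P||].
- by congr (_ + _); first (apply: eq_bigr => b _); rewrite -poly_actM mulmx1.
- by apply: gen => [|tau ht]; [exact: SL2Z_S|exact: coset_sum_S].
- by apply: gen => [|tau ht]; [exact: SL2Z_T|exact: coset_sum_T].
Qed.

End Equivariant.

Lemma hecke_op_comm (A : comNzRingType) (V : zmodType) g (S : set divisor) (phi : divisor -> {poly A} -> V) l p D P :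
  (forall M D, S D -> S (mx_div M D)) ->
  prime l -> prime p -> l != p -> equivariant g S phi -> S D ->
  hecke_op g p (hecke_op g l phi) D P = hecke_op g l (hecke_op g p phi) D P.
Proof.
move=> hS pl pp lp hphi hD.
have l0 : l%:Z != 0 by rewrite eqz_nat -lt0n prime_gt0.
have p0 : p%:Z != 0 by rewrite eqz_nat -lt0n prime_gt0.
pose tau M := phi (mx_div M D) (poly_act g M P).
have dU (b n : int) : n != 0 -> \det (mx2 1 b 0 n) != 0 by rewrite det_mx2 mul1r mulr0 subr0.
have dD (n : int) : n != 0 -> \det (mx2 n 0 0 1) != 0 by rewrite det_mx2 mulr1 mul0r subr0.
have exp (m n : nat) : m%:Z != 0 -> n%:Z != 0 ->
    hecke_op g m (hecke_op g n phi) D P = tri_sum m (fun M => tri_sum n (fun N => tau (N *m M))).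
  move=> m0 n0; have e M : \det M != 0 -> hecke_op g n phi (mx_div M D) (poly_act g M P) =
      tri_sum n (fun N => tau (N *m M)).
    move=> hM; rewrite /hecke_op /tri_sum; congr (_ + _); first (apply: eq_bigr => b _).
      by rewrite /tau mx_div_mul ?dU // poly_actM.
    by rewrite /tau mx_div_mul ?dD // poly_actM.
  rewrite {1}/hecke_op {1 2}/tri_sum; congr (_ + _); first (apply: eq_bigr => b _).
    by rewrite e ?dU.
  by rewrite e ?dD.
rewrite !exp //; apply: tri_sum_comm => // a b d a0 d0.
have -> : mx2 a (b + d) 0 d = mxT *m mx2 a b 0 d by rewrite mulmx2; congr mx2; ring.
have dT : \det mxT != 0 by rewrite (_ : \det mxT = 1) //; exact: SL2Z_T.
have dM : \det (mx2 a b 0 d) != 0 by rewrite det_mx2 mulr0 subr0 mulf_neq0.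
rewrite /tau (mx_div_mul dT dM) poly_actM hphi //; first exact: SL2Z_T.
exact: hS.
Qed.

(** * From symbols of level p with constant values to symbols of level one *)

Section Induced.
Variables (p : nat) (pp : prime p) (h : nat) (A : comNzRingType) (pA : p%:R = 0 :> A).
Hypotheses (h_gt0 : (0 < h)%N) (h_even : ~~ odd h).
Variable psi : {additive divisor -> A}.
Implicit Types (D : divisor) (P : {poly A}) (M : 'M[int]_2).

Hypothesis psiU : forall D, Delta0 D -> \sum_(b < p) psi (mx_div (mx2 1 b%:Z 0 p%:Z) D) = psi D.
Hypothesis psiG : forall M D, Gamma0 p M -> Delta0 D ->
  (M 0 0)%:~R ^+ h * psi (mx_div M D) = psi D.
Hypothesis psiN : forall D, Delta0 D -> psi (mx_div mx_neg D) = psi D.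

Definition induced_term D P M : A :=
  hev h P (M 0 0)%:~R (M 0 1)%:~R * psi (mx_div M D).

(** Shapiro's lemma made explicit modulo [p]: the forms are evaluated at the points of the
    projective line over the field with [p] elements, which index the cosets of [Gamma0 p].
    *)
Definition induced D P : A := coset_sum p (induced_term D P).

Lemma p_eq0 (n : int) : (p%:Z %| n)%Z -> n%:~R = 0 :> A.
Proof. by case/dvdzP=> q ->; rewrite rmorphM /= -pmulrn pA mulr0. Qed.

(** The upper left entry of [N] multiplies the first row of [M] modulo [p]; by homogeneity
    it leaves the form with the power that [psiG] asks for. *)
Lemma induced_term_Gamma0 D P N M : Delta0 D -> Gamma0 p N -> hecke_mx p M ->
  induced_term D P (N *m M) = induced_term D P M.
Proof.
move=> hD hN [hM h0 h1]; rewrite /induced_term !mulmx2E.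
have e0 : (N 0 0 * M 0 0 + N 0 1 * M 1 0)%:~R = (N 0 0)%:~R * (M 0 0)%:~R :> A.
  by rewrite intrD !intrM (p_eq0 h0) mulr0 addr0.
have e1 : (N 0 0 * M 0 1 + N 0 1 * M 1 1)%:~R = (N 0 0)%:~R * (M 0 1)%:~R :> A.
  by rewrite intrD !intrM (p_eq0 h1) mulr0 addr0.
have dN : \det N != 0 by case: hN => ->.
rewrite e0 e1 hev_scale (mx_div_mul dN hM) -(psiG hN (Delta0_mx_div M hD)).
by move: (psi _) (hev _ _ _ _) => u v; ring.
Qed.

Lemma induced_lin c P Q D : induced D (c *: P + Q) = c * induced D P + induced D Q.
Proof.
rewrite /induced /coset_sum mulrDr mulr_sumr addrACA -big_split.
have e M : induced_term D (c *: P + Q) M = c * induced_term D P M + induced_term D Q M.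
  by rewrite /induced_term hev_lin mulrDl mulrA.
by congr (_ + _) => //; apply: eq_bigr => b _ /=.
Qed.

Lemma inducedD D E P : induced (D + E) P = induced D P + induced E P.
Proof.
rewrite /induced /coset_sum addrACA -big_split.
have e M : induced_term (D + E) P M = induced_term D P M + induced_term E P M.
  by rewrite /induced_term !raddfD /= mulrDr.
by congr (_ + _) => //; apply: eq_bigr => b _ /=.
Qed.

Lemma induced_equivariant : equivariant h Delta0 induced.
Proof.
have gen M : SL2Z M -> (forall tau : 'M[int]_2 -> A,
    (forall N B, Gamma0 p N -> hecke_mx p B -> tau (N *m B) = tau B) ->
    coset_sum p (fun B => tau (B *m M)) = coset_sum p tau) ->
    forall D P, Delta0 D -> induced (mx_div M D) (poly_act h M P) = induced D P.
  move=> hM hc D P hD; rewrite /induced -(hc (induced_term D P)); last first.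
    by move=> N B hN hB; exact: induced_term_Gamma0.
  have dM : \det M != 0 by rewrite hM.
  have e B : \det B != 0 ->
      induced_term (mx_div M D) (poly_act h M P) B = induced_term D P (B *m M).
    by move=> hA; rewrite /induced_term hev_act !mulmx2E (mx_div_mul hA dM) !intrD !intrM.
  congr (_ + _); first (apply: eq_bigr => b _).
    by rewrite e //; case: (hecke_mx_translate pp b).
  by rewrite e //; case: (hecke_mx_infty pp).
apply: (equivariant_gens Delta0_mx_div) => [D P||].
- have e M : induced_term D (poly_act h 1%:M P) M = induced_term D P M.
    by rewrite /induced_term hev_act !mxE /= !mulr1 !mulr0 add0r addr0.
  by congr (_ + _) => //; apply: eq_bigr.
- by apply: gen => [|tau ht]; [exact: SL2Z_S|exact: coset_sum_S].
- by apply: gen => [|tau ht]; [exact: SL2Z_T|exact: coset_sum_T].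
Qed.

(** The point at infinity contributes 0 as the degree is positive, and the other points give
    U_p of [psi]. *)
Lemma induced_one D : Delta0 D -> induced D 1 = psi D.
Proof.
move=> hD; rewrite -[RHS]psiU // /induced /coset_sum /induced_term.
rewrite !mx2E !hev1 expr0n eqn0Ngt h_gt0 mul0r addr0.
by apply: eq_bigr => b _; rewrite !mx2E hev1 expr1n mul1r.
Qed.

Lemma induced_neg D P : Delta0 D -> induced (mx_div mx_neg D) (poly_act h mx_neg P) = induced D P.
Proof.
move=> hD; have dN : \det mx_neg = - 1 by rewrite det_mx2 mulr1 mul0r subr0.
have dN0 : \det mx_neg != 0 by rewrite dN.
pose tau := induced_term D P.
have e B : \det B != 0 ->
    induced_term (mx_div mx_neg D) (poly_act h mx_neg P) B = tau (B *m mx_neg).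
  by move=> hA; rewrite /tau /induced_term hev_act !mulmx2E (mx_div_mul hA dN0) !intrD !intrM.
have tN B : \det B != 0 -> tau (mx_neg *m B) = tau B.
  move=> hA; rewrite /tau /induced_term !mulmx2E !mx2E (mx_div_mul dN0 hA) psiN; last exact: Delta0_mx_div.
  by rewrite !mul0r !addr0 !mulN1r !rmorphN /= hev_neg.
have tM B : hecke_mx p B -> tau (mx2 (- 1) 0 0 (- 1) *m B) = tau B.
  by move=> hB; apply: induced_term_Gamma0 => //; split; rewrite ?det_mx2 ?mx2E ?dvdz0.
rewrite /induced /coset_sum; congr (_ + _); last first.
  have [d0 _ _] := hecke_mx_infty pp; rewrite e // -/(tau _).
  rewrite -(tM _ (hecke_mx_infty pp)) -[RHS]tN; last by rewrite det_mulmx mulf_neq0 // det_mx2.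
  by congr tau; rewrite /mx_neg !mulmx2; congr mx2; ring.
have per b : tau (mx2 1 (b + p%:Z) 0 p%:Z) = tau (mx2 1 b 0 p%:Z).
  have hT : Gamma0 p mxT by split; rewrite ?det_mx2 ?mx2E ?dvdz0.
  rewrite -[RHS](induced_term_Gamma0 P hD hT (hecke_mx_translate pp b)) -/tau.
  by congr tau; rewrite /mxT !mulmx2; congr mx2; ring.
have hN1 : ~~ (p%:Z %| - 1)%Z by rewrite dvdzE /= dvdn1 neq_ltn prime_gt1 ?orbT.
rewrite -(periodic_sum_mul pp per hN1).
apply: eq_bigr => b _; have [d0 _ _] := hecke_mx_translate pp b.
have [d1 _ _] := hecke_mx_translate pp (- 1 * b%:Z).
  by rewrite e // -[RHS]tN //; congr tau; rewrite /mx_neg !mulmx2; congr mx2; ring.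
Qed.

Lemma poly_act_p_translate (b : nat) P :
  poly_act h (mx2 1 b%:Z 0 p%:Z) P = hev h P 1 b%:R *: (1 : {poly A}).
Proof.
rewrite /poly_act /hev scaler_suml; apply: eq_bigr => i _; rewrite !mx2E.
rewrite (p_eq0 (dvdzz _)) !scale0r !addr0 -rmorphXn /= expr1n !mulr1 expr1n mulr1.
by rewrite -[in RHS]scalerA alg_polyC rmorphXn.
Qed.

Lemma poly_act_p_dilate P : poly_act h (mx2 p%:Z 0 0 1) P = P`_h *: 'X^h.
Proof.
rewrite /poly_act big_ord_recr big1 /= => [|i _]; last first.
  by rewrite !mx2E (p_eq0 (dvdzz _)) scale0r addr0 expr0n subn_eq0 leqNgt ltn_ord mulr0 scaler0.
rewrite add0r subnn expr0 mulr1 !mx2E scale1r add0r //.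
Qed.

(** Modulo [p] the matrices of T_p have rank 1: their action on [P] is evaluation at a point
    of the projective line, times a polynomial that [SL2(Z)] carries to the constant 1. *)
Lemma hecke_op_p phi D P : equivariant h Delta0 phi -> Delta0 D ->
  (forall D c P, phi D (c *: P) = c * phi D P) ->
  hecke_op h p phi D P = coset_sum p (fun M =>
     hev h P (M 0 0)%:~R (M 0 1)%:~R * phi (mx_div M D) 1).
Proof.
move=> hphi hD hZ; rewrite /hecke_op /tri_sum /coset_sum; congr (_ + _).
  by apply: eq_bigr => b _; rewrite poly_act_p_translate hZ !mx2E.
rewrite poly_act_p_dilate hZ !mx2E hev01; congr (_ * _).
have hS : SL2Z (adj2 mxS) by apply: SL2Z_adj; exact: SL2Z_S.
have dS : \det (adj2 mxS) != 0 by rewrite hS.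
have [di _ _] := hecke_mx_infty pp.
rewrite -[RHS](hphi _ hS); last exact: Delta0_mx_div.
rewrite -(mx_div_mul dS di) (_ : adj2 mxS *m _ = mx2 p%:Z 0 0 1); last first.
  by rewrite /adj2 /mxS !mx2E mulmx2; congr mx2; ring.
by rewrite poly_act1 /adj2 /mxS !mx2E add0r scale1r.
Qed.

Lemma induced0 D : induced D 0 = 0.
Proof.
have e M : induced_term D 0 M = 0.
  by rewrite /induced_term /hev big1 ?mul0r // => i _; rewrite coef0 mul0r.
by rewrite /induced /coset_sum e addr0 big1.
Qed.

Lemma inducedZ D c P : induced D (c *: P) = c * induced D P.
Proof. by rewrite -[c *: P]addr0 induced_lin induced0 addr0. Qed.

Lemma induced_Up D P : Delta0 D -> hecke_op h p induced D P = induced D P.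
Proof.
move=> hD; rewrite hecke_op_p //; last first.
- by move=> *; exact: inducedZ.
- exact: induced_equivariant.
by congr (_ + _); first (apply: eq_bigr => b _); rewrite induced_one //; exact: Delta0_mx_div.
Qed.

(** By [hecke_op_p], a fixed point of T_p is expressed by its own values at the constant
    polynomial. *)
Lemma hecke_op_p_inj phi : equivariant h Delta0 phi ->
  (forall D c P, phi D (c *: P) = c * phi D P) ->
  (forall D P, Delta0 D -> hecke_op h p phi D P = phi D P) ->
  (forall D, Delta0 D -> phi D 1 = 0) -> forall D P, Delta0 D -> phi D P = 0.
Proof.
move=> hphi hZ hU h1 D P hD; rewrite -hU // hecke_op_p // /coset_sum big1 => [|b _].
  by rewrite h1 ?mulr0 ?addr0 //; exact: Delta0_mx_div.
by rewrite h1 ?mulr0 //; exact: Delta0_mx_div.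
Qed.

(** The difference of the two sides is fixed by T_p, since T_p and T_l commute, and it
    vanishes at the constant polynomial by the hypothesis on [psi]. *)
Lemma induced_Tl l D P : prime l -> l != p ->
  (forall D, Delta0 D -> \sum_(b < l) psi (mx_div (mx2 1 b%:Z 0 l%:Z) D) +
     l%:R ^+ h * psi (mx_div (mx2 l%:Z 0 0 1) D) = (1 + l%:R ^+ h.+1) * psi D) ->
  Delta0 D -> hecke_op h l induced D P = (1 + l%:R ^+ h.+1) * induced D P.
Proof.
move=> pl lp psiT hD; set la := 1 + _.
pose X D P := hecke_op h l induced D P - la * induced D P.
have hi := induced_equivariant; have hl := hecke_op_equivariant Delta0_mx_div pl hi.
have iZ := inducedZ.
suff : X D P = 0 by move/eqP; rewrite subr_eq0 => /eqP.
apply: hecke_op_p_inj hD => [M hM E Q hE|E c Q|E Q hE|E hE].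
- by rewrite /X hl // hi.
- rewrite /X iZ mulrBr mulrCA; congr (_ - _).
  rewrite /hecke_op /tri_sum mulrDr mulr_sumr.
  have pZ M : poly_act h M (c *: Q) = c *: poly_act h M Q.
    by rewrite -[c *: Q]addr0 poly_act_lin /poly_act [X in _ + X]big1 ?addr0 // => i _; rewrite coef0 scale0r.
  by rewrite pZ iZ; congr (_ + _); apply: eq_bigr => b _; rewrite pZ iZ.
- have -> : hecke_op h p X E Q = hecke_op h p (hecke_op h l induced) E Q -
      la * hecke_op h p induced E Q.
    exact: tri_sum_sub.
  rewrite (hecke_op_comm _ Delta0_mx_div) // induced_Up // /X; congr (_ - _).
  by congr (_ + _); first (apply: eq_bigr => b _); rewrite induced_Up //; exact: Delta0_mx_div.
rewrite /X induced_one // -psiT // /hecke_op /tri_sum; apply/eqP; rewrite subr_eq0; apply/eqP.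
congr (_ + _); first (apply: eq_bigr => b _).
  by rewrite poly_act1 !mx2E scale0r addr0 expr1n induced_one //; exact: Delta0_mx_div.
rewrite poly_act1 !mx2E scale0r addr0 -rmorphXn /= -alg_polyC iZ induced_one ?pmulrn //.
exact: Delta0_mx_div.
Qed.

End Induced.

(** * The boundary symbol *)

Section Boundary.
Variables (A : comNzRingType) (h : nat).
Hypotheses (h_gt0 : (0 < h)%N) (h_even : ~~ odd h).
Implicit Types (D : divisor) (P : {poly A}) (M : 'M[int]_2) (c : cusp).

(** The symbol of the Eisenstein series: a cusp, as a primitive vector up to sign, defines
    an evaluation of forms of even degree. *)
Definition boundary_at P c : A :=
  if c is Some r then hev h P (- (denq r)%:~R) (numq r)%:~R else hev h P 0 1.

Definition boundary D P : A := div_lift (boundary_at P) D.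

Lemma boundary_cusp_of (x y : int) P : coprimez x y ->
  boundary_at P (cusp_of x y) = hev h P (- y%:~R) x%:~R.
Proof.
move=> cxy; rewrite /cusp_of; case: (eqVneq y 0) => [y0|y0].
  move: cxy; rewrite y0 /coprimez gcdz0 => /eqP hx.
  have [->|->] : x = 1 \/ x = - 1 by lia.
    by rewrite /= mulr0z oppr0.
  by rewrite /= mulr0z rmorphN /= hev_neg.
rewrite /boundary_at coprimeq_num ?coprimeq_den //.
have [yp|yn|ye] := ltrgtP y 0; last by rewrite ye eqxx in y0.
  rewrite ltr0_sg // ltr0_norm // !rmorphM !rmorphN /= mulN1r -[in RHS](opprK x%:~R).
  by rewrite -[RHS]hev_neg // !opprK.
by rewrite gtr0_sg // gtr0_norm // mul1r.
Qed.

Lemma cusp_primitive c : exists x y, coprimez x y /\ c = cusp_of x y.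
Proof.
case: c => [r|]; last by exists 1, 0; rewrite /cusp_of eqxx.
exists (numq r), (denq r); split; first exact: coprime_num_den.
by rewrite /cusp_of (negbTE (denq_neq0 r)) divq_num_den.
Qed.

Lemma boundary_at_act M P c : SL2Z M -> boundary_at (poly_act h M P) (mx_cusp M c) = boundary_at P c.
Proof.
move=> hM; have [x [y [cxy ->]]] := cusp_primitive c.
have dM : \det M != 0 by rewrite hM.
have xy0 : (x != 0) || (y != 0).
  by apply: contraLR cxy; rewrite negb_or !negbK => /andP[/eqP-> /eqP->].
rewrite mx_cusp_of // boundary_cusp_of; last first.
  have /coprimezP[[u v] /= huv] := cxy.
  apply/coprimezP; exists (u * M 1 1 - v * M 1 0, v * M 0 0 - u * M 0 1) => /=.
  transitivity (\det M * (u * x + v * y)); first by rewrite det_mx2E; ring.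
  by rewrite hM huv.
rewrite boundary_cusp_of // hev_act; have := hM; rewrite /SL2Z /= det_mx2E => hd.
have e0 : - y%:~R = - (\det M * y)%:~R :> A by rewrite hM mul1r.
have e1 : x%:~R = (\det M * x)%:~R :> A by rewrite hM mul1r.
rewrite e0 e1 det_mx2E; congr hev; rewrite !(rmorphD, rmorphM, rmorphN) /=; ring.
Qed.

Lemma boundary_equivariant : equivariant h setT boundary.
Proof.
move=> M hM D P _; rewrite /boundary.
apply: (additive_ext (f := div_lift (boundary_at (poly_act h M P)) \o mx_div M)
  (g := div_lift (boundary_at P))) => c /=.
by rewrite mx_div_pt !div_lift_pt boundary_at_act.
Qed.

(** At the cusp oo the dilation contributes 1 and each of the [l] translations contributes
    [l ^ h]. *)
Lemma boundary_Tl l D P : prime l ->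
  hecke_op h l boundary D P = (1 + l%:R ^+ h.+1) * boundary D P.
Proof.
move=> pl; have sT M D' : setT D' -> setT (mx_div M D') by [].
have heq := hecke_op_equivariant sT pl boundary_equivariant.
have hP c : hecke_op h l boundary (pt c) P = (1 + l%:R ^+ h.+1) * boundary (pt c) P.
  have [M hM <-] := cusp_matrix c; have dM : \det M = 1 by [].
  (* By equivariance it is enough to compute at oo. *)
  pose Q := poly_act h (adj2 M) P.
  have eQ : poly_act h M Q = poly_act h 1%:M P by rewrite -poly_actM mul_adj2 dM.
  rewrite -mx_div_pt -(equivariant_act1 P heq) //.
  rewrite -(equivariant_act1 P boundary_equivariant) // -eQ heq // boundary_equivariant //.
  rewrite /hecke_op /tri_sum mulrDl mul1r addrC; congr (_ + _).
    rewrite /boundary mx_div_pt !div_lift_pt /mx_cusp !mx2E eqxx /= hev_act !mx2E.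
    by rewrite !mul0r !mulr0 !addr0 mulr1 add0r.
  rewrite (eq_bigr (fun=> l%:R ^+ h * boundary (pt None) Q)) => [|b _].
    by rewrite sumr_const card_ord -mulrnAl -mulr_natl exprS.
  rewrite /boundary mx_div_pt !div_lift_pt /mx_cusp !mx2E eqxx /= hev_act !mx2E.
  by rewrite !mul0r !mul1r !add0r -hev_scale mulr0 mulr1 -pmulrn.
rewrite /boundary -div_liftZ /hecke_op /tri_sum /boundary.
rewrite (eq_bigr (fun b : 'I_l => div_lift (fun c => boundary_at
  (poly_act h (mx2 1 b%:Z 0 l%:Z) P) (mx_cusp (mx2 1 b%:Z 0 l%:Z) c)) D)); last first.
  by move=> b _; rewrite div_lift_mx.
rewrite div_lift_mx -div_lift_sum -div_liftD; apply: eq_div_lift => c.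
have := hP c; rewrite /boundary div_lift_pt => <-.
rewrite /hecke_op /tri_sum; congr (_ + _); first (apply: eq_bigr => b _).
  by rewrite mx_div_pt div_lift_pt.
by rewrite mx_div_pt div_lift_pt.
Qed.

Lemma boundary_neg D P : boundary (mx_div mx_neg D) (poly_act h mx_neg P) = boundary D P.
Proof.
rewrite /boundary div_lift_mx; apply: eq_div_lift => c.
have [x [y [cxy ->]]] := cusp_primitive c.
have dN : \det mx_neg != 0 by rewrite det_mx2.
have xy0 : (x != 0) || (y != 0).
  by apply: contraLR cxy; rewrite negb_or !negbK => /andP[/eqP-> /eqP->].
rewrite mx_cusp_of // !boundary_cusp_of //; last first.
  by move: cxy; rewrite /mx_neg !mx2E mul0r mul1r !(mul0r, add0r, addr0) mulN1r /coprimez gcdNz.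
rewrite hev_act /mx_neg !mx2E !(mul0r, mul1r, add0r, addr0, mulr0, mulr1) !mulN1r /=.
by rewrite mulrN1 opprK rmorphN /= -hev_neg // !opprK.
Qed.

Lemma boundary_infty0 : boundary (pt None - pt (Some 0)) 1 = - 1.
Proof.
rewrite /boundary raddfB /= !div_lift_pt /= !hev1 expr0n eqn0Ngt h_gt0 sub0r.
by rewrite -signr_odd (negbTE h_even).
Qed.

End Boundary.

(** * The p-adic numbers *)

Section PadicNumbers.
Variables (p : nat) (pp : prime p) (K : closedFieldType) (v : K -> rat).
Hypothesis hv : is_Qpbar p v.
Implicit Types (x y : K) (q : rat).
Local Notation O := (padic_integral v).
Local Notation m := (in_max v).

Let p_neq0 : p%:R != 0 :> K. Proof. exact: (Qpbar_p_neq0 hv). Qed.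
Let vM x y : x != 0 -> y != 0 -> v (x * y) = v x + v y. Proof. exact: (Qpbar_ordM hv). Qed.

Lemma ord1 : v 1 = 0.
Proof.
have := vM (oner_neq0 K) (oner_neq0 K); rewrite mulr1 => h.
by apply: (addrI (v 1)); rewrite addr0.
Qed.

Lemma ordN x : v (- x) = v x.
Proof.
have [->|x0] := eqVneq x 0; first by rewrite oppr0.
have n1 : (- 1 : K) != 0 by rewrite oppr_eq0 oner_eq0.
have h : v (- 1) = 0.
  have := vM n1 n1; rewrite mulrNN mulr1 ord1 => /eqP; rewrite eq_sym -mulr2n mulrn_eq0 /=.
  by move/eqP.
by rewrite -mulN1r vM // h add0r.
Qed.

Lemma ordV x : x != 0 -> v x^-1 = - v x.
Proof.
move=> x0; apply: (addrI (v x)); rewrite -vM ?invr_eq0 // divff // ord1.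
by rewrite subrr.
Qed.

Lemma ord_ge_le q r x : r <= q -> ord_ge v q x -> ord_ge v r x.
Proof. by rewrite /ord_ge; case: eqVneq => //= _; exact: le_trans. Qed.

Lemma ord_geD q x y : ord_ge v q x -> ord_ge v q y -> ord_ge v q (x + y).
Proof. exact: (Qpbar_ordD hv). Qed.

Lemma ord_geN q x : ord_ge v q (- x) = ord_ge v q x.
Proof. by rewrite /ord_ge oppr_eq0 ordN. Qed.

Lemma ord_geB q x y : ord_ge v q x -> ord_ge v q y -> ord_ge v q (x - y).
Proof. by move=> hx hy; apply: ord_geD => //; rewrite ord_geN. Qed.

Lemma ord_ge0 q : ord_ge v q 0.
Proof. by rewrite /ord_ge eqxx. Qed.

Lemma ord_geM q r x y : ord_ge v q x -> ord_ge v r y -> ord_ge v (q + r) (x * y).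
Proof.
rewrite /ord_ge mulf_eq0; case: eqVneq => //= x0; case: eqVneq => //= y0 h1 h2.
by rewrite vM // lerD.
Qed.

Lemma integral0 : O 0. Proof. exact: ord_ge0. Qed.
Lemma integral1 : O 1. Proof. by rewrite /padic_integral /ord_ge ord1 lexx orbT. Qed.
Lemma integralM x y : O x -> O y -> O (x * y).
Proof. by move=> hx hy; have := ord_geM hx hy; rewrite addr0. Qed.
Lemma integralD x y : O x -> O y -> O (x + y). Proof. exact: ord_geD. Qed.
Lemma integralN x : O (- x) = O x. Proof. exact: ord_geN. Qed.
Lemma integralB x y : O x -> O y -> O (x - y). Proof. exact: ord_geB. Qed.
Lemma integral_sum I (r : seq I) (P : pred I) F :
  (forall i, P i -> O (F i)) -> O (\sum_(i <- r | P i) F i).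
Proof. by move=> h; elim/big_ind: _ => //; [exact: integral0|exact: integralD]. Qed.
Lemma integralX x n : O x -> O (x ^+ n).
Proof.
move=> hx; elim: n => [|n IH]; first by rewrite expr0; exact: integral1.
by rewrite exprS; exact: integralM.
Qed.
Lemma integral_nat n : O n%:R.
Proof.
elim: n => [|n IH]; first exact: integral0.
by rewrite -natr1; apply: integralD => //; exact: integral1.
Qed.
Lemma integral_int (n : int) : O n%:~R.
Proof.
case: (intP n) => [|k|k]; first exact: integral0.
  exact: integral_nat.
by rewrite rmorphN integralN; exact: integral_nat.
Qed.

Lemma max_integral x : m x -> O x.
Proof. by rewrite /in_max /padic_integral /ord_ge; case: eqVneq => //= _; exact: ltW. Qed.
Lemma max0 : m 0. Proof. by rewrite /in_max eqxx. Qed.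
Lemma max_p : m p%:R. Proof. by rewrite /in_max (Qpbar_ord_p hv) ltr01 orbT. Qed.
Lemma max1 : ~~ m 1. Proof. by rewrite /in_max oner_eq0 ord1. Qed.
Lemma maxN x : m (- x) = m x. Proof. by rewrite /in_max oppr_eq0 ordN. Qed.
Lemma maxD x y : m x -> m y -> m (x + y).
Proof.
have pos z : m z -> exists2 q, 0 < q & ord_ge v q z.
  rewrite /in_max; have [->|z0] := eqVneq z 0 => /= h; first by exists 1 => //; exact: ord_ge0.
  by exists (v z) => //; rewrite /ord_ge lexx orbT.
move=> /pos[q q0 hq] /pos[r r0 hr].
have := @ord_geD (Order.min q r) x y.
rewrite (ord_ge_le _ hq) ?ge_min ?lexx // (ord_ge_le _ hr) ?ge_min ?lexx ?orbT // => /(_ isT isT).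
rewrite /ord_ge /in_max; case: eqVneq => //= _; apply: lt_le_trans.
by rewrite lt_min q0 r0.
Qed.
Lemma maxB x y : m x -> m y -> m (x - y).
Proof. by move=> hx hy; apply: maxD => //; rewrite maxN. Qed.
Lemma maxMl x y : m x -> O y -> m (x * y).
Proof.
rewrite /in_max /padic_integral /ord_ge mulf_eq0; case: eqVneq => //= x0.
by case: eqVneq => //= y0 h1 h2; rewrite vM // ltr_pwDl.
Qed.
Lemma maxMr x y : O x -> m y -> m (x * y).
Proof. by move=> hx hy; rewrite mulrC; exact: maxMl. Qed.
Lemma max_sum I (r : seq I) (P : pred I) F :
  (forall i, P i -> m (F i)) -> m (\sum_(i <- r | P i) F i).
Proof. by move=> h; elim/big_ind: _ => //; [exact: max0|exact: maxD]. Qed.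

Lemma unitP x : padic_unit v x = O x && ~~ m x.
Proof.
rewrite /padic_unit /padic_integral /ord_ge /in_max; have [//|x0] := eqVneq x 0.
by rewrite /= -leNgt andbC eq_le.
Qed.

Lemma unit_neq0 x : padic_unit v x -> x != 0.
Proof. by case/andP. Qed.

Lemma unit_div x y : padic_unit v y -> O x -> O (x / y).
Proof.
case/andP=> y0 /eqP hy hx; apply: integralM => //.
by rewrite /padic_integral /ord_ge ordV // hy oppr0 lexx orbT.
Qed.

Lemma max_prime x y : O x -> O y -> m (x * y) -> m x || m y.
Proof.
move=> hx hy; apply: contraLR; rewrite negb_or => /andP[h1 h2].
have /andP[x0 /eqP vx] : padic_unit v x by rewrite unitP hx.
have /andP[y0 /eqP vy] : padic_unit v y by rewrite unitP hy.
by rewrite /in_max mulf_eq0 (negbTE x0) (negbTE y0) vM // vx vy.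
Qed.

Lemma max_int (n : int) : m n%:~R = (p%:Z %| n)%Z.
Proof.
apply/idP/idP => [hn|/dvdzP[q ->]]; last first.
  by rewrite rmorphM /=; apply: maxMr max_p; exact: integral_int.
apply: contraT => hpn; have /coprimezP[[a b] /= hab] : coprimez p%:Z n.
  by rewrite coprimezE prime_coprime.
have := max1; rewrite -[1]/(1%:~R) -hab rmorphD !rmorphM /= => /negP[].
by apply: maxD; apply: maxMr; rewrite ?integral_int //; exact: max_p.
Qed.

Lemma max_nat (n : nat) : m n%:R = (p %| n)%N.
Proof. by have := max_int n; rewrite -pmulrn dvdzE. Qed.

Lemma unit_nat (n : nat) : ~~ (p %| n)%N -> padic_unit v n%:R.
Proof. by move=> h; rewrite unitP integral_nat max_nat h. Qed.

Lemma integral_divp x : O (x / p%:R) = ord_ge v 1 x.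
Proof.
rewrite /padic_integral /ord_ge mulf_eq0 invr_eq0 (negbTE p_neq0) orbF.
have [//|x0] /= := eqVneq x 0; rewrite vM ?invr_eq0 // ordV // (Qpbar_ord_p hv).
by rewrite subr_ge0.
Qed.

(** ** The field [Qp] as a rational vector space *)

Variable ip : {rmorphism algC -> K}.

Lemma ratrE (q : rat) : ratr q = ip (ratr q).
Proof. by rewrite fmorph_rat. Qed.

Lemma ratr_linear (a b c : rat) : ratr (a * b + c) = ratr a * ratr b + ratr c :> K.
Proof.
have e : ratr (a * b + c) = ratr a * ratr b + ratr c :> algC by rewrite rmorphD rmorphM.
by rewrite !ratrE e rmorphD rmorphM.
Qed.

Lemma Qp_rat (q : rat) : Qp v (ratr q).
Proof.
have h N : ord_ge v N (0 : K) by exact: ord_ge0.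
by exists (fun=> q) => N; exists 0%N => *; rewrite subrr.
Qed.

(** Multiplication by [q] moves the precision by the valuation of [q]. *)
Lemma Qp_lin (q : rat) x y : Qp v x -> Qp v y -> Qp v (ratr q * x + y).
Proof.
have [B hB] : exists B : nat, forall (N : nat) z, ord_ge v (N + B)%N%:R z ->
    ord_ge v N%:R (ratr q * z).
  have [->|q0] := eqVneq q 0.
    by exists 0%N => N z _; rewrite (ratr_int K 0) mul0r ord_ge0.
  exists (Num.bound `|v (ratr q)|) => N z hz.
  have hq : ord_ge v (v (ratr q)) (ratr q) by rewrite /ord_ge lexx orbT.
  apply: ord_ge_le (ord_geM hq hz).
  have hb := archi_boundP (normr_ge0 (v (ratr q))).
  have hn := ler_norm (- v (ratr q)); rewrite normrN in hn.
  by rewrite natrD; move: hb hn; set a := v _; set b := _%:R; set c := `|_|; lra.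
move=> [u hu hux] [w hw hwy].
have e a b c d : ratr q * a + b - (ratr q * c + d) = ratr q * (a - c) + (b - d) :> K by ring.
exists (fun n => q * u n + w n) => N.
  have [M1 h1] := hu (N + B)%N; have [M2 h2] := hw N.
  exists (maxn M1 M2) => i j; rewrite !geq_max => /andP[i1 i2] /andP[j1 j2].
  by rewrite !ratr_linear e; apply: ord_geD; [apply: hB; exact: h1|exact: h2].
have [M1 h1] := hux (N + B)%N; have [M2 h2] := hwy N.
exists (maxn M1 M2) => i; rewrite !geq_max => /andP[i1 i2].
by rewrite !ratr_linear e; apply: ord_geD; [apply: hB; exact: h1|exact: h2].
Qed.

Lemma Qp_int (n : int) : Qp v n%:~R. Proof. by rewrite -(ratr_int K n); exact: Qp_rat. Qed.

Lemma Qp0 : Qp v 0. Proof. exact: (Qp_int 0). Qed.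

Lemma Qp_ratM q x : Qp v x -> Qp v (ratr q * x).
Proof. by move=> hx; rewrite -[_ * x]addr0; apply: Qp_lin => //; exact: Qp0. Qed.

Lemma Qp_intM (n : int) x : Qp v x -> Qp v (n%:~R * x).
Proof. by rewrite -(ratr_int K n); exact: Qp_ratM. Qed.

Lemma QpD x y : Qp v x -> Qp v y -> Qp v (x + y).
Proof. by move=> hx hy; have := Qp_lin 1%:~R hx hy; rewrite ratr_int mul1r. Qed.

Lemma Qp_sum I (r : seq I) (P : pred I) F :
  (forall i, P i -> Qp v (F i)) -> Qp v (\sum_(i <- r | P i) F i).
Proof. by move=> h; elim/big_ind: _ => //; [exact: Qp0|exact: QpD]. Qed.

Lemma QpM x y : Qp v x -> Qp v y -> Qp v (x * y).
Proof.
have bnd z u : rat_cvg v u z -> exists B M : nat,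
    ord_ge v (- B%:R) z /\ forall n, (M <= n)%N -> ord_ge v (- B%:R) (ratr (u n)).
  move=> hu; have [M hM] := hu 0%N; exists (Num.bound `|v z|), M.
  have hz : ord_ge v (- (Num.bound `|v z|)%:R) z.
    rewrite /ord_ge; apply/orP; right; have hb := archi_boundP (normr_ge0 (v z)).
    have := ler_norm (- v z); rewrite normrN; move: hb; set c := _%:R; lra.
  split=> // n hn; rewrite -[ratr _](subrK z); apply: ord_geD => //.
  by apply: ord_ge_le (hM n hn); rewrite oppr_le0 ler0n.
move=> [u hu hux] [w hw hwy].
have [B1 [M1 [hx hB1]]] := bnd _ _ hux; have [B2 [M2 [hy hB2]]] := bnd _ _ hwy.
pose B := maxn B1 B2.
have mul_ge (N : nat) s t : ord_ge v (N + B)%N%:R s ->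
    ord_ge v (- B1%:R) t \/ ord_ge v (- B2%:R) t -> ord_ge v N%:R (s * t).
  move=> hs ht; have ht' : ord_ge v (- B%:R) t.
    by case: ht; apply: ord_ge_le; rewrite lerN2 ler_nat /B leq_max leqnn ?orbT.
  by apply: ord_ge_le (ord_geM hs ht'); rewrite natrD addrK.
have eM (q r : rat) : ratr (q * r) = ratr q * ratr r :> K.
  by have := ratr_linear q r 0; rewrite addr0 (ratr_int K 0) addr0.
exists (fun n => u n * w n) => N.
  have [M3 h3] := hu (N + B)%N; have [M4 h4] := hw (N + B)%N.
  exists (maxn (maxn M1 M2) (maxn M3 M4)) => i j; rewrite !geq_max.
  move=> /andP[/andP[i1 i2] /andP[i3 i4]] /andP[/andP[j1 j2] /andP[j3 j4]].
  have -> : ratr (u i * w i) - ratr (u j * w j) =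
      (ratr (u i) - ratr (u j)) * ratr (w i) + (ratr (w i) - ratr (w j)) * ratr (u j) :> K.
    by rewrite !eM; ring.
  apply: ord_geD; apply: mul_ge; [exact: h3|by right; exact: hB2|exact: h4|by left; exact: hB1].
have [M3 h3] := hux (N + B)%N; have [M4 h4] := hwy (N + B)%N.
exists (maxn (maxn M1 M2) (maxn M3 M4)) => i; rewrite !geq_max.
move=> /andP[/andP[i1 i2] /andP[i3 i4]].
have -> : ratr (u i * w i) - x * y =
    (ratr (u i) - x) * ratr (w i) + (ratr (w i) - y) * x by rewrite eM; ring.
by apply: ord_geD; apply: mul_ge; [exact: h3|right; exact: hB2|exact: h4|left].
Qed.

Lemma Qp_divp x : Qp v x -> Qp v (x / p%:R).
Proof.
move=> hx; rewrite mulrC (_ : p%:R^-1 = ratr p%:R^-1); first exact: Qp_ratM.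
by rewrite ratrE fmorphV /= fmorphV !rmorph_nat.
Qed.

Lemma Zp_int (n : int) : Defs.Zp v n%:~R.
Proof. by split; [exact: Qp_int|exact: integral_int]. Qed.

Lemma ZpD x y : Defs.Zp v x -> Defs.Zp v y -> Defs.Zp v (x + y).
Proof. by move=> [h1 h2] [h3 h4]; split; [exact: QpD|exact: integralD]. Qed.

Lemma Zp_intM (n : int) x : Defs.Zp v x -> Defs.Zp v (n%:~R * x).
Proof. by move=> [h1 h2]; split; [exact: Qp_intM|apply: integralM => //; exact: integral_int]. Qed.

Lemma ZpM x y : Defs.Zp v x -> Defs.Zp v y -> Defs.Zp v (x * y).
Proof. by move=> [h1 h2] [h3 h4]; split; [exact: QpM|exact: integralM]. Qed.

Lemma Zp_sum I (r : seq I) (P : pred I) F :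
  (forall i, P i -> Defs.Zp v (F i)) -> Defs.Zp v (\sum_(i <- r | P i) F i).
Proof. by move=> h; elim/big_ind: _ => //; [exact: (Zp_int 0)|exact: ZpD]. Qed.

(** ** Integer-valued polynomials *)

Lemma Pg1 g : Pg v g 1.
Proof.
split=> [|i|x _]; first by rewrite size_poly1.
  by rewrite coef1; case: eqP => _; [exact: (Qp_int 1)|exact: Qp0].
by rewrite hornerC; exact: (Zp_int 1).
Qed.

Lemma Zp_coef_Pg g (P : {poly K}) : (size P <= g.+1)%N -> (forall i, Defs.Zp v P`_i) -> Pg v g P.
Proof.
move=> sP hP; split=> // [i|x hx]; first by case: (hP i).
rewrite horner_coef; apply: Zp_sum => i _; apply: ZpM => //.
by elim: (nat_of_ord i) => [|n IH]; [exact: (Zp_int 1)|rewrite exprS; exact: ZpM].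
Qed.

Lemma int_poly_Pg g (P : {poly int}) : (size P <= g.+1)%N -> Pg v g (map_poly intr P).
Proof.
move=> sP; apply: Zp_coef_Pg => [|i]; last by rewrite coef_map; exact: Zp_int.
exact: leq_trans (size_poly _ _) sP.
Qed.

(** Newton interpolation at 0, ..., g divides by differences of these integers, which are
    units as [g < p]. *)
Lemma interpolation_integral g (P : {poly K}) : (g < p)%N -> (size P <= g.+1)%N ->
  (forall n : nat, (n <= g)%N -> O P.[n%:R]) -> forall i, O P`_i.
Proof.
elim: g P => [|g IH] P gp sP hP i.
  have := hP 0%N isT; rewrite horner_coef0; case: i => // i _.
  by rewrite nth_default ?integral0 // (leq_trans sP).
have /factor_theorem[Q hQ] : root (P - P.[g.+1%:R]%:P) g.+1%:R.
  by rewrite rootE hornerD hornerN hornerC subrr.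
have PE : P = Q * ('X - g.+1%:R%:P) + P.[g.+1%:R]%:P by rewrite -hQ subrK.
have sQ : (size Q <= g.+1)%N.
  have [->|Q0] := eqVneq Q 0; first by rewrite size_poly0.
  have := size_polyD P (- P.[g.+1%:R]%:P); rewrite hQ size_Mmonic ?monicXsubC //.
  rewrite size_XsubC addn2 /= size_polyN => h.
  by rewrite -ltnS (leq_trans h) // geq_max sP (leq_trans (size_polyC_leq1 _)).
have hQi : forall i, O Q`_i.
  apply: IH => // [|n hn]; first exact: ltnW.
  have hu : padic_unit v (n%:R - g.+1%:R).
    have -> : (n%:R - g.+1%:R : K) = - (g.+1 - n)%N%:R by rewrite natrB ?opprB // ltnW.
    rewrite unitP integralN maxN -unitP; apply: unit_nat.
    by rewrite gtnNdvd ?subn_gt0 // (leq_ltn_trans (leq_subr _ _)).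
  have -> : Q.[n%:R] = (P.[n%:R] - P.[g.+1%:R]) / (n%:R - g.+1%:R).
    rewrite {1}PE hornerD hornerM hornerD hornerN hornerX !hornerC addrK mulfK //.
    exact: unit_neq0.
  by apply: unit_div => //; apply: integralB; apply: hP => //; exact: leqW.
rewrite PE mulrBr !coefD coefN coefMX coefMC coefC.
apply: integralD; last by case: eqP => // _; [exact: hP|exact: integral0].
apply: integralB; first by case: eqP => // _; exact: integral0.
by apply: integralM => //; exact: integral_nat.
Qed.

Lemma Pg_coef_integral g (P : {poly K}) i : (g < p)%N -> Pg v g P -> O P`_i.
Proof.
move=> gp [sP _ hP]; apply: interpolation_integral gp sP _ i => n _.
by have [] := hP n%:R (Zp_int n).
Qed.

Lemma Pg_coef_Zp g (P : {poly K}) i : (g < p)%N -> Pg v g P -> Defs.Zp v P`_i.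
Proof. by move=> gp hP; split; [case: hP|exact: Pg_coef_integral gp hP]. Qed.

(** ** A residue map to the prime field *)

(** The residue field is a vector space over its prime field, so that a nonzero residue is
    detected by a linear form; the kernel of the form comes from a maximal additive subgroup
    avoiding [x0]. *)
Lemma residue_form (x0 : K) : O x0 -> ~~ m x0 -> exists lam : K -> 'F_p,
  [/\ forall x y, O x -> O y -> lam (x + y) = lam x + lam y,
      forall x, m x -> lam x = 0 & lam x0 != 0].
Proof.
move=> hx0 nx0.
pose sub (N : set K) := [/\ forall x, N x -> O x, forall x, m x -> N x,
  forall x y, N x -> N y -> N (x - y) & ~ N x0].
have sub_m : sub m.
  by split; [exact: max_integral|by []|exact: maxB|exact/negP].
have [N [[NO Nm NB Nx0] Nmax]] : exists N, sub N /\ forall N', N `<=` N' -> sub N' -> N' = N.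
  have [|N [hN hmax]] := @Zorn_bigcup K (fun N => N = set0 \/ sub N).
    move=> F hF tot; have [[N FN hN]|noN] := pselect (exists2 N, F N & sub N); last first.
      left; rewrite predeqE => x; split=> // -[N FN Nx].
      have [N0|hN] := hF _ FN; first by rewrite N0 in Nx.
      by case: noN; exists N.
    right; split.
    - move=> x [N' FN' N'x]; have [N0|[h _ _ _]] := hF _ FN'; first by rewrite N0 in N'x.
      exact: h.
    - by move=> x mx; exists N => //; case: hN => _ h _ _; exact: h.
    - move=> x y [N1 F1 N1x] [N2 F2 N2y].
      have [h1|[_ _ h1 _]] := hF _ F1; first by rewrite h1 in N1x.
      have [h2|[_ _ h2 _]] := hF _ F2; first by rewrite h2 in N2y.
      by have [h|h] := tot _ _ F1 F2; [exists N2 => //; apply: h2 => //; exact: h|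
        exists N1 => //; apply: h1 => //; exact: h].
    - move=> [N1 F1 N1x]; have [h1|[_ _ _ h1]] := hF _ F1; first by rewrite h1 in N1x.
      exact: h1.
  have hN' : sub N.
    case: hN => // N0; case: (hmax m); last by right.
    by rewrite N0; split=> // h; apply: (h 0); exact: max0.
  exists N; split=> // N' NN' sN'; apply: contrapT => ne; apply: (hmax N'); last by right.
  by split=> // h; apply: ne; rewrite eqEsubset.
have N0 : N 0 by apply: Nm; exact: max0.
have NN x : N x -> N (- x) by move=> h; rewrite -sub0r; exact: NB.
have ND x y : N x -> N y -> N (x + y) by move=> h1 h2; rewrite -[y]opprK; apply: NB => //; exact: NN.
have NMn x (k : nat) : N x -> N (x * k%:R).
  move=> h; elim: k => [|k IH]; first by rewrite mulr0.
  by rewrite -natr1 mulrDr mulr1; exact: ND.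
have NMz x (n : int) : N x -> N (x * n%:~R).
  move=> h; case: (intP n) => [|k|k]; first by rewrite mulr0.
    exact: (NMn x k.+1).
  by rewrite rmorphN mulrN; apply: (NN); exact: (NMn x k.+1).
have Np x : O x -> N (x * p%:R) by move=> hx; apply: Nm; apply: maxMr => //; exact: max_p.
have bez (t : int) : ~~ (p%:Z %| t)%Z -> exists a b : int, 1 = a%:~R * p%:R + b%:~R * t%:~R :> K.
  move=> ht; have /coprimezP[[a b] /= hab] : coprimez p%:Z t by rewrite coprimezE prime_coprime.
  by exists a, b; rewrite -[LHS]/(1%:~R) -hab rmorphD !rmorphM.
(* By maximality, adjoining [y] to [N] must reach [x0]. *)
have gen y : O y -> exists t : int, N (y - x0 * t%:~R).
  move=> hy; have [Ny|nNy] := pselect (N y); first by exists 0; rewrite mulr0 subr0.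
  pose N' := [set z : K | exists (t : int), N (z - y * t%:~R)].
  have [t ht] : N' x0.
    apply: contrapT => nx.
    have : N' = N.
      apply: Nmax => [z Nz|]; first by exists 0; rewrite mulr0 subr0.
      split=> // [z [t ht]|z mz|z z' [t ht] [t' ht']].
      - rewrite -[z](subrK (y * t%:~R)); apply: integralD; first exact: NO.
        by apply: integralM => //; exact: integral_int.
      - by exists 0; rewrite mulr0 subr0; exact: Nm.
      - exists (t - t'); rewrite rmorphB /=.
        have -> : z - z' - y * (t%:~R - t'%:~R) = (z - y * t%:~R) - (z' - y * t'%:~R) by ring.
        exact: NB.
    by move=> e; apply: nNy; rewrite -e; exists 1; rewrite mulr1 subrr.
  have /bez[a [b hab]] : ~~ (p%:Z %| t)%Z.
    apply/negP => /dvdzP[q hq]; apply: Nx0; rewrite -[x0](subrK (y * t%:~R)); apply: ND => //.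
    rewrite hq rmorphM /= mulrA; apply: Np; apply: integralM => //; exact: integral_int.
  exists b.
  have -> : y - x0 * b%:~R = y * a%:~R * p%:R - (x0 - y * t%:~R) * b%:~R.
    by rewrite -[y in LHS]mulr1 [X in y * X - _]hab; ring.
  apply: NB; last exact: NMz.
  by apply: Np; apply: integralM => //; exact: integral_int.
have uniq (y : K) (s t : int) : N (y - x0 * s%:~R) -> N (y - x0 * t%:~R) -> s%:~R = t%:~R :> 'F_p.
  move=> hs ht; apply/eqP; rewrite -subr_eq0 -rmorphB (Fp_int_eq0 pp); apply: contraT => hst.
  case: Nx0; have [a [b hab]] := bez _ hst.
  have -> : x0 = x0 * a%:~R * p%:R - ((y - x0 * s%:~R) - (y - x0 * t%:~R)) * b%:~R.
    by rewrite -[LHS]mulr1 [X in x0 * X = _]hab rmorphB /=; ring.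
  by apply: (NB); [apply: Np; apply: integralM => //; exact: integral_int|apply: NMz; exact: (NB)].
have /choice[lam hlam] : forall y, exists t : int, O y -> N (y - x0 * t%:~R).
  move=> y; have [hy|hy] := boolP (O y); last by exists 0.
  by have [t ht] := gen y hy; exists t.
(* [O / N] has order [p] and is generated by [x0]. *)
exists (fun y => (lam y)%:~R); split.
- move=> x y hx hy; rewrite -rmorphD; apply: (uniq (x + y)); first by apply: hlam; exact: integralD.
  by rewrite rmorphD /= mulrDr opprD addrACA; apply: ND; exact: hlam.
- move=> x mx; apply: (uniq x _ 0); first by apply: hlam; exact: max_integral.
  by rewrite mulr0 subr0; exact: Nm.
- rewrite (uniq x0 _ 1 (hlam x0 hx0)) ?oner_eq0 //.
  by rewrite mulr1 subrr.
Qed.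

(** ** Teichmuller representatives *)

Lemma root_of_unity_integral x n : (0 < n)%N -> x ^+ n = 1 -> O x.
Proof.
move=> n0 hx; have x0 : x != 0.
  by apply/eqP => x0; move/eqP: hx; rewrite x0 expr0n eqn0Ngt n0 eq_sym oner_eq0.
have hn k : v (x ^+ k) = v x *+ k.
  by elim: k => [|k IH]; rewrite ?expr0 ?ord1 // exprS vM ?expf_neq0 // IH mulrS.
have := hn n; rewrite hx ord1 => /esym/eqP; rewrite mulrn_eq0 eqn0Ngt n0 /= => /eqP vx.
by rewrite /padic_integral /ord_ge vx lexx orbT.
Qed.

(** The representative [t] of [a] exists because [p] divides the value at [a] of [X^(p-1) -
    1], which is a product of linear factors. Since [p] divides [t^(p-1) - a^(p-1)], and the
    cofactor of [t - a] is a unit, [p] divides [t - a]. *)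
Lemma teichmuller_close (a : nat) : coprime a p ->
  O ((a%:R / teichmuller p v a - 1) / p%:R).
Proof.
move=> cap; have pa : ~~ (p %| a)%N by rewrite -prime_coprime // coprime_sym.
have p2 := prime_gt1 pp; have p1 : (0 < p.-1)%N by lia.
have ap : O ((1 - a%:R ^+ p.-1) / p%:R : K).
  have a1 : (1 <= a ^ p.-1)%N.
    by rewrite expn_gt0 lt0n; apply/orP; left; apply: contraNneq pa => ->; rewrite dvdn0.
  have h : (p %| a ^ p.-1 - 1)%N.
    exact: dvdn_fermat.
  rewrite -natrX -opprB -[1]/(1%:R) -natrB // mulNr integralN.
  by case/dvdnP: h => q ->; rewrite natrM mulfK //; exact: integral_nat.
have [] : [set w : K | w ^+ p.-1 = 1 /\ m (w - a%:R)] (teichmuller p v a).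
  apply: xgetPex; have [r hr] := closed_field_poly_normal ('X^(p.-1) - 1 : {poly K}).
  have hroot z : z \in r -> z ^+ p.-1 = 1.
    move=> zr; have : root ('X^(p.-1) - 1) z.
      by rewrite hr rootZ ?root_prod_XsubC // lead_coef_eq0 -size_poly_eq0 size_XnsubC.
    by rewrite rootE !hornerE subr_eq0 => /eqP.
  have : m (\prod_(z <- r) (a%:R - z)).
    have := congr1 (fun P : {poly K} => P.[a%:R]) hr.
    rewrite (monicP (monicXnsubC _ p1)) scale1r horner_prod !hornerE => h.
    rewrite (eq_bigr (fun z => ('X - z%:P).[a%:R])) => [|z _]; last by rewrite !hornerE.
    by rewrite -h -opprB maxN -[X in m X](divfK p_neq0); apply: maxMr => //; exact: max_p.
  elim: r {hr} hroot => [|z r IH] hroot; first by rewrite big_nil (negbTE max1).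
  have hz w : w \in z :: r -> O (a%:R - w).
    move=> /hroot hw; apply: integralB; first exact: integral_nat.
    exact: root_of_unity_integral hw.
  rewrite big_cons => /max_prime; case/(_ (hz z (mem_head _ _)) _)/orP => [||h].
  - rewrite big_seq; elim/big_ind: _ => [||w wr]; [exact: integral1|exact: integralM|].
    by apply: hz; rewrite in_cons wr orbT.
  - by exists z; split; [apply: hroot; exact: mem_head|rewrite -opprB maxN].
  - by apply: IH h => w wr; apply: hroot; rewrite in_cons wr orbT.
move: (teichmuller p v a) => t t1 ht.
have ut : padic_unit v t.
  rewrite unitP (root_of_unity_integral p1 t1); apply/negP => mt.
  have := max1; rewrite -t1 -(prednK p1) exprS => /negP[]; apply: maxMl => //.
  by apply: integralX; exact: max_integral.
have Oa := integral_nat a; have Ot : O t by move: ut; rewrite unitP => /andP[].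
have hX k : m (t ^+ k - a%:R ^+ k).
  rewrite subrXX; apply: maxMl => //; apply: integral_sum => i _.
  by apply: integralM; exact: integralX.
pose s := \sum_(i < p.-1) t ^+ (p.-1.-1 - i) * a%:R ^+ i.
have us : padic_unit v s.
  have hs : m (s - p.-1%:R * a%:R ^+ p.-1.-1).
    have -> : p.-1%:R * a%:R ^+ p.-1.-1 =
        \sum_(i < p.-1) (a%:R ^+ (p.-1.-1 - i) * a%:R ^+ i : K).
      rewrite (eq_bigr (fun=> a%:R ^+ p.-1.-1)) => [|i _].
        by rewrite sumr_const card_ord mulr_natl.
      by rewrite -exprD subnK //; have := ltn_ord i; lia.
    rewrite /s -sumrB; apply: max_sum => i _; rewrite -mulrBl.
    by apply: maxMl => //; exact: integralX.
  rewrite unitP; apply/andP; split.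
    by apply: integral_sum => i _; apply: integralM; exact: integralX.
  apply/negP => ms; have := maxB ms hs; rewrite opprB addrC subrK -natrX -natrM max_nat.
  rewrite Euclid_dvdM // gtnNdvd //; last by lia.
  by apply/negP; apply: contra pa; rewrite Euclid_dvdX // => /andP[].
have -> : (a%:R / t - 1) / p%:R = (- ((1 - a%:R ^+ p.-1) / p%:R) / s) / t.
  have e : 1 - a%:R ^+ p.-1 = (t - a%:R) * s by have := subrXX t a%:R p.-1; rewrite t1.
  rewrite e; have s0 := unit_neq0 us; have t0 := unit_neq0 ut.
  by field; rewrite p_neq0 t0 s0.
by do 2!apply: unit_div => //; rewrite integralN.
Qed.

End PadicNumbers.

(** * Lifting symbols modulo [p] *)

Section Lift.
Variables (p : nat) (pp : prime p) (K : closedFieldType) (v : K -> rat).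
Hypothesis hv : is_Qpbar p v.
Variable ip : {rmorphism algC -> K}.
Variables (h : nat) (hp : (h < p)%N).
Implicit Types (al be : {poly K} -> K) (D : divisor) (M : 'M[int]_2).

Definition int_form (n : nat -> int) (P : {poly K}) : K := \sum_(i < h.+1) P`_i * (n i)%:~R.

(** Forms over the prime field are lifted through their values at the monomials. As [h < p],
    the monomials generate the integer-valued polynomials, so that forms with the same
    reduction are congruent in the dual ([reduces_eq]). *)
Definition reduces_to al (Ps : {poly 'F_p} -> 'F_p) := exists2 n : nat -> int,
  forall P, al P = int_form n P & forall i, (i <= h)%N -> (n i)%:~R = Ps 'X^i.

Lemma int_form_Pg_dual n : Pg_dual v h (int_form n).
Proof.
split=> [P hP|c P Q _ _ _].
  apply: (Zp_sum hv ip) => i _; rewrite mulrC; apply: (Zp_intM hv ip).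
  exact: (Pg_coef_Zp pp hv _ hp hP).
rewrite /int_form mulr_sumr -big_split; apply: eq_bigr => i _ /=.
by rewrite coefD coefZ mulrDl mulrA.
Qed.

Lemma reduces_Pg_dual al Ps : reduces_to al Ps -> Pg_dual v h al.
Proof.
by case=> n hal _; rewrite (_ : al = int_form n); [exact: int_form_Pg_dual|exact/funext].
Qed.

Lemma reduces_eq al be Ps : reduces_to al Ps -> reduces_to be Ps -> eq_Pg_dual_mod p v h al be.
Proof.
move=> [n hal hn] [n' hbe hn'].
exists (int_form (fun i => divz (n i - n' i) p%:Z)); first exact: int_form_Pg_dual.
move=> P _; rewrite hal hbe /int_form -sumrB mulr_sumr; apply: eq_bigr => i _.
have hi : (i <= h)%N by rewrite -ltnS.
have : (p%:Z %| n i - n' i)%Z by rewrite -(Fp_int_eq0 pp) rmorphB /= hn // hn' // subrr.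
move/divzK; move: (divz _ _) => q hq; rewrite -mulrBr -rmorphB /= -hq rmorphM /= -pmulrn.
by ring.
Qed.

Lemma reduces_ext al be Ps Ps' : (forall P, be P = al P) ->
  (forall i, (i <= h)%N -> Ps' 'X^i = Ps 'X^i) -> reduces_to al Ps -> reduces_to be Ps'.
Proof. by move=> h1 h2 [n hal hn]; exists n => [P|i hi]; [rewrite h1 hal|rewrite h2 // hn]. Qed.

Lemma reducesD al be Ps Ps' : reduces_to al Ps -> reduces_to be Ps' ->
  reduces_to (fun P => al P + be P) (fun P => Ps P + Ps' P).
Proof.
move=> [n hal hn] [n' hbe hn']; exists (fun i => n i + n' i) => [P|i hi].
  by rewrite hal hbe /int_form -big_split; apply: eq_bigr => i _ /=; rewrite rmorphD mulrDr.
by rewrite rmorphD /= hn // hn'.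
Qed.

Lemma reduces0 : reduces_to (fun=> 0) (fun=> 0).
Proof. by exists (fun=> 0) => // P; rewrite /int_form big1 // => i _; rewrite mulr0. Qed.

Lemma reduces_sum l (al : nat -> {poly K} -> K) (Ps : nat -> {poly 'F_p} -> 'F_p) :
  (forall b, (b < l)%N -> reduces_to (al b) (Ps b)) ->
  reduces_to (fun P => \sum_(b < l) al b P) (fun P => \sum_(b < l) Ps b P).
Proof.
elim: l => [|l IH] hb.
  by apply: reduces_ext reduces0 => [P|i _]; rewrite big_ord0.
apply: reduces_ext (reducesD (IH _) (hb l (ltnSn l))) => [P|i _|b hbl].
- by rewrite big_ord_recr.
- by rewrite big_ord_recr.
- by apply: hb; exact: ltnW.
Qed.

Lemma reduces_natmul al Ps (n : nat) : reduces_to al Ps ->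
  reduces_to (fun P => al P *+ n) (fun P => n%:R * Ps P).
Proof.
move=> hr; elim: n => [|n IH].
  by apply: reduces_ext reduces0 => *; rewrite ?mulr0n ?mul0r.
apply: reduces_ext (reducesD hr IH) => [P|i _]; first by rewrite mulrS.
by rewrite -natr1 mulrDl mul1r addrC.
Qed.

Definition linear_form (Ps : {poly 'F_p} -> 'F_p) :=
  forall c P Q, Ps (c *: P + Q) = c * Ps P + Ps Q.

Lemma linear_form_coef Ps (Q : {poly 'F_p}) : linear_form Ps -> (size Q <= h.+1)%N ->
  Ps Q = \sum_(i < h.+1) Q`_i * Ps 'X^i.
Proof.
move=> hPs sQ; have P0 : Ps 0 = 0.
  by have := hPs (- 1) 0 0; rewrite scaler0 add0r mulN1r addNr.
have QE : Q = \sum_(i < h.+1) Q`_i *: 'X^i.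
  rewrite -[LHS]coefK poly_def (big_ord_widen h.+1 (fun i => Q`_i *: 'X^i)) //.
  rewrite big_mkcond; apply: eq_bigr => i _ /=; case: ltnP => // hi.
  by rewrite nth_default // scale0r.
by rewrite [in LHS]QE; elim/big_rec2: _ => [//|i u w _ e]; rewrite hPs e.
Qed.

Lemma reduces_act al Ps M : linear_form Ps -> reduces_to al Ps ->
  reduces_to (fun P => al (poly_act h M P)) (fun P => Ps (poly_act h M P)).
Proof.
move=> hPs [n hal hn].
pose c i j := (poly_act h M ('X^i : {poly int}))`_j.
have hc (R : comNzRingType) i j : (poly_act h M ('X^i : {poly R}))`_j = (c i j)%:~R.
  rewrite /c -[RHS](coef_map intr) poly_act_map; congr (nth _ (polyseq (poly_act h M _)) _).
  by rewrite rmorphXn /= map_polyX.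
exists (fun i => \sum_(j < h.+1) c i j * n j) => [P|i hi].
  rewrite hal /int_form.
  have -> : poly_act h M P = \sum_(i < h.+1) P`_i *: poly_act h M 'X^i.
    rewrite /poly_act; apply: eq_bigr => i _; congr (_ *: _).
    rewrite (bigD1 i) //= coefXn eqxx scale1r big1 ?addr0 // => j hj.
    by rewrite coefXn (_ : (_ == _) = (j == i)) // (negbTE hj) scale0r.
  under eq_bigr => j _ do rewrite coef_sum mulr_suml.
  rewrite exchange_big; apply: eq_bigr => i _ /=.
  rewrite rmorph_sum mulr_sumr; apply: eq_bigr => j _ /=.
  by rewrite coefZ hc rmorphM mulrA.
rewrite (linear_form_coef hPs (size_poly_act _ _ _)) rmorph_sum; apply: eq_bigr => j _ /=.
by rewrite hc rmorphM /= hn // -ltnS.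
Qed.

Variable Psi : divisor -> {poly 'F_p} -> 'F_p.
Hypothesis PsiL : forall D, linear_form (Psi D).

Definition lift_symbol : symbol K := fun D P =>
  \sum_(i < h.+1) P`_i * (nat_of_ord (Psi D 'X^i))%:R.

Lemma lift_reduces D : reduces_to (lift_symbol D) (Psi D).
Proof.
exists (fun i => (nat_of_ord (Psi D 'X^i))%:Z) => [P|i hi]; first by [].
by rewrite (Fp_valz (Psi D 'X^i)).
Qed.

Lemma slash_lift_reduces D M :
  reduces_to (slash h lift_symbol M D) (fun P => Psi (mx_div M D) (poly_act h M P)).
Proof. exact: reduces_act (lift_reduces _). Qed.

Lemma hecke_lift_reduces l D : reduces_to (hecke h l lift_symbol D) (hecke_op h l Psi D).
Proof.
have := reducesD (reduces_sum (fun b (_ : (b < l)%N) => slash_lift_reduces D (mx2 1 b%:Z 0 l%:Z)))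
  (slash_lift_reduces D (mx2 l%:Z 0 0 1)).
apply: reduces_ext => [P|i _] //.
by rewrite /hecke; congr (_ + _); rewrite !fct_sumE.
Qed.

Lemma symbol_mulrn (phi : symbol K) n D P : (phi *+ n) D P = phi D P *+ n.
Proof. by elim: n => [|n IH]; rewrite ?mulr0n // !mulrS -IH. Qed.

Lemma symbol_mulrz (phi : symbol K) (n : int) D P : (phi *~ n) D P = phi D P *~ n.
Proof.
case: (intP n) => [|k|k]; first by rewrite !mulr0z.
  by rewrite -!pmulrn symbol_mulrn.
by rewrite !mulrNz -!pmulrn -symbol_mulrn.
Qed.

(** Each condition is a congruence between forms with the same reduction. *)
Lemma lift_eigen :
  (forall D E, Delta0 D -> Delta0 E -> forall P, Psi (D + E) P = Psi D P + Psi E P) ->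
  equivariant h Delta0 Psi ->
  (forall D P, Delta0 D -> Psi (mx_div mx_neg D) (poly_act h mx_neg P) = Psi D P) ->
  (forall l D P, prime l -> l != p -> Delta0 D ->
     hecke_op h l Psi D P = (1 + l%:R ^+ h.+1) * Psi D P) ->
  (forall D P, Delta0 D -> hecke_op h p Psi D P = Psi D P) ->
  H1c_plus_eis p v h.+2 lift_symbol.
Proof.
move=> PsiA PsiE PsiN PsiT PsiU; have h2 : (h.+2 - 2)%N = h by rewrite subn2.
rewrite /H1c_plus_eis /= h2; split.
- split; last first.
    move=> D hD; apply: reduces_eq (lift_reduces D).
    by apply: reduces_ext (slash_lift_reduces D _) => // i _; rewrite PsiN.
  split=> [D _|D E hD hE|M hM D hD]; first exact: reduces_Pg_dual (lift_reduces D).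
    apply: reduces_eq (lift_reduces _) _.
    by apply: reduces_ext (reducesD (lift_reduces D) (lift_reduces E)) => // i _; rewrite PsiA.
  apply: reduces_eq (lift_reduces D).
  by apply: reduces_ext (slash_lift_reduces D _) => // i _; rewrite PsiE.
- move=> l pl lp D hD; apply: reduces_eq (hecke_lift_reduces l D) _.
  apply: reduces_ext (reduces_natmul (1 + l ^ h.+1) (lift_reduces D)) => [P|i _].
    exact: symbol_mulrn.
  by rewrite PsiT // natrD natrX.
- move=> D hD; apply: reduces_eq (hecke_lift_reduces p D) _.
  by apply: reduces_ext (lift_reduces D) => // i _; rewrite PsiU.
Qed.

End Lift.

Lemma eq_Pg_dual_mod_max (p : nat) (K : closedFieldType) (v : K -> rat) g al be P :
  is_Qpbar p v -> eq_Pg_dual_mod p v g al be -> Pg v g P -> in_max v (al P - be P).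
Proof.
move=> hv [ga [hga _] e] hP; rewrite e //; apply: (maxMl hv); first exact: (max_p hv).
by case: (hga P hP).
Qed.

(** Modulo [p] both symbols are integer multiples of one generator. It does not vanish where
    [Bs] does not, so the multiple that gives [Ph] is zero modulo [p]. *)
Lemma mult_one_vanish (p : nat) (pp : prime p) (K : closedFieldType) (v : K -> rat) j0
    (Bs Ph : symbol K) D0 P0 D P :
  is_Qpbar p v -> mult_one_mod_p p v j0 ->
  H1c_plus_eis p v j0 Bs -> H1c_plus_eis p v j0 Ph ->
  Delta0 D0 -> Pg v (j0 - 2) P0 -> ~~ in_max v (Bs D0 P0) -> in_max v (Ph D0 P0) ->
  Delta0 D -> Pg v (j0 - 2) P -> in_max v (Ph D P).
Proof.
move=> hv [e [he hspan _]] hB hP hD0 hP0 nB mP hD hPg.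
pose e0 := e ord0.
have ev (x : symbol K) : H1c_plus_eis p v j0 x -> exists c : int, forall E Q,
    Delta0 E -> Pg v (j0 - 2) Q -> in_max v (x E Q - e0 E Q * c%:~R).
  move=> /hspan[c hc]; exists (c ord0) => E Q hE hQ.
  have := eq_Pg_dual_mod_max hv (hc E hE) hQ.
  have -> : x - \sum_i e i *~ c i = x - e0 *~ c ord0 by rewrite big_ord1.
  have -> : (x - e0 *~ c ord0) E Q = x E Q - (e0 *~ c ord0) E Q by [].
  by rewrite symbol_mulrz mulrzr subr0.
have Kint E Q : Delta0 E -> Pg v (j0 - 2) Q -> padic_integral v (e0 E Q).
  move=> hE hQ; have [[[hd _ _] _] _ _] := he ord0.
  by have [h _] := hd E hE; case: (h Q hQ).
have [b hb] := ev _ hB; have [c hc] := ev _ hP.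
have me : ~~ in_max v (e0 D0 P0).
  apply: contra nB => h; rewrite -[X in in_max v X](subrK (e0 D0 P0 * b%:~R)).
  by apply: (maxD hv); [exact: hb|apply: (maxMl hv) => //; exact: (integral_int hv)].
have : in_max v (c%:~R : K).
  have : in_max v (e0 D0 P0 * c%:~R).
    rewrite -[X in in_max v X](subKr (Ph D0 P0)); apply: (maxB hv) => //; exact: hc.
  by case/(max_prime hv (Kint _ _ hD0 hP0) (integral_int hv c))/orP => // h; rewrite h in me.
move=> mc; rewrite -[X in in_max v X](subrK (e0 D P * c%:~R)).
by apply: (maxD hv); [exact: hc|apply: (maxMr hv) => //; exact: Kint].
Qed.

(** ** Vanishing of symbols with constant values *)

Section Vanish.
Variables (p : nat) (pp : prime p) (K : closedFieldType) (v : K -> rat).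
Hypothesis hv : is_Qpbar p v.
Variable ip : {rmorphism algC -> K}.
Variables (h : nat) (hp : (h < p)%N) (h_gt0 : (0 < h)%N) (h_even : ~~ odd h).
Variable psi : {additive divisor -> 'F_p}.

(** The symbol induced from [psi] lies in the same line as the boundary symbol, which takes
    the value -1 at [oo - 0]. *)
Lemma constant_symbol_vanish :
  mult_one_mod_p p v h.+2 ->
  (forall D, Delta0 D -> \sum_(b < p) psi (mx_div (mx2 1 b%:Z 0 p%:Z) D) = psi D) ->
  (forall M D, Gamma0 p M -> Delta0 D -> (M 0 0)%:~R ^+ h * psi (mx_div M D) = psi D) ->
  (forall D, Delta0 D -> psi (mx_div mx_neg D) = psi D) ->
  (forall l D, prime l -> l != p -> Delta0 D ->
     \sum_(b < l) psi (mx_div (mx2 1 b%:Z 0 l%:Z) D) +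
     l%:R ^+ h * psi (mx_div (mx2 l%:Z 0 0 1) D) = (1 + l%:R ^+ h.+1) * psi D) ->
  psi (pt None - pt (Some 0)) = 0 ->
  forall D, Delta0 D -> psi D = 0.
Proof.
move=> m1 psiU psiG psiN psiT psi0.
have pF : p%:R = 0 :> 'F_p by apply/eqP; rewrite (Fp_nat_eq0 pp).
have h2 : (h.+2 - 2)%N = h by rewrite subn2.
have mF (x : 'F_p) : in_max v ((nat_of_ord x)%:R : K) = (x == 0).
  by rewrite (max_nat pp hv) -(Fp_nat_eq0 pp) (Fp_val x).
have liftE Psi D : @lift_symbol p K h Psi D 1 = (nat_of_ord (Psi D 1))%:R.
  rewrite /lift_symbol big_ord_recl big1 ?addr0 => [|i _]; last by rewrite coef1 mul0r.
  by rewrite coef1 mul1r expr0.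
have hB : H1c_plus_eis p v h.+2 (@lift_symbol p K h (@boundary 'F_p h)).
  apply: (lift_eigen pp hv ip hp) => [D c P Q|D E _ _ P||D P _|l D P pl _ _|D P _].
  - by rewrite /boundary -div_liftZ -div_liftD; apply: eq_div_lift => -[r|] /=; rewrite hev_lin.
  - by rewrite /boundary raddfD.
  - by move=> M hM D P _; exact: boundary_equivariant.
  - exact: boundary_neg.
  - exact: boundary_Tl.
  - by rewrite boundary_Tl // pF expr0n /= addr0 mul1r.
have hP : H1c_plus_eis p v h.+2 (@lift_symbol p K h (induced p h psi)).
  apply: (lift_eigen pp hv ip hp) => [D c P Q|D E _ _ P||D P hD|l D P pl lp hD|D P hD].
  - exact: induced_lin.
  - exact: inducedD.
  - exact: (induced_equivariant pp pF psiG).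
  - exact: (induced_neg pp pF h_even psiG psiN).
  - by apply: (induced_Tl pp pF) => // E hE; exact: psiT.
  - exact: (induced_Up pp pF).
move=> D hD; apply/eqP; rewrite -mF -(induced_one h_gt0 psiU hD) -liftE.
have P1 : Pg v (h.+2 - 2) 1 by exact: (Pg1 hv).
apply: (mult_one_vanish pp hv m1 hB hP (Delta0_ptB None (Some 0)) P1 _ _ hD P1).
- by rewrite liftE mF boundary_infty0 // oppr_eq0 oner_eq0.
- by rewrite liftE mF induced_one ?psi0 //; exact: Delta0_ptB.
Qed.

End Vanish.

(** ** Weight two *)

(** In weight two there is no nonzero symbol: [SL2(Z)] is generated by the stabiliser of oo
    and [mxS], which reverses the path from 0 to oo, and 2 is invertible modulo [p]. *)
Lemma mult_one_weight2 (p : nat) (K : closedFieldType) (v : K -> rat)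
  (ip : {rmorphism algC -> K}) : prime p -> (2 < p)%N -> is_Qpbar p v -> ~ mult_one_mod_p p v 2.
Proof.
move=> pp p2 hv [e [he _ hfree]].
have [[[hd hadd hinv] _] _ _] := he ord0; rewrite subnn in hd hadd hinv.
pose phi := e ord0; rewrite -/phi in hd hadd hinv.
suff phi0 D Q : Delta0 D -> Pg v 0 Q -> Defs.Zp v (phi D Q / p%:R).
  suff : null_symbol p v (2 - 2) (\sum_i e i *~ 1).
    by move=> /(hfree (fun=> 1))/(_ ord0); rewrite dvdzE /= dvdn1 => /eqP p1; rewrite p1 in p2.
  rewrite big_ord1 mulr1z subnn -/phi => D hD.
  exists (fun Q => phi D Q / p%:R); last first.
    move=> Q _; rewrite (_ : (0 : symbol K) D Q = 0) // subr0 mulrC divfK //.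
    exact: (Qpbar_p_neq0 hv).
  split=> [Q hQ|c P Q hc hP hQ]; first exact: phi0.
  by have [_ ->] := hd D hD; rewrite // mulrDl mulrA.
move=> hD hQ; pose pZ x := Defs.Zp v (x / p%:R); rewrite -/(pZ _).
have p0 : p%:R != 0 :> K := Qpbar_p_neq0 hv.
have pZD x y : pZ x -> pZ y -> pZ (x + y).
  by move=> hx hy; rewrite /pZ mulrDl; exact: (ZpD hv ip).
have pZM (n : int) x : pZ x -> pZ (n%:~R * x).
  by move=> hx; rewrite /pZ -mulrA; exact: (Zp_intM hv ip).
have pZB x y : pZ x -> pZ y -> pZ (x - y).
  by move=> hx hy; apply: (pZD) => //; rewrite -mulN1r; exact: (pZM (- 1)).
have eqm al be : eq_Pg_dual_mod p v 0 al be -> pZ (al Q - be Q).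
  by move=> [ga [hga _] ->] //; rewrite /pZ mulrC mulKf //; exact: hga.
have phiD E E' : Delta0 E -> Delta0 E' -> pZ (phi (E + E') Q - (phi E Q + phi E' Q)).
  by move=> hE hE'; exact: (eqm _ _ (hadd E E' hE hE')).
have actQ M : poly_act 0 M Q = Q.
  have [sQ _ _] := hQ; rewrite /poly_act big_ord1 !expr0 mulr1 alg_polyC.
  by rewrite [RHS]size1_polyC.
have phiM M E : SL2Z M -> Delta0 E -> pZ (phi (mx_div M E) Q - phi E Q).
  by move=> hM hE; have := eqm _ _ (hinv M hM E hE); rewrite /slash actQ.
have phi00 : pZ (phi 0 Q).
  have := phiD 0 0 Delta0_0 Delta0_0; rewrite addr0 opprD addNKr => h.
  by rewrite -[phi 0 Q]opprK -mulN1r; exact: (pZM (- 1)).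
have phiDD E E' : Delta0 E -> Delta0 E' -> pZ (phi E Q) -> pZ (phi E' Q) -> pZ (phi (E + E') Q).
  move=> hE hE' h1 h2; rewrite -[phi _ _](subrK (phi E Q + phi E' Q)).
  by apply: (pZD); [exact: phiD|exact: pZD].
have phiNN E : Delta0 E -> pZ (phi E Q) -> pZ (phi (- E) Q).
  move=> hE h1; have := phiD _ _ hE (Delta0N hE); rewrite subrr => h2.
  have -> : phi (- E) Q = phi 0 Q - phi E Q - (phi 0 Q - (phi E Q + phi (- E) Q)) by ring.
  by apply: (pZB) => //; exact: pZB.
have phiMM M E : SL2Z M -> Delta0 E -> pZ (phi E Q) -> pZ (phi (mx_div M E) Q).
  move=> hM hE h1; rewrite -[phi _ _](subrK (phi E Q)).
  by apply: (pZD) => //; exact: phiM.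
pose E M := pZ (phi (pt (mx_cusp M None) - pt None) Q).
apply: (Delta0_ind (Pr := fun D => pZ (phi D Q))) hD => // c.
have [M hM <-] := cusp_matrix c; rewrite -/(E M); move: M hM.
apply: SL2Z_ind => [|||M N hM hN hE1 hE2].
- have eS : mx_cusp mxS None = Some 0 by rewrite /mx_cusp /mxS !mx2E oppr_eq0 oner_eq0 mul0r.
  have eS0 : mx_cusp mxS (Some 0) = None by rewrite /mx_cusp /mxS !mx2E mulr0 add0r eqxx.
  rewrite /E eS; set D0 := pt _ - pt _; have hD0 : Delta0 D0 by exact: Delta0_ptB.
  have SD0 : mx_div mxS D0 = - D0 by rewrite raddfB /= !mx_div_pt eS eS0 opprB.
  have h1 := phiM _ _ SL2Z_S hD0; rewrite SD0 in h1.
  have := phiD _ _ hD0 (Delta0N hD0); rewrite subrr => h2.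
  have h3 : pZ (2%:~R * phi D0 Q).
    have -> : 2%:~R * phi D0 Q = phi 0 Q - (phi 0 Q - (phi D0 Q + phi (- D0) Q)) -
      (phi (- D0) Q - phi D0 Q) by ring.
    by apply: (pZB) => //; exact: pZB.
  (* [(p + 1) / 2] is an inverse of 2 modulo [p]. *)
  have -> : phi D0 Q = (p.+1./2)%:~R * (2%:~R * phi D0 Q) - p%:R * phi D0 Q.
    have op : odd p by case: (even_prime pp) => // e2; rewrite e2 in p2.
    have e1 : (p.+1./2)%:R * 2 = p%:R + 1 :> K.
      by rewrite natr1 -natrM muln2 -[in RHS](odd_double_half p.+1) /= op.
    by rewrite mulrA -pmulrn (_ : 2%:~R = 2) // e1; ring.
  apply: (pZB); first exact: pZM.
  by rewrite /pZ mulrC mulKf //; have [hz _] := hd D0 hD0; exact: hz.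
- by rewrite /E /mx_cusp /mxT !mx2E eqxx subrr.
- by rewrite /E /mx_cusp /adj2 /mxT !mx2E oppr0 eqxx subrr.
have dM : \det M != 0 by rewrite hM.
have dN : \det N != 0 by rewrite hN.
rewrite /E mx_cuspM // (_ : pt _ - pt None = mx_div M (pt (mx_cusp N None) - pt None) +
  (pt (mx_cusp M None) - pt None)); last by rewrite raddfB /= !mx_div_pt addrA subrK.
apply: phiDD => //; [|exact: Delta0_ptB|]; first by apply: Delta0_mx_div; exact: Delta0_ptB.
by apply: phiMM => //; exact: Delta0_ptB.
Qed.

(** * The relations between the values of the normalised symbol *)

Lemma div_lift_const (G : zmodType) (f g : cusp -> G) (C0 : G) D :
  (forall c, f c = g c + C0) -> Delta0 D -> div_lift f D = div_lift g D.
Proof.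
move=> fg hD; apply: (Delta0_ext (f := div_lift f) (g := div_lift g) (C := C0)) => // c.
by rewrite /= !div_lift_pt.
Qed.

Lemma poly_act_neg (A : comNzRingType) g (P : {poly A}) : ~~ odd g -> (size P <= g.+1)%N ->
  poly_act g mx_neg P = P \Po (- 'X).
Proof.
move=> hg sP; rewrite poly_actE /mx_neg !mx2E mulrN1z !scale0r scale1r addr0 add0r polyCN.
by rewrite -[X in hev _ _ _ X]opprK hev_neg // hev_horner ?size_map_polyC.
Qed.

Section Symbol.
Variables (R : realType) (p k : nat) (K : closedFieldType) (v : K -> rat).
Variables (iinf : {rmorphism algC -> R[i]}) (ip : {rmorphism algC -> K}).
Variables (F : R[i] -> R[i]) (a : nat -> algC) (Om : R[i]).
Local Notation C := R[i].
Hypotheses (pp : prime p) (k2 : (2 <= k)%N) (k_even : ~~ odd k).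
Hypotheses (hc : cusp_form p k F) (hq : q_expansion F (fun n => iinf (a n))).
Hypothesis hU : forall n, a (p * n)%N = a p * a n.
Hypothesis hT : forall l n, prime l -> l != p ->
  a (l * n)%N + (if (l %| n)%N then l%:R ^+ k.-1 * a (n %/ l)%N else 0) = a l * a n.
Hypothesis ap0 : a p != 0.
Hypothesis hO : canonical_period v iinf ip k F Om.
Implicit Types (D : divisor) (M : 'M[int]_2) (P Q : {poly R[i]}).

Let hUC n : iinf (a (p * n)%N) = iinf (a p) * iinf (a n). Proof. by rewrite hU rmorphM. Qed.
Let hTC l n : prime l -> l != p ->
  iinf (a (l * n)%N) + (if (l %| n)%N then l%:R ^+ k.-1 * iinf (a (n %/ l)%N) else 0) =
  iinf (a l) * iinf (a n).
Proof.
move=> pl lp; rewrite -rmorphM -hT // rmorphD; congr (_ + _).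
by case: ifP => _; rewrite ?rmorph0 // rmorphM rmorphXn rmorph_nat.
Qed.
Let apC : iinf (a p) != 0. Proof. by rewrite fmorph_eq0. Qed.
Let g_even : ~~ odd (k - 2). Proof. by rewrite oddB // (negbTE k_even). Qed.
Let kE : k.-1 = (k - 2).+1. Proof. by lia. Qed.
Let p0 : p%:Z != 0. Proof. by rewrite eqz_nat -lt0n prime_gt0. Qed.
Let p1 (e : int) : e = 1 \/ e = - 1 -> ~~ (p%:Z %| e)%Z.
Proof. by move=> he; rewrite dvdzE /= (_ : `|e|%N = 1%N) ?dvdn1 ?neq_ltn ?prime_gt1 ?orbT //; case: he => ->. Qed.
Let dN : \det mx_neg != 0. Proof. by rewrite det_mx2. Qed.
Let dU (b n : int) : n != 0 -> \det (mx2 1 b 0 n) != 0.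
Proof. by rewrite det_mx2 mul1r mulr0 subr0. Qed.
Let dD (n : int) : n != 0 -> \det (mx2 n 0 0 1) != 0.
Proof. by rewrite det_mx2 mulr1 mul0r subr0. Qed.

Lemma xiE D P : xi F D P = div_lift (Xi F P) D.
Proof. by []. Qed.

Lemma xi_lin b P Q D : (size P <= k.-1)%N -> (size Q <= k.-1)%N ->
  xi F D (b *: P + Q) = b * xi F D P + xi F D Q.
Proof.
move=> sP sQ; rewrite !xiE -div_liftZ -div_liftD; apply: eq_div_lift => c.
exact: (Xi_lin pp hq hc hUC apC k2).
Qed.

Lemma xi_Up (e : int) P D : ~~ (p%:Z %| e)%Z -> (size P <= k.-1)%N -> Delta0 D ->
  \sum_(b < p) xi F (mx_div (mx2 1 (e * b%:Z) 0 p%:Z) D) (P \Po (p%:R *: 'X - (e * b%:Z)%:~R%:P)) =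
  iinf (a p) * xi F D P.
Proof.
move=> he sP hD; have [C0 hC0] := Xi_Up pp hq hc hUC apC k2 he sP.
rewrite xiE -div_liftZ -(div_lift_const hC0 hD) div_lift_sum; apply: eq_bigr => b _.
by rewrite xiE div_lift_mx.
Qed.

Lemma xi_Tl l (e : int) D : prime l -> l != p -> ~~ (l%:Z %| e)%Z -> Delta0 D ->
  \sum_(b < l) xi F (mx_div (mx2 1 (e * b%:Z) 0 l%:Z) D) 1 +
  l%:R ^+ (k - 2) * xi F (mx_div (mx2 l%:Z 0 0 1) D) 1 = iinf (a l) * xi F D 1.
Proof.
move=> pl lp he hD; have [C0 hC0] := Xi_Tl pp hq hc hUC apC k2 pl he (fun n => hTC n pl lp).
rewrite [in RHS]xiE -[RHS]div_liftZ -(div_lift_const hC0 hD) div_liftD div_liftZ div_lift_sum.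
rewrite [xi _ (mx_div (mx2 l%:Z _ _ _) _) _]xiE [in LHS]div_lift_mx.
by congr (_ + _); apply: eq_bigr => b _; rewrite xiE div_lift_mx.
Qed.

(** The polynomial [(a - c z)^(k-2)]. As [a - c (M z) = 1 / (c z + d)], it is carried to 1
    by [M]. *)
Definition denom_poly (A : comNzRingType) M : {poly A} :=
  ((M 0 0)%:~R%:P - (M 1 0)%:~R *: 'X) ^+ (k - 2).

Lemma size_denom_poly (A : comNzRingType) M : (size (denom_poly A M) <= k.-1)%N.
Proof. by rewrite kE /denom_poly -scaleNr; exact: size_linear_exp. Qed.

Lemma xi_Gamma0 M D : Gamma0 p M -> Delta0 D -> xi F (mx_div M D) (denom_poly _ M) = xi F D 1.
Proof.
move=> hM hD; have s1 : (size (1%R : {poly C}) <= k.-1)%N by rewrite size_poly1 kE.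
have dM : \det M = 1 by case: hM.
have h z : upper z -> autfactor M z ^+ (k - 2) * (denom_poly C M).[mx_upper M z] = 1.[z].
  move=> hz; rewrite /denom_poly horner_exp hornerD hornerN hornerZ hornerX !hornerC -exprMn.
  rewrite -[RHS](expr1n _ (k - 2)); congr (_ ^+ _).
  have h0 : autfactor M z != 0 by rewrite autfactor_neq0 // dM.
  have hd : (M 0 0)%:~R * (M 1 1)%:~R - (M 0 1)%:~R * (M 1 0)%:~R = 1 :> C.
    by rewrite -!intrM -rmorphB /= -det_mx2E dM.
  by rewrite -[RHS]hd; move: h0; rewrite /mx_upper /autfactor => h0; field.
have [C0 hC0] := Xi_Gamma0 pp hq hc hUC apC k2 hM s1 (size_denom_poly C M) h.
by rewrite !xiE div_lift_mx; exact: div_lift_const hC0 hD.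
Qed.

Lemma xi_plusE D P : (size P <= k.-1)%N ->
  xi_plus k F D P = (xi F D P + xi F (mx_div mx_neg D) (P \Po (- 'X))) / 2.
Proof. by move=> sP; rewrite /xi_plus poly_act_neg // -kE. Qed.

Lemma size_comp_neg (A : idomainType) (P : {poly A}) : size (P \Po (- 'X)) = size P.
Proof. by rewrite size_comp_poly2 // size_polyN size_polyX. Qed.

Lemma xi_plusD D E P : xi_plus k F (D + E) P = xi_plus k F D P + xi_plus k F E P.
Proof.
have xiD E1 E2 Q : xi F (E1 + E2) Q = xi F E1 Q + xi F E2 Q.
  by rewrite !xiE; exact: (raddfD (div_lift (Xi F Q))).
by rewrite /xi_plus raddfD /= !xiD -mulrDl addrACA.
Qed.

Lemma xi_plus_lin b P Q D : (size P <= k.-1)%N -> (size Q <= k.-1)%N ->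
  xi_plus k F D (b *: P + Q) = b * xi_plus k F D P + xi_plus k F D Q.
Proof.
move=> sP sQ; have sPQ : (size (b *: P + Q)%R <= k.-1)%N.
  apply: leq_trans (size_polyD _ _) _; rewrite geq_max sQ andbT.
  exact: leq_trans (size_scale_leq _ _) sP.
have sP' : (size (P \Po (- 'X)) <= k.-1)%N by rewrite size_comp_neg.
have sQ' : (size (Q \Po (- 'X)) <= k.-1)%N by rewrite size_comp_neg.
rewrite (xi_plusE _ sPQ) (xi_plusE _ sP) (xi_plusE _ sQ) comp_polyD comp_polyZ.
rewrite (xi_lin _ _ sP sQ) (xi_lin _ _ sP' sQ').
by rewrite mulrA -mulrDl mulrDr addrACA.
Qed.

(** Conjugation by diag (-1, 1) changes the sign of the translations, so that the two halves
    of [xi_plus] are the cases [e = 1] and [e = - 1] of [xi_Up]. *)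
Lemma xi_plus_Up P D : (size P <= k.-1)%N -> Delta0 D ->
  \sum_(b < p) xi_plus k F (mx_div (mx2 1 b%:Z 0 p%:Z) D) (P \Po (p%:R *: 'X - b%:R%:P)) =
  iinf (a p) * xi_plus k F D P.
Proof.
move=> sP hD; rewrite (xi_plusE _ sP) mulrA mulrDr.
have sN : (size (P \Po (- 'X)) <= k.-1)%N by rewrite size_comp_neg.
rewrite -(xi_Up (p1 (or_introl erefl)) sP hD).
rewrite -(xi_Up (p1 (or_intror erefl)) sN (Delta0_mx_div mx_neg hD)).
rewrite -big_split mulr_suml; apply: eq_bigr => b _ /=.
have sPb : (size (P \Po (p%:R *: 'X - b%:R%:P)) <= k.-1)%N.
  rewrite size_comp_poly2 // (_ : _ - _ = p%:R%:P * 'X + (- b%:R)%:P); last by rewrite mul_polyC polyCN.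
  by rewrite size_MXaddC polyC_eq0 pnatr_eq0 eqn0Ngt prime_gt0 //= size_polyC pnatr_eq0 eqn0Ngt prime_gt0.
have eM : mx_div mx_neg (mx_div (mx2 1 b%:Z 0 p%:Z) D) =
    mx_div (mx2 1 (- 1 * b%:Z) 0 p%:Z) (mx_div mx_neg D).
  rewrite -(mx_div_mul dN (dU _ p0)) -(mx_div_mul (dU _ p0) dN); congr (mx_div _ D).
  by rewrite /mx_neg !mulmx2; congr mx2; ring.
have eP : (P \Po (p%:R *: 'X - b%:R%:P)) \Po (- 'X) =
    (P \Po (- 'X)) \Po (p%:R *: 'X - (- 1 * b%:Z)%:~R%:P).
  rewrite -!comp_polyA; congr (P \Po _).
  rewrite !comp_polyB comp_polyZ comp_polyX comp_polyC -[- 'X]add0r comp_polyB comp_polyX comp_poly0 !add0r.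
  by rewrite scalerN mulN1r rmorphN /= polyCN opprK opprD -pmulrn.
by rewrite (xi_plusE _ sPb) eM eP (mul1r b%:Z) -pmulrn.
Qed.

Lemma xi_plus_Tl l D : prime l -> l != p -> Delta0 D ->
  \sum_(b < l) xi_plus k F (mx_div (mx2 1 b%:Z 0 l%:Z) D) 1 +
  l%:R ^+ (k - 2) * xi_plus k F (mx_div (mx2 l%:Z 0 0 1) D) 1 = iinf (a l) * xi_plus k F D 1.
Proof.
move=> pl lp hD; have l0 : l%:Z != 0 by rewrite eqz_nat -lt0n prime_gt0.
have l1 (e : int) : e = 1 \/ e = - 1 -> ~~ (l%:Z %| e)%Z.
  by move=> he; rewrite dvdzE /= (_ : `|e|%N = 1%N) ?dvdn1 ?neq_ltn ?prime_gt1 ?orbT //; case: he => ->.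
have s1 : (size (1%R : {poly C}) <= k.-1)%N by rewrite size_poly1 kE.
have E D' : xi_plus k F D' 1 = (xi F D' 1 + xi F (mx_div mx_neg D') 1) / 2.
  by rewrite (xi_plusE _ s1) comp_polyC.
have e1 := @xi_Tl l 1 D pl lp (l1 _ (or_introl erefl)) hD.
have e2 := @xi_Tl l (- 1) _ pl lp (l1 _ (or_intror erefl)) (Delta0_mx_div mx_neg hD).
move: E e1 e2; move: (xi F) (xi_plus k F) => X Y E e1 e2.
rewrite !E [in RHS]mulrA [in RHS]mulrDr -{}e1 -{}e2 (eq_bigr (fun b : 'I_l =>
  X (mx_div (mx2 1 (1 * b%:Z) 0 l%:Z) D) 1 / 2 +
  X (mx_div (mx2 1 (- 1 * b%:Z) 0 l%:Z) (mx_div mx_neg D)) 1 / 2)); last first.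
  move=> b _; rewrite E mul1r mulrDl; congr (_ + X _ _ / _).
  rewrite -(mx_div_mul dN (dU _ l0)) -(mx_div_mul (dU _ l0) dN); congr (mx_div _ D).
  by rewrite /mx_neg !mulmx2; congr mx2; ring.
have -> : mx_div mx_neg (mx_div (mx2 l%:Z 0 0 1) D) = mx_div (mx2 l%:Z 0 0 1) (mx_div mx_neg D).
  rewrite -(mx_div_mul dN (dD l0)) -(mx_div_mul (dD l0) dN); congr (mx_div _ D).
  by rewrite /mx_neg !mulmx2; congr mx2; ring.
by rewrite big_split -!mulr_suml /=; field.
Qed.

Lemma xi_plus_Gamma0 M D : Gamma0 p M -> Delta0 D ->
  xi_plus k F (mx_div M D) (denom_poly _ M) = xi_plus k F D 1.
Proof.
move=> hM hD; have s1 : (size (1%R : {poly C}) <= k.-1)%N by rewrite size_poly1 kE.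
have dM : \det M != 0 by case: hM => ->.
pose M' := mx2 (M 0 0) (- M 0 1) (- M 1 0) (M 1 1).
have hM' : Gamma0 p M'.
  by case: hM => hd hp; split; rewrite ?mx2E ?rpredN // det_mx2 -hd det_mx2E; ring.
have dM' : \det M' != 0 by case: hM' => ->.
have eM : mx_div mx_neg (mx_div M D) = mx_div M' (mx_div mx_neg D).
  rewrite -(mx_div_mul dN dM) -(mx_div_mul dM' dN); congr (mx_div _ D).
  by rewrite [M in LHS]mx2_eta /mx_neg !mulmx2; congr mx2; ring.
have eP : denom_poly C M \Po (- 'X) = denom_poly C M'.
  rewrite /denom_poly /M' !mx2E rmorphXn /= comp_polyB comp_polyC comp_polyZ comp_polyX.
  by rewrite rmorphN /= scalerN scaleNr.
rewrite (xi_plusE _ s1) (xi_plusE _ (size_denom_poly C M)) comp_polyC (xi_Gamma0 hM hD) eM eP.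
by rewrite (xi_Gamma0 hM' (Delta0_mx_div _ hD)).
Qed.

Lemma xi_plus_neg D : xi_plus k F (mx_div mx_neg D) 1 = xi_plus k F D 1.
Proof.
have s1 : (size (1%R : {poly C}) <= k.-1)%N by rewrite size_poly1 kE.
rewrite !(xi_plusE _ s1) comp_polyC addrC -(mx_div_mul dN dN) (_ : _ *m _ = 1%:M) ?mx_div1 //.
by rewrite /mx_neg mulmx2 [RHS]mx2_eta !mxE /=.
Qed.

(** ** Algebraic values *)

Definition alg_value D i : algC := alg_part iinf (xi_plus k F D 'X^i / Om).

Definition alg_symbol D (P : {poly algC}) : algC := \sum_(i < (k - 2).+1) P`_i * alg_value D i.

Lemma alg_valueE D i : Delta0 D -> (i <= k - 2)%N -> iinf (alg_value D i) = xi_plus k F D 'X^i / Om.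
Proof.
move=> hD hi; rewrite /alg_value /alg_part.
exact: (xgetPex 0 (period_algebraic hO hD hi)).
Qed.

Lemma alg_symbolE D (P : {poly algC}) : Delta0 D -> (size P <= k.-1)%N ->
  iinf (alg_symbol D P) = xi_plus k F D (map_poly iinf P) / Om.
Proof.
move=> hD sP; rewrite /alg_symbol rmorph_sum /=.
have sX n : (n <= k - 2)%N -> (size ('X^n : {poly C})%R <= k.-1)%N by rewrite size_polyXn kE.
have z0 : xi_plus k F D 0 = 0.
  have := @xi_plus_lin (- 1) 0 0 D; rewrite size_poly0 => /(_ isT isT).
  by rewrite scaler0 addr0 mulN1r addNr.
have sum_n n : (n <= k.-1)%N -> xi_plus k F D (\sum_(i < n) iinf P`_i *: 'X^i) =
    \sum_(i < n) iinf P`_i * xi_plus k F D 'X^i.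
  elim: n => [|n IH] hn; first by rewrite !big_ord0.
  rewrite !big_ord_recr /= addrC xi_plus_lin ?IH ?sX //; [by rewrite addrC|exact: ltnW|by rewrite -ltnS -kE|].
  apply: leq_trans (size_sum _ _ _) _; apply/bigmax_leqP => i _.
  apply: leq_trans (size_scale_leq _ _) _; apply: sX; rewrite -ltnS -kE.
  by apply: leq_trans (ltn_ord i) _; exact: ltnW.
have -> : map_poly iinf P = \sum_(i < k.-1) iinf P`_i *: 'X^i.
  rewrite -[LHS]coefK poly_def (big_ord_widen k.-1 (fun i => (map_poly iinf P)`_i *: 'X^i)) ?size_map_poly //.
  rewrite big_mkcond; apply: eq_bigr => i _ /=; rewrite coef_map /=; case: ltnP => // hi.
  by rewrite nth_default // rmorph0 scale0r.
rewrite sum_n // mulr_suml -kE; apply: eq_bigr => i _.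
rewrite rmorphM /= alg_valueE ?mulrA //.
by rewrite -ltnS -kE.
Qed.

Lemma alg_symbol_inj (x y : algC) : iinf x = iinf y -> x = y.
Proof. exact: fmorph_inj. Qed.

Let size_shift (A : numDomainType) (P : {poly A}) b : (size P <= k.-1)%N ->
  (size (P \Po (p%:R *: 'X - b%:P)) <= k.-1)%N.
Proof.
move=> sP; have pA : (p%:R : A) != 0 by rewrite pnatr_eq0 -lt0n prime_gt0.
rewrite size_comp_poly2 // (_ : _ - _ = p%:R%:P * 'X + (- b)%:P); last by rewrite mul_polyC polyCN.
by rewrite size_MXaddC polyC_eq0 (negbTE pA) /= size_polyC pA.
Qed.

Lemma alg_symbol_Up (P : {poly algC}) D : (size P <= k.-1)%N -> Delta0 D ->
  \sum_(b < p) alg_symbol (mx_div (mx2 1 b%:Z 0 p%:Z) D) (P \Po (p%:R *: 'X - b%:R%:P)) =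
  a p * alg_symbol D P.
Proof.
move=> sP hD; apply: alg_symbol_inj; rewrite rmorph_sum rmorphM /= (alg_symbolE hD sP).
have sP' : (size (map_poly iinf P) <= k.-1)%N by rewrite size_map_poly.
rewrite mulrA -(xi_plus_Up sP' hD) mulr_suml; apply: eq_bigr => b _.
rewrite (alg_symbolE (Delta0_mx_div _ hD) (size_shift _ sP)).
congr (xi_plus k F _ _ / Om); rewrite map_comp_poly rmorphB /= map_polyZ map_polyX map_polyC /=.
by rewrite !rmorph_nat.
Qed.

Lemma alg_symbol_Tl l D : prime l -> l != p -> Delta0 D ->
  \sum_(b < l) alg_symbol (mx_div (mx2 1 b%:Z 0 l%:Z) D) 1 +
  l%:R ^+ (k - 2) * alg_symbol (mx_div (mx2 l%:Z 0 0 1) D) 1 = a l * alg_symbol D 1.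
Proof.
move=> pl lp hD; apply: alg_symbol_inj.
have s1 : (size (1%R : {poly algC}) <= k.-1)%N by rewrite size_poly1 kE.
have E D' : Delta0 D' -> iinf (alg_symbol D' 1) = xi_plus k F D' 1 / Om.
  by move=> hD'; rewrite (alg_symbolE hD' s1) rmorph1.
have hL b := E _ (Delta0_mx_div (mx2 1 b 0 l%:Z) hD).
move: (E _ hD) (E _ (Delta0_mx_div (mx2 l%:Z 0 0 1) hD)) hL (xi_plus_Tl pl lp hD).
move: alg_symbol (xi_plus k F) => X Y e1 e2 e3 e.
rewrite rmorphD rmorph_sum !rmorphM /= e1 e2 rmorphXn rmorph_nat !mulrA -e mulrDl mulr_suml.
by congr (_ + _); apply: eq_bigr => b _; exact: e3.
Qed.

Lemma alg_symbol_Gamma0 M D : Gamma0 p M -> Delta0 D ->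
  alg_symbol (mx_div M D) (denom_poly _ M) = alg_symbol D 1.
Proof.
move=> hM hD; apply: alg_symbol_inj.
have s1 : (size (1%R : {poly algC}) <= k.-1)%N by rewrite size_poly1 kE.
rewrite (alg_symbolE hD s1) (alg_symbolE (Delta0_mx_div _ hD) (size_denom_poly _ M)).
rewrite rmorph1 -(xi_plus_Gamma0 hM hD).
congr (xi_plus k F _ _ / Om); rewrite /denom_poly rmorphXn rmorphB /= map_polyZ map_polyX map_polyC /=.
by rewrite !rmorph_int.
Qed.

Lemma alg_symbol_neg D : Delta0 D -> alg_symbol (mx_div mx_neg D) 1 = alg_symbol D 1.
Proof.
move=> hD; apply: alg_symbol_inj.
have s1 : (size (1%R : {poly algC}) <= k.-1)%N by rewrite size_poly1 kE.
rewrite (alg_symbolE hD s1) (alg_symbolE (Delta0_mx_div _ hD) s1).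
by rewrite rmorph1 xi_plus_neg.
Qed.

(** ** Values in [K] *)

Local Notation phi := (phi_plus iinf ip k F Om).

Lemma phiE D (P : {poly K}) : phi D P = \sum_(i < k.-1) P`_i * ip (alg_value D i).
Proof. by rewrite kE. Qed.

Lemma phi_map D (P : {poly algC}) : phi D (map_poly ip P) = ip (alg_symbol D P).
Proof.
by rewrite /alg_symbol rmorph_sum; apply: eq_bigr => i _; rewrite coef_map rmorphM.
Qed.

Lemma phi_lin D c (P Q : {poly K}) : phi D (c *: P + Q) = c * phi D P + phi D Q.
Proof.
rewrite !phiE mulr_sumr -big_split; apply: eq_bigr => i _ /=.
by rewrite coefD coefZ mulrDl mulrA.
Qed.

Lemma phi_sum D n (c : 'I_n -> K) (P : 'I_n -> {poly K}) :
  phi D (\sum_i c i *: P i) = \sum_i c i * phi D (P i).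
Proof.
elim/big_rec2: _ => [|i u w _ <-]; last by rewrite phi_lin.
by rewrite phiE big1 // => i _; rewrite coef0 mul0r.
Qed.

Lemma phiD D E (P : {poly K}) : Delta0 D -> Delta0 E -> phi (D + E) P = phi D P + phi E P.
Proof.
move=> hD hE; rewrite !phiE -big_split; apply: eq_bigr => i _ /=.
rewrite -mulrDr -rmorphD; congr (_ * ip _); apply: alg_symbol_inj.
have hi : (i <= k - 2)%N by rewrite -ltnS -kE.
rewrite rmorphD /= (alg_valueE hD hi) (alg_valueE hE hi) (alg_valueE (Delta0D hD hE) hi).
by rewrite xi_plusD; exact: mulrDl.
Qed.

(** Both sides are linear in [P], and on monomials the relation is one between algebraic
    numbers. *)
Lemma phi_Up (P : {poly K}) D : (size P <= k.-1)%N -> Delta0 D ->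
  \sum_(b < p) phi (mx_div (mx2 1 b%:Z 0 p%:Z) D) (P \Po (p%:R *: 'X - b%:R%:P)) =
  ip (a p) * phi D P.
Proof.
move=> sP hD; have PE : P = \sum_(i < k.-1) P`_i *: 'X^i.
  rewrite -[LHS]coefK poly_def (big_ord_widen k.-1 (fun i => P`_i *: 'X^i)) //.
  rewrite big_mkcond; apply: eq_bigr => i _ /=; case: ltnP => // hi.
  by rewrite nth_default // scale0r.
rewrite {1 2}PE phi_sum mulr_sumr.
under eq_bigr => b _ do rewrite raddf_sum /=.
rewrite (eq_bigr (fun b : 'I_p => \sum_(i < k.-1) P`_i *
  phi (mx_div (mx2 1 b%:Z 0 p%:Z) D) ('X^i \Po (p%:R *: 'X - b%:R%:P)))); last first.
  move=> b _; rewrite (eq_bigr (fun i : 'I_k.-1 => P`_i *: ('X^i \Po (p%:R *: 'X - b%:R%:P)))).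
    exact: phi_sum.
  by move=> i _; rewrite comp_polyZ.
rewrite exchange_big; apply: eq_bigr => i _ /=.
rewrite -mulr_sumr mulrCA; congr (_ * _).
have sX : (size ('X^i : {poly algC})%R <= k.-1)%N by rewrite size_polyXn.
have := congr1 ip (alg_symbol_Up sX hD).
rewrite rmorphM rmorph_sum /= -phi_map map_polyXn => <-; apply: eq_bigr => b _.
rewrite -phi_map map_comp_poly map_polyXn rmorphB /= map_polyZ map_polyX map_polyC /=.
by rewrite !rmorph_nat.
Qed.

Lemma phi_Tl l D : prime l -> l != p -> Delta0 D ->
  \sum_(b < l) phi (mx_div (mx2 1 b%:Z 0 l%:Z) D) 1 +
  l%:R ^+ (k - 2) * phi (mx_div (mx2 l%:Z 0 0 1) D) 1 = ip (a l) * phi D 1.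
Proof.
move=> pl lp hD; have E D' : phi D' 1 = ip (alg_symbol D' 1) by rewrite -phi_map rmorph1.
move: E (alg_symbol_Tl pl lp hD); move: phi alg_symbol => Y X E e.
rewrite !E -rmorphM -e rmorphD rmorphM rmorph_sum rmorphXn rmorph_nat /=.
by congr (_ + _); apply: eq_bigr => b _; rewrite E.
Qed.

Lemma phi_Gamma0 M D : Gamma0 p M -> Delta0 D -> phi (mx_div M D) (denom_poly _ M) = phi D 1.
Proof.
move=> hM hD; have := congr1 ip (alg_symbol_Gamma0 hM hD); rewrite -!phi_map rmorph1 => <-.
congr (phi _ _); rewrite /denom_poly rmorphXn rmorphB /= map_polyZ map_polyX map_polyC /=.
by rewrite !rmorph_int.
Qed.

Lemma phi_neg D : Delta0 D -> phi (mx_div mx_neg D) 1 = phi D 1.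
Proof. by move=> hD; have := congr1 ip (alg_symbol_neg hD); rewrite -!phi_map rmorph1. Qed.

(** * Congruences *)

Hypothesis hv : is_Qpbar p v.
Hypothesis hap : padic_unit v (ip (a p)).

Let p_neq0K : p%:R != 0 :> K. Proof. exact: (Qpbar_p_neq0 hv). Qed.

Lemma phi_integral D (P : {poly K}) : Delta0 D -> Pg v (k - 2) P -> padic_integral v (phi D P).
Proof. exact: (period_integral hO). Qed.

(** Substituting [p X - b] makes the nonconstant coefficients more divisible by [p]. *)
Lemma coef_shift (P : {poly K}) (b : nat) i : exists e : nat -> int,
  (P \Po (p%:R *: 'X - b%:R%:P))`_i = \sum_(j < size P) P`_j * (e j)%:~R /\
  ((0 < i)%N -> forall j, (p%:Z %| e j)%Z /\ e 0%N = 0).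
Proof.
pose S j : {poly int} := \sum_(t < j) (p%:Z *: 'X - b%:Z%:P) ^+ (j.-1 - t) * (- b%:Z%:P) ^+ t.
have hS j : (p%:Z *: 'X - b%:Z%:P) ^+ j = (- b%:Z)%:P ^+ j + p%:Z *: ('X * S j) :> {poly int}.
  rewrite polyCN scalerAl -[LHS](subrK ((- b%:Z%:P) ^+ j)) subrXX opprK subrK.
  by rewrite addrC.
exists (fun j => ((p%:Z *: 'X - b%:Z%:P : {poly int}) ^+ j)`_i); split; last first.
  move=> i0 j; rewrite expr0 coef1 eqn0Ngt i0; split=> //.
  rewrite hS coefD -rmorphXn coefC eqn0Ngt i0 add0r coefZ.
  by rewrite dvdz_mulr ?dvdzz.
rewrite comp_polyE coef_sum; apply: eq_bigr => j _; rewrite coefZ; congr (_ * _).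
rewrite -[RHS](coef_map intr) rmorphXn rmorphB /= map_polyZ map_polyX map_polyC /=.
by rewrite -!pmulrn.
Qed.

Lemma Pg_shift (P : {poly K}) b : Pg v (k - 2) P -> Pg v (k - 2) (P \Po (p%:R *: 'X - b%:R%:P)).
Proof.
move=> [sP cP eP]; split=> [|i|x hx].
- rewrite size_comp_poly2 // (_ : _ - _ = p%:R%:P * 'X + (- b%:R)%:P); last by rewrite mul_polyC polyCN.
  by rewrite size_MXaddC polyC_eq0 (negbTE p_neq0K) /= size_polyC p_neq0K.
- have [e [-> _]] := coef_shift P b i; apply: (Qp_sum hv ip) => j _.
  by rewrite mulrC; exact: (Qp_intM hv ip).
rewrite horner_comp !hornerE /=; apply: eP; apply: (ZpD hv ip).
  exact: (Zp_intM hv ip p hx).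
by have := Zp_int hv (- b%:Z); rewrite rmorphN.
Qed.

(** The operator U_p has a unit eigenvalue, and it replaces [P] by polynomials whose
    nonconstant coefficients are more divisible by [p]. After finitely many steps [P] is a
    constant plus [p] times an integer-valued polynomial. *)
Lemma phi_one_max : (forall D, Delta0 D -> in_max v (phi D 1)) ->
  forall D (P : {poly K}), Delta0 D -> Pg v (k - 2) P -> in_max v (phi D P).
Proof.
move=> h1.
(* Up to one power of [p], [N] bounds the denominators of the nonconstant coefficients. *)
suff step N : forall (P : {poly K}) D, Pg v (k - 2) P -> Delta0 D ->
    (forall i, (0 < i)%N -> ord_ge v 1 (p%:R ^+ N * P`_i)) -> in_max v (phi D P).
  move=> D P hD hP.
  have bnd (x : K) : exists N : nat, forall M : nat, (N <= M)%N -> ord_ge v 1 (p%:R ^+ M * x).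
    have pow (M : nat) : ord_ge v M%:R (p%:R ^+ M : K).
      elim: M => [|M IH]; first by rewrite expr0; exact: (integral1 hv).
      rewrite exprS -natr1 addrC; apply: (ord_geM hv) => //.
      by rewrite /ord_ge (Qpbar_ord_p hv) lexx orbT.
    exists (Num.bound `|v x|).+1 => M hM.
    have hx : ord_ge v (v x) x by rewrite /ord_ge lexx orbT.
    apply: ord_ge_le (ord_geM hv (pow M) hx).
    have hb := archi_boundP (normr_ge0 (v x)); have := ler_norm (- v x); rewrite normrN.
    have : ((Num.bound `|v x|).+1%:R : rat) <= M%:R by rewrite ler_nat.
    by rewrite -natr1; move: hb; set c := _%:R; set d := _%:R; lra.
  have [N hN] : exists N, forall i, (i < size P)%N -> ord_ge v 1 (p%:R ^+ N * P`_i).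
    elim: (size P) => [|n [N hN]]; first by exists 0%N.
    have [N' hN'] := bnd P`_n; exists (maxn N N') => i; rewrite ltnS leq_eqVlt.
    case/orP => [/eqP->|/hN h]; first by apply: hN'; exact: leq_maxr.
    have [M ->] : exists M : nat, maxn N N' = (M + N)%N by exists (maxn N N' - N)%N; rewrite subnK // leq_maxl.
    rewrite exprD -mulrA -[1]add0r; apply: (ord_geM hv) => //.
    by apply: (integralX hv); exact: (integral_nat hv).
  apply: (step N) => // i _; have [/hN //|hi] := ltnP i (size P).
  by rewrite nth_default // mulr0 ord_ge0.
elim: N => [|N IH] P D hP hD hc'.
  (* [Q] has integral coefficients. *)
  pose Q := p%:R^-1 *: (P - (P`_0)%:P).
  have hQ : Pg v (k - 2) Q.
    have [sP cP _] := hP; apply: (Zp_coef_Pg hv ip) => [|i].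
      apply: leq_trans (size_scale_leq _ _) _; apply: leq_trans (size_polyD _ _) _.
      by rewrite geq_max sP size_polyN (leq_trans (size_polyC_leq1 _)).
    rewrite coefZ coefB coefC; case: (posnP i) => [->|i0].
      by rewrite subrr mulr0; exact: (Zp_int hv 0).
    rewrite subr0 mulrC; split; first exact: (Qp_divp hv ip).
    by rewrite (integral_divp hv); have := hc' i i0; rewrite expr0 mul1r.
  have -> : P = P`_0 *: 1 + (p%:R *: Q + 0).
    by rewrite addr0 scalerA divff // scale1r alg_polyC addrC subrK.
  rewrite phi_lin phi_lin [phi D 0](_ : _ = 0) ?addr0; last first.
    by rewrite phiE big1 // => i _; rewrite coef0 mul0r.
  apply: (maxD hv).
    apply: (maxMr hv); last exact: h1.
    have [_ _ eP] := hP; have := eP 0 (Zp_int hv 0); rewrite horner_coef0.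
    by case.
  by apply: (maxMl hv); [exact: (max_p hv)|exact: phi_integral].
have : in_max v (ip (a p) * phi D P).
  rewrite -phi_Up //; last by case: hP; rewrite kE.
  apply: (max_sum hv) => b _; apply: IH => [||i i0].
  - exact: Pg_shift.
  - exact: Delta0_mx_div.
  have [e [-> /(_ i0) he]] := coef_shift P b i.
  rewrite mulr_sumr; elim/big_ind: _ => [|x y hx hy|j _]; first exact: ord_ge0.
    exact: (ord_geD hv).
  have [/dvdzP[q qE] e0] := he j; case: (posnP j) => [j0|j0]; first by rewrite j0 e0 mulr0 mulr0 ord_ge0.
  rewrite qE rmorphM /= -pmulrn.
  have -> : p%:R ^+ N * (P`_j * (q%:~R * p%:R)) = p%:R ^+ N.+1 * P`_j * q%:~R by rewrite exprS; ring.
  by rewrite -[1]addr0; apply: (ord_geM hv); [exact: hc'|exact: (integral_int hv)].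
have /andP[oa na] : padic_integral v (ip (a p)) && ~~ in_max v (ip (a p)) by rewrite -unitP.
by case/(max_prime hv oa (phi_integral hD hP))/orP => // h; rewrite h in na.
Qed.

(** ** The reduction of the symbol *)

Hypothesis hap1 : in_max v (ip (a p) - 1).
Hypothesis hal : forall l, prime l -> l != p -> in_max v (ip (a l) - (1 + l%:R ^+ k.-1)).
Variables (h : nat) (hp : (h < p)%N) (h_gt0 : (0 < h)%N) (h_even : ~~ odd h).
Hypothesis hk : (k - 2 = h %[mod p.-1])%N.
Hypothesis m1 : mult_one_mod_p p v h.+2.

Let P1 : Pg v (k - 2) 1. Proof. exact: (Pg1 hv). Qed.
Let s1 : (size (1%R : {poly K}) <= k.-1)%N. Proof. by rewrite size_poly1 kE. Qed.

(** [M] is upper triangular modulo [p]. *)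
Lemma phi_denom_poly M D : Gamma0 p M -> Delta0 D ->
  in_max v (phi D (denom_poly K M) - (M 0 0)%:~R ^+ (k - 2) * phi D 1).
Proof.
move=> [_ /dvdzP[q qE]] hD.
pose x : {poly int} := (M 0 0)%:P - (M 1 0) *: 'X.
pose S : {poly int} := \sum_(t < k - 2) x ^+ ((k - 2).-1 - t) * (M 0 0)%:P ^+ t.
have hS : x ^+ (k - 2) = (M 0 0)%:P ^+ (k - 2) + p%:Z *: (- q *: ('X * S)).
  rewrite -[LHS](subrK ((M 0 0)%:P ^+ (k - 2))) subrXX -/S addrC; congr (_ + _).
  rewrite /x addrAC subrr sub0r scalerA mulrN -scaleNr -scalerAl qE mulrC.
  by rewrite mulrC.
have hdp : denom_poly K M = (M 0 0)%:~R ^+ (k - 2) *: 1 + (p%:R *: map_poly intr (- q *: ('X * S)) + 0).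
  have -> : denom_poly K M = map_poly intr (x ^+ (k - 2)).
    by rewrite rmorphXn rmorphB /= map_polyZ map_polyX map_polyC.
  by rewrite hS rmorphD /= rmorphXn /= map_polyC /= map_polyZ addr0 alg_polyC -rmorphXn.
have sS : (size (- q *: ('X * S))%R <= (k - 2).+1)%N.
  have hx n : (size (x ^+ n)%R <= n.+1)%N.
    have := size_linear_exp (M 0 0) (- M 1 0) n; rewrite scaleNr /=; exact.
  apply: leq_trans (size_scale_leq _ _) _; apply: leq_trans (size_mul_leq _ _) _.
  rewrite size_polyX /= ltnS; apply: (leq_trans (size_sum _ _ _)); apply/bigmax_leqP => t _.
  rewrite -rmorphXn mulrC mul_polyC; apply: leq_trans (size_scale_leq _ _) _.
  by apply: leq_trans (hx _) _; have := ltn_ord t; lia.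
rewrite hdp phi_lin phi_lin [phi D 0](_ : _ = 0) ?addr0; last first.
  by rewrite phiE big1 // => i _; rewrite coef0 mul0r.
rewrite addrAC subrr add0r; apply: (maxMl hv); first exact: (max_p hv).
by apply: phi_integral => //; exact: (int_poly_Pg hv ip).
Qed.

(** Otherwise, a linear form on the residues turns the values at the constant polynomial
    into a nonzero symbol over the prime field to which [constant_symbol_vanish] applies. *)
Lemma phi_infty_unit : padic_unit v (phi (pt None - pt (Some 0)) 1).
Proof.
have oD0 := Delta0_ptB None (Some 0); set D0 := pt None - pt (Some 0) in oD0 *.
rewrite unitP (phi_integral oD0 P1); apply/negP => mD0.
have [D1 hD1 nD1] : exists2 D, Delta0 D & ~~ in_max v (phi D 1).
  apply: contrapT => none; have [D [P [hD hP]]] := period_unit hO.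
  rewrite unitP => /andP[_ /negP[]]; apply: phi_one_max => // E hE.
  by apply: contrapT => /negP nE; apply: none; exists E.
have [lam [lamD lam0 nlam]] := residue_form pp hv (phi_integral hD1 P1) nD1.
have lam_eq x y : padic_integral v y -> in_max v (x - y) -> lam x = lam y.
  move=> hy hxy; rewrite -[x](subrK y) lamD ?(lam0 _ hxy) ?add0r //.
  exact: max_integral.
have lam_sum l (x : nat -> K) : (forall b, (b < l)%N -> padic_integral v (x b)) ->
    lam (\sum_(b < l) x b) = \sum_(b < l) lam (x b).
  elim: l => [|l IH] hx; first by rewrite !big_ord0 lam0 //; exact: (max0 v).
  have hx' b : (b < l)%N -> padic_integral v (x b) by move=> hb; apply: hx; exact: ltnW.
  rewrite !big_ord_recr /= lamD ?(IH hx') //; last by apply: hx; exact: ltnSn.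
  by apply: (integral_sum hv) => b _; exact: hx'.
have lamN x : padic_integral v x -> lam (- x) = - lam x.
  move=> hx; apply: (addrI (lam x)); rewrite -lamD ?(integralN hv) // !subrr.
  by apply: lam0; exact: (max0 v).
have lamMn (n : nat) x : padic_integral v x -> lam (n%:R * x) = n%:R * lam x.
  move=> hx; elim: n => [|n IH]; first by rewrite !mul0r lam0 //; exact: (max0 v).
  rewrite -!natr1 !mulrDl !mul1r lamD ?IH //.
  by apply: (integralM hv) => //; exact: (integral_nat hv).
have lamMz (n : int) x : padic_integral v x -> lam (n%:~R * x) = n%:~R * lam x.
  move=> hx; case: (intP n) => [|m|m]; first exact: (lamMn 0%N).
    exact: (lamMn m.+1).
  rewrite !rmorphN !mulNr lamN; first by congr (- _); exact: (lamMn m.+1).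
  by apply: (integralM hv) => //; exact: (integral_int hv).
have Ophi D : Delta0 D -> padic_integral v (phi D 1) by move=> hD; exact: phi_integral.
pose psi : {additive divisor -> 'F_p} := div_lift (fun c => lam (phi (pt c - pt None) 1)).
have psiE D : Delta0 D -> psi D = lam (phi D 1).
  move=> hD; rewrite (@Delta0_lift _ (fun D => lam (phi D 1))) // => E E' hE hE'.
  by rewrite phiD // lamD //; exact: Ophi.
have OT M D : Delta0 D -> padic_integral v (phi (mx_div M D) 1).
  by move=> hD; apply: Ophi; exact: Delta0_mx_div.
move/negP: nlam; apply; rewrite -psiE //.
have F_exp (x : 'F_p) : x != 0 -> x ^+ (k - 2) = x ^+ h.
  by move=> x0; exact: (Fp_exp_mod pp x0 hk).
apply/eqP; apply: (@constant_symbol_vanish p pp K v hv ip h hp h_gt0 h_even psi m1) => //.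
- move=> D hD; rewrite psiE //.
  rewrite (eq_bigr (fun b : 'I_p => lam (phi (mx_div (mx2 1 b%:Z 0 p%:Z) D) 1))); last first.
    by move=> b _; rewrite psiE //; exact: Delta0_mx_div.
  rewrite -(lam_sum p (fun b => phi (mx_div (mx2 1 b%:Z 0 p%:Z) D) 1)) => [|b _]; last exact: OT.
  have := phi_Up s1 hD; under eq_bigr => b _ do rewrite comp_polyC polyC1.
  move=> ->; apply: lam_eq; first exact: Ophi.
  by rewrite -{2}[phi D 1]mul1r -mulrBl; apply: (maxMl hv) => //; exact: Ophi.
- move=> M D hM hD; rewrite !psiE //; last exact: Delta0_mx_div.
  have M0 : (M 0 0)%:~R != 0 :> 'F_p.
    rewrite (Fp_int_eq0 pp); case: hM => hd hp10; apply/negP => hp00.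
    have : (p%:Z %| \det M)%Z by rewrite det_mx2E rpredB //; [exact: dvdz_mulr|exact: dvdz_mull].
    by rewrite hd dvdzE /= dvdn1 => /eqP e1; have := prime_gt1 pp; rewrite e1.
  rewrite -F_exp // -rmorphXn -lamMz; last exact: OT.
  rewrite -(phi_Gamma0 hM hD); symmetry; apply: lam_eq.
    by apply: (integralM hv); [exact: (integral_int hv)|exact: OT].
  by rewrite rmorphXn; apply: phi_denom_poly => //; exact: Delta0_mx_div.
- by move=> D hD; rewrite !psiE ?phi_neg //; exact: Delta0_mx_div.
- move=> l D pl lp hD; rewrite !psiE //; last exact: Delta0_mx_div.
  rewrite (eq_bigr (fun b : 'I_l => lam (phi (mx_div (mx2 1 b%:Z 0 l%:Z) D) 1))); last first.
    by move=> b _; rewrite psiE //; exact: Delta0_mx_div.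
  rewrite -(lam_sum l (fun b => phi (mx_div (mx2 1 b%:Z 0 l%:Z) D) 1)) => [|b _]; last exact: OT.
  have l0 : l%:R != 0 :> 'F_p by rewrite (Fp_nat_eq0 pp) dvdn_prime2 // eq_sym.
  rewrite exprS -(F_exp _ l0) -exprS -kE -!natrX -[1 in RHS]/(1%:R) -natrD.
  rewrite -lamMn; last exact: OT.
  rewrite -lamD; last 2 first.
  + by apply: (integral_sum hv) => b _; exact: OT.
  + by apply: (integralM hv); [exact: (integral_nat hv)|exact: OT].
  rewrite natrX (phi_Tl pl lp hD) -lamMn; last exact: Ophi.
  apply: lam_eq; first by apply: (integralM hv); [exact: (integral_nat hv)|exact: Ophi].
  by rewrite natrD natrX -mulrBl; apply: (maxMl hv); [exact: hal|exact: Ophi].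
- by rewrite psiE //; exact: lam0.
Qed.

(** The whole of [1 + p Z_p] is the image of all balls [a + p Z_p] with [a] prime to [p]. By
    U_p at [oo - 0], the values at [oo - a / p], with [a = 0] included, add up to [f p]
    times the value at [oo - 0]. *)
Lemma total_mass f : f p = ip (a p) ->
  Lp_plus_omega0 p v iinf ip k f F Om 1 1 = (f p)^-1 * ((f p - 1) * phi (pt None - pt (Some 0)) 1).
Proof.
move=> fp; have p_gt0 := prime_gt0 pp.
have oD0 := Delta0_ptB None (Some 0).
have U b : mx_div (mx2 1 b%:Z 0 p%:Z) (pt None - pt (Some 0)) =
    pt None - pt (Some (b%:R / p%:R ^+ 1)).
  have pQ : p%:R != 0 :> rat by rewrite pnatr_eq0 -lt0n.
  have c1 : mx_cusp (mx2 1 b%:Z 0 p%:Z) (Some 0) = Some (b%:R / p%:R ^+ 1).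
    by rewrite /mx_cusp !mx2E !mulr0 !add0r -!pmulrn (negbTE pQ).
  by rewrite raddfB /= !mx_div_pt c1 /mx_cusp mx2E eqxx.
have := phi_Up s1 oD0; under eq_bigr => b _ do rewrite comp_polyC polyC1 U.
rewrite (bigD1 (Ordinal p_gt0)) //= mul0r -fp => hsum.
have {}hsum : \sum_(i < p | i != Ordinal p_gt0) phi (pt None - pt (Some (i%:R / p%:R))) 1 =
    (f p - 1) * phi (pt None - pt (Some 0)) 1.
  by rewrite mulrBl mul1r -hsum [RHS]addrC addKr.
rewrite -hsum /Lp_plus_omega0 /Lp_plus mulr_sumr expn1 !expr1.
apply: eq_bigl => b; have hb := ltn_ord b.
case: (posnP b) => [b0|b0].
  rewrite -val_eqE /= b0 eqxx /=; apply/negbTE; rewrite negb_and; apply/orP; left.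
  by rewrite /coprime gcd0n neq_ltn prime_gt1 ?orbT.
have cb : coprime b p by rewrite coprime_sym prime_coprime // gtnNdvd.
by rewrite cb /= (teichmuller_close pp hv) // -val_eqE /= -lt0n b0.
Qed.

End Symbol.

(** * The theorem *)

Lemma eis_ord_prime p k l : prime p -> prime l ->
  eis_ord p k l = if l == p then 1 else 1 + l%:R ^+ k.-1.
Proof.
move=> pp pl; have l0 := prime_gt0 pl; have l1 := prime_gt1 pl.
have dE : perm_eq (divisors l) [:: 1%N; l].
  apply: uniq_perm; first exact: divisors_uniq.
    by rewrite /= inE neq_ltn l1.
  move=> d; rewrite -dvdn_divisors // !inE; case/primeP: pl => _ h.
  by apply/idP/idP => [/h|/orP[/eqP->|/eqP->]].
rewrite /eis_ord eqn0Ngt l0 /= (perm_big _ dE) !big_cons big_nil.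
rewrite dvdn1 (gtn_eqF (prime_gt1 pp)) /= expr1n dvdn_prime2 // [p == l]eq_sym.
by case: eqP => _ /=; rewrite addr0.
Qed.

Theorem theorem1p2 (R : realType) (p j j0 : nat)
    (K : closedFieldType) (v : K -> rat)
    (iinf : {rmorphism algC -> R[i]}) (ip : {rmorphism algC -> K}) :
  is_Qpbar p v ->
  irregular_pair p j ->
  (2 <= j0)%N -> (j0 + 3 <= p)%N -> (j0 = j %[mod p.-1])%N ->
  mult_one_mod_p p v j0 ->
  forall k : nat, (2 <= k)%N -> (k = j %[mod p.-1])%N ->
  forall (f : nat -> K) (F : R[i] -> R[i]),
    cusp_form p k F ->
    q_expansion_in iinf ip F f ->
    normalized_eigenform p k f ->
    padic_unit v (f p) ->
    (forall n, in_max v (f n - ratr (eis_ord p k n))) ->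
  forall (w : K) (Om : R[i]),
    uniformizer v f w ->
    canonical_period v iinf ip k F Om ->
    (mu_invariant p v iinf ip k f F Om w <= ord_unif R v f w (f p - 1))%E.
Proof.
move=> hv [pp j2 jodd _] hj0 hj0p hj0j m1 k hk2 hkj f F hc [a [hq fa]] [f1 feig] fpu fE w Om huw hO.
have op : odd p by case: (even_prime pp) => // e; move: hj0 hj0p; rewrite e; clear; lia.
have par i : (i = j %[mod p.-1])%N -> ~~ odd i.
  move=> hi; have p1odd : ~~ odd p.-1 by rewrite -subn1 oddB ?prime_gt0 // op.
  have e n : odd (n %% p.-1) = odd n.
    by rewrite [in RHS](divn_eq n p.-1) oddD oddM (negbTE p1odd) andbF.
  by rewrite -e hi e.
have k_even := par _ hkj; have j0_even := par _ hj0j.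
have [h j0E] : exists h, j0 = h.+2 by exists (j0 - 2)%N; rewrite -addn2 subnK.
have h_gt0 : (0 < h)%N.
  case: (posnP h) => // h0; rewrite j0E h0 in m1.
  case: (mult_one_weight2 ip pp _ hv m1).
  by move: hj0 hj0p; clear; lia.
have h_even : ~~ odd h by move: j0_even; rewrite j0E /= negbK.
have hkh : (k - 2 = h %[mod p.-1])%N.
  apply/eqP; rewrite -(eqn_modDr 2) subnK // addn2 -j0E; apply/eqP.
  by rewrite hkj hj0j.
have eigE l : prime l -> forall n, hecke_q p k l f n = f l * f n.
  move=> pl n; have [c hcl] := feig l pl; rewrite hcl; congr (_ * _).
  have := hcl 1%N; rewrite /hecke_q muln1 f1 mulr1 dvdn1 (gtn_eqF (prime_gt1 pl)) andbF addr0.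
  by move=> ->.
have hU n : a (p * n)%N = a p * a n.
  apply: (fmorph_inj ip); rewrite rmorphM /= -!fa -(eigE p pp) /hecke_q eqxx /= addr0 //.
have hT l n : prime l -> l != p ->
    a (l * n)%N + (if (l %| n)%N then l%:R ^+ k.-1 * a (n %/ l)%N else 0) = a l * a n.
  move=> pl lp; apply: (fmorph_inj ip); rewrite rmorphM /= -!fa -(eigE l pl) /hecke_q lp /= rmorphD /= -fa.
  by congr (_ + _); case: ifP => _; rewrite ?rmorph0 // rmorphM rmorphXn rmorph_nat /= -fa.
have ap0 : a p != 0 by rewrite -(fmorph_eq0 ip) -fa (unit_neq0 fpu).
have hap : padic_unit v (ip (a p)) by rewrite -fa.
have ratr1 : ratr 1 = 1 :> K by exact: (ratr_int K 1).
have hap1 : in_max v (ip (a p) - 1).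
  by have := fE p; rewrite eis_ord_prime // eqxx ratr1 fa.
have hal l : prime l -> l != p -> in_max v (ip (a l) - (1 + l%:R ^+ k.-1)).
  move=> pl lp; have := fE l; rewrite eis_ord_prime // (negbTE lp) fa.
  have -> : 1 + l%:R ^+ k.-1 = (1 + l ^ k.-1)%:R :> rat by rewrite natrD natrX.
  by rewrite ratr_nat natrD natrX.
have hph : (h < p)%N by move: hj0p; rewrite j0E; clear; lia.
rewrite j0E in m1.
have uu := phi_infty_unit pp hk2 k_even hc hq hU hT ap0 hO hv hap hap1 hal hph h_gt0 h_even hkh m1.
have mass := total_mass pp hk2 k_even hc hq hU ap0 hO hv (fa p).
set u := phi_plus iinf ip k F Om (pt None - pt (Some 0)) 1 in uu mass.
have [w0 [wf _] _ _] := huw.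
rewrite /mu_invariant /ord_unif /sup_nat; apply: le_ereal_sup; apply: image_subset => n.
(* If [w ^+ n] divides the measure, it divides the total mass. *)
move=> [lam hlam hdiv]; have [Olam _ _] := hlam 1%N 1%N isT erefl.
have fp0 := unit_neq0 fpu; have u0 := unit_neq0 uu; have wn0 : w ^+ n != 0 by rewrite expf_neq0.
have e : f p - 1 = w ^+ n * (f p * lam 1%N 1%N / u).
  have := hdiv 1%N 1%N isT erefl; rewrite mass => e1.
  have -> : w ^+ n * (f p * lam 1%N 1%N / u) = f p * (w ^+ n * lam 1%N 1%N) / u by ring.
  by rewrite -e1; field; rewrite fp0 u0.
exists (f p * lam 1%N 1%N / u) => //; split.
  (* The quotient is in the coefficient field as [f p - 1] and [w] are. *)
  move=> S hS QpS fS; have [S1 SB SM SV] := hS.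
  have Sw : S w by exact: wf.
  have Swn : S (w ^+ n) by elim: (n) => [|m IH]; rewrite ?expr0 // exprS; exact: SM.
  have -> : f p * lam 1%N 1%N / u = (f p - 1) / w ^+ n by rewrite e [RHS]mulrC mulKf.
  by apply: SM; [exact: SB|exact: SV].
apply: (unit_div hv uu); apply: (integralM hv) => //.
by move: fpu; rewrite unitP => /andP[].
Qed.
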